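(* Let $h\ge 2$ be an integer and let $G=G(n,r(n),h)$ be an $h$-layered random geometric graph on $n$ vertices with radius $r(n)$. If $$r(n)\ge b\left(\frac{\log n}{n^{h-1}}\right)^{1/(2h)}$$ for a constant $b>\left(\frac{2^{2+3(h-1)}}{\pi^3}\right)^{1/(2h)}$, then with high probability $G$ is rainbow connected. Moreover, if $$r(n)\le c\left(\frac{\log n}{n^{h-1}}\right)^{1/(2h)}$$ for a constant $c<\frac{2}{3\pi}\left(\frac{1}{2\pi}\right)^{h-1}$, then with high probability $G$ is not rainbow connected.
   Context: A multilayered random geometric graph $G(n,r(n),h)$ is the edge-colored multigraph on a vertex set $V$ with $|V|=n$ obtained as follows: for each layer $k\in\{1,\dots,h\}$ and each vertex $v\in V$, a position $b_k(v)\in[0,1]^2$ is chosen uniformly at random, all these choices being independent. For each $k$ and each pair of distinct vertices $u,v$, there is an edge $uv$ of color $k$ if and only if the Euclidean distance between $b_k(u)$ and $b_k(v)$ is at most $r(n)$. Thus the color-$k$ edges form a random geometric graph (the $k$-th layer), and the layers are independent. A path is rainbow if its edges have pairwise distinct colors; the multigraph is rainbow connected if every pair of distinct vertices is joined by a rainbow path. ''With high probability'' means with probability tending to $1$ as $n\to\infty$. Here $\log$ denotes the natural logarithm. *)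

(* Defs.v *)
From HB Require Import structures.
From mathcomp Require Import all_boot all_order all_algebra.
From mathcomp Require Import all_classical all_reals all_analysis.
Set Implicit Arguments. Unset Strict Implicit. Unset Printing Implicit Defensive.
Import Order.TTheory GRing.Theory Num.Theory.
Import numFieldNormedType.Exports.
Local Open Scope classical_set_scope.
Local Open Scope ring_scope.

Definition unit_square (R : realType) : set (R * R) :=
  [set x | (0 <= x.1 <= 1) /\ (0 <= x.2 <= 1)].

Definition edist (R : realType) (x y : R * R) : R :=
  Num.sqrt ((x.1 - y.1) ^+ 2 + (x.2 - y.2) ^+ 2).

Definition leb2 (R : realType) : set (R * R) -> \bar R :=
  ((@lebesgue_measure R) \x (@lebesgue_measure R))%E.

Definition rgg_edge (R : realType) (h n : nat) (pos : 'I_h -> 'I_n -> R * R)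
  (r : R) (k : 'I_h) (u v : 'I_n) : bool :=
  (u != v) && (edist (pos k u) (pos k v) <= r).

(* A rainbow path from u to v: vertices u = w_0, w_1 = vs_0, ..., w_m = vs_(m-1) = v,
   pairwise distinct, the i-th edge w_(i-1) w_i having colour cs_(i-1),
   with the colours pairwise distinct. *)
Definition rainbow_path (h n : nat) (adj : 'I_h -> 'I_n -> 'I_n -> bool)
  (u v : 'I_n) (vs : seq 'I_n) (cs : seq 'I_h) : Prop :=
  [/\ size cs = size vs, uniq (u :: vs), uniq cs, last u vs = v &
      all (fun t => adj t.2.2 t.1 t.2.1) (zip (u :: vs) (zip vs cs))].

Definition rainbow_connected (h n : nat) (adj : 'I_h -> 'I_n -> 'I_n -> bool) : Prop :=
  forall u v : 'I_n, u != v -> exists vs cs, rainbow_path adj u v vs cs.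

Definition iid_uniform_positions (R : realType) (d : measure_display)
  (Omega : measurableType d) (P : probability Omega R) (h n : nat)
  (pos : 'I_h -> 'I_n -> Omega -> R * R) : Prop :=
  (forall k v, measurable_fun setT (pos k v)) /\
  (forall A : 'I_h -> 'I_n -> set (R * R),
     (forall k v, measurable (A k v)) ->
     P [set w | forall k v, A k v (pos k v w)] =
     (\prod_(k < h) \prod_(v < n) @leb2 R (A k v `&` @unit_square R))%E).

Definition rainbow_event (R : realType) (d : measure_display)
  (Omega : measurableType d) (h n : nat) (pos : 'I_h -> 'I_n -> Omega -> R * R)
  (r : R) : set Omega :=
  [set w | rainbow_connected (rgg_edge (fun k v => pos k v w) r)].

(* Main.v *)
Require Import Defs.
From HB Require Import structures.
From mathcomp Require Import all_boot all_order all_algebra.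
From mathcomp Require Import all_classical all_reals all_analysis.
From mathcomp Require Import measurable_realfun ring lra zify.
Import Order.TTheory GRing.Theory Num.Theory.
Import numFieldNormedType.Exports.
Local Open Scope classical_set_scope.
Local Open Scope ring_scope.

(** Both parts discretise the square into M x M cells, so that a configuration
    is a uniform finite function and probabilities become averages over a finite
    type.

    Above the threshold, cells have side at most r / 20, and a vertex is adjacent
    to all vertices in a disk of cells around its own cell.  For h >= 3 layers,
    fix the order of the colours and follow a walk from its far end: if every set
    S of at most m vertices fails to reach v through the last k layers with
    probability at most (1 - x) ^ |S| + d, then revealing one more layer gives a
    bound of the same shape with x multiplied by nearly n times the area of a
    disk; after h layers this beats the union bound over pairs.  For h = 2 a vertex
    can join u to v with the colours in either order, and the failure probability
    given the positions of u and v is bounded by a product over the two orders.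
    The loss at the boundary (half or quarter disks) is absorbed by pi ^ 3 <= 32.

    Below the threshold, cells have side at least r, so adjacent vertices lie in
    adjacent cells.  Fix u and reserve a set W of n ^ (1/(4h)) vertices.  For each
    colour k, explore from u, outside W, along the rainbow walks avoiding k; the
    cells of layer k next to the vertices found leave a non-negligible part of
    the grid uncovered, hence some v in W avoids all of them in every layer at once.
    With no rainbow walk joining two vertices of W, no rainbow path joins u to v. *)

Set Implicit Arguments.
Unset Strict Implicit.
Unset Printing Implicit Defensive.

(** * Averages over finite types *)

Section Averages.
Variable R : realFieldType.

(** The union bound over pairs needs a failure probability below n ^ -2. Counting only quarter
    disks, one colour order fails with probability about n ^ -(g ^ h), where g = 0.71 b ^ 2 and the
    hypothesis on b gives g ^ h >= 5.68 ^ h / 64. This is 2.86 for h = 3 but only 0.504 for h = 2,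
    so the worst position may be assumed everywhere only when h >= 3. For h = 2, half disks away
    from the corners give n ^ -2.016 with one order. A vertex falls near a corner with probability
    about n ^ -(1/2), and one order then fails with probability n ^ -1.008, in total only n ^
    -1.508. With both orders the average becomes the square of n ^ -1.008 + n ^ -1.004 + n ^ -1.252
    (up to logarithms), which suffices. Below the threshold the size of W is squeezed from two
    sides. A vertex of W escapes all layers with probability at least about mu ^ h, where mu bounds
    the uncovered proportion of a layer, so |W| must exceed mu ^ -h; and |W| ^ 2 must stay below n ^
    (1/h) / log n, so that chains of at most h - 1 colours link no two of its vertices. With Q = n ^
    (1/(8h)), mu ^ -h is at most Q, and |W| about Q ^ 2 meets both demands. *)

Definition avg (T : finType) (F : T -> R) : R := (#|T|%:R)^-1 * \sum_x F x.

Definition pr (T : finType) (A : pred T) : R := avg (fun x => (A x)%:R).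

Lemma eq_avg (T : finType) (F G : T -> R) : F =1 G -> avg F = avg G.
Proof. by move=> FG; rewrite /avg; congr (_ * _); apply: eq_bigr => x _. Qed.

Lemma ler_avg (T : finType) (F G : T -> R) :
  (forall x, F x <= G x) -> avg F <= avg G.
Proof.
by move=> FG; rewrite ler_wpM2l ?invr_ge0 ?ler0n//; apply: ler_sum => x _.
Qed.

Lemma avgD (T : finType) (F G : T -> R) :
  avg (fun x => F x + G x) = avg F + avg G.
Proof. by rewrite /avg big_split mulrDr. Qed.

Lemma avgMl (T : finType) (a : R) (F : T -> R) :
  avg (fun x => a * F x) = a * avg F.
Proof. by rewrite /avg -mulr_sumr mulrCA. Qed.

Lemma avgMr (T : finType) (a : R) (F : T -> R) :
  avg (fun x => F x * a) = avg F * a.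
Proof. by rewrite /avg -mulr_suml mulrA. Qed.

Lemma avg_sum (T J : finType) (F : J -> T -> R) :
  avg (fun x => \sum_j F j x) = \sum_j avg (F j).
Proof. by rewrite /avg exchange_big mulr_sumr. Qed.

Lemma avg_cst (T : finType) (a : R) : (0 < #|T|)%N -> avg (fun _ : T => a) = a.
Proof.
move=> T0; rewrite /avg sumr_const -[a *+ _]mulr_natl mulKf//.
by rewrite pnatr_eq0 -lt0n.
Qed.

Lemma avg_ge0 (T : finType) (F : T -> R) : (forall x, 0 <= F x) -> 0 <= avg F.
Proof. by move=> F0; rewrite mulr_ge0 ?invr_ge0 ?ler0n// sumr_ge0. Qed.

Lemma avg_le (T : finType) (F : T -> R) (a : R) :
  0 <= a -> (forall x, F x <= a) -> avg F <= a.
Proof.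
(* Over an empty type the average is 0, because the inverse of 0 is 0; this case uses [0 <= a]. *)
move=> a0 Fa; have [T0|T0] := posnP #|T|; last first.
  by rewrite -[leRHS](avg_cst a T0); exact: ler_avg.
by rewrite /avg T0 invr0 mul0r.
Qed.

Lemma avg_pair (T U : finType) (F : T -> U -> R) :
  avg (fun p : T * U => F p.1 p.2) = avg (fun x => avg (F x)).
Proof.
rewrite /avg card_prod natrM invfM -mulr_sumr -mulrA.
by congr (_ * (_ * _)); rewrite pair_big.
Qed.

Lemma avg_bij (T U : finType) (f : T -> U) (F : U -> R) :
  bijective f -> avg (F \o f) = avg F.
Proof.
move=> bf; rewrite /avg (bij_eq_card bf) [in RHS](reindex f)//.
exact: onW_bij.
Qed.

Lemma prE (T : finType) (A : pred T) : pr A = #|A|%:R / #|T|%:R.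
Proof. by rewrite /pr /avg -natr_sum -sum1_card -big_mkcond /= mulrC. Qed.

Lemma pr_ge0 (T : finType) (A : pred T) : 0 <= pr A.
Proof. by apply: avg_ge0 => x; rewrite ler0n. Qed.

Lemma ler_pr (T : finType) (A B : pred T) :
  (forall x, A x -> B x) -> pr A <= pr B.
Proof.
move=> AB; apply: ler_avg => x; rewrite ler_nat.
by case: (A x) (AB x) => // /(_ isT) ->.
Qed.

Lemma prU_le (T : finType) (A B C : pred T) :
  (forall x, A x -> B x || C x) -> pr A <= pr B + pr C.
Proof.
move=> ABC; rewrite -avgD; apply: ler_avg => x; rewrite -natrD ler_nat.
by case: (A x) (ABC x) => // /(_ isT) /orP[] ->; rewrite ?leq_addr ?leq_addl.
Qed.

Lemma pr_exists_le (T J : finType) (A : pred T) (B : J -> pred T) :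
  (forall x, A x -> exists j, B j x) -> pr A <= \sum_j pr (B j).
Proof.
move=> AB; rewrite -avg_sum; apply: ler_avg => x.
rewrite -natr_sum ler_nat; case: (boolP (A x)) => // /AB[j Bj].
by rewrite (bigD1 j)//= Bj.
Qed.

Lemma prC (T : finType) (A : pred T) :
  (0 < #|T|)%N -> pr (fun x => ~~ A x) = 1 - pr A.
Proof.
move=> T0; apply/eqP; rewrite eq_sym subr_eq -avgD -[eqbLHS](@avg_cst T 1 T0).
by apply/eqP/eq_avg => x; case: (A x); rewrite ?addr0 ?add0r.
Qed.

Lemma markov_avg (T : finType) (F : T -> R) (A : pred T) (a : R) :
  0 < a -> (forall x, 0 <= F x) -> (forall x, A x -> a <= F x) ->
  pr A <= avg F / a.
Proof.
move=> a0 F0 AF; rewrite -avgMr; apply: ler_avg => x.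
case: (boolP (A x)) => [/AF aF|_]; first by rewrite ler_pdivlMr// mul1r.
by rewrite divr_ge0// ltW.
Qed.

(** * Independence of the coordinates of a uniform finite function *)

Definition splice (I T : finType) (A : {set I}) (f g : {ffun I -> T}) :
  {ffun I -> T} := [ffun i => if i \in A then f i else g i].

(* [(f, g) |-> (splice A f g, splice A g f)] is an involution. *)
Lemma avg_splice (I T : finType) (A : {set I}) (F : {ffun I -> T} -> R) :
  avg F = avg (fun f => avg (fun g => F (splice A f g))).
Proof.
have [T0|T0] := posnP #|{ffun I -> T}|.
  by rewrite /avg T0 invr0 !mul0r.
rewrite -(avg_pair (fun f g => F (splice A f g))).
pose s (p : {ffun I -> T} * {ffun I -> T}) := (splice A p.1 p.2, splice A p.2 p.1).
have sK : involutive s.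
  move=> [f g]; congr (_, _); apply/ffunP => i; rewrite !ffunE /= ?ffunE;
  by case: (i \in A).
rewrite -[RHS](avg_bij _ (inv_bij sK)).
transitivity (avg (fun p : {ffun I -> T} * {ffun I -> T} => F p.1)).
  rewrite (avg_pair (fun f g => F f)); apply: eq_avg => f.
  by rewrite avg_cst.
apply: eq_avg => -[f g] /=; congr F; apply/ffunP => i.
by rewrite !ffunE; case: (i \in A).
Qed.

(** Independence of coordinates: expanding a product of sums enumerates the finite functions, and
    coordinates outside [J] contribute the factor 1. *)
Lemma avg_prod (I T : finType) (J : pred I) (F : I -> T -> R) :
  (0 < #|T|)%N ->
  avg (fun g : {ffun I -> T} => \prod_(i | J i) F i (g i)) =
  \prod_(i | J i) avg (F i).
Proof.
move=> T0; pose F' i x := if J i then F i x else 1.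
transitivity (avg (fun g : {ffun I -> T} => \prod_i F' i (g i))).
  by apply: eq_avg => g; rewrite big_mkcond.
transitivity (\prod_i avg (F' i)); last first.
  rewrite [RHS]big_mkcond; apply: eq_bigr => i _; rewrite /F'; case: (J i) => //.
  exact: avg_cst.
rewrite /avg -bigA_distr_bigA big_split /= prodr_const card_ffun natrX exprVn.
by congr (_^-1 * _); rewrite cardE.
Qed.

Lemma avg_coord (I T : finType) (i : I) (F : T -> R) :
  (0 < #|T|)%N -> avg (fun g : {ffun I -> T} => F (g i)) = avg F.
Proof.
move=> T0; rewrite -(big_pred1_eq +%R i (fun _ => avg F)).
have := @avg_prod I T (pred1 i) (fun _ => F) T0; rewrite !big_pred1_eq => <-.
by apply: eq_avg => g; rewrite big_pred1_eq.
Qed.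

Lemma card_ffun_gt0 (I T : finType) : (0 < #|T|)%N -> (0 < #|{ffun I -> T}|)%N.
Proof. by move=> T0; rewrite card_ffun expn_gt0 T0. Qed.

Lemma avg_coord2 (I T : finType) (i j : I) (F : T -> T -> R) :
  (0 < #|T|)%N -> i != j ->
  avg (fun g : {ffun I -> T} => F (g i) (g j)) = avg (fun x => avg (F x)).
Proof.
move=> T0 ij; rewrite (avg_splice [set i]).
rewrite -(@avg_coord I T i (fun x => avg (F x)))//; apply: eq_avg => g.
rewrite -(@avg_coord I T j (F (g i)))//; apply: eq_avg => g'.
by rewrite !ffunE !inE eqxx eq_sym (negPf ij).
Qed.

(** Swaps the layer-first and vertex-first tables. In vertex-first form the cells of one vertex in
    all layers are a single coordinate, so that whole vertices are independent. *)
Definition transp (I J T : finType) (f : {ffun I -> {ffun J -> T}}) :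
  {ffun J -> {ffun I -> T}} := [ffun j => [ffun i => f i j]].

Lemma transpK (I J T : finType) : cancel (@transp I J T) (@transp J I T).
Proof. by move=> f; apply/ffunP => i; apply/ffunP => j; rewrite !ffunE. Qed.

Lemma avg_transp (I J T : finType) (F : {ffun I -> {ffun J -> T}} -> R) :
  avg F = avg (fun g => F (transp g)).
Proof.
apply/esym; apply: (@avg_bij _ _ (@transp J I T) F).
by exists (@transp I J T); exact: transpK.
Qed.

End Averages.

(** * From positions in the unit square to positions in a grid *)

Section Grid.
Variables (R : realType) (M : nat).
Hypothesis M0 : (0 < M)%N.

Definition cell1 (i : 'I_M) : set R :=
  `[i%:R / M%:R, (i.+1)%:R / M%:R[%classic.

Definition cell (c : 'I_M * 'I_M) : set (R * R) := cell1 c.1 `*` cell1 c.2.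

Lemma measurable_cell1 i : measurable (cell1 i).
Proof. exact: measurable_itv. Qed.

Lemma measurable_cell c : measurable (cell c).
Proof. by apply: measurableX; exact: measurable_cell1. Qed.

Lemma cell1_inj i j x : cell1 i x -> cell1 j x -> i = j.
Proof.
rewrite /cell1 /= !in_itv /= !ler_pdivrMr ?ltr0n// !ltr_pdivlMr ?ltr0n//.
move=> /andP[ix xi] /andP[jx xj]; apply/val_inj/eqP; rewrite eqn_leq -ltnS -[X in _ && X]ltnS.
by rewrite -!(ltr_nat R) (le_lt_trans ix)//= (le_lt_trans jx).
Qed.

Lemma cell1_01 i x : cell1 i x -> 0 <= x <= 1.
Proof.
rewrite /cell1 /= in_itv /= => /andP[ix xi]; apply/andP; split.
  by apply: le_trans ix; rewrite divr_ge0.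
by apply: le_trans (ltW xi) _; rewrite ler_pdivrMr ?ltr0n// mul1r ler_nat.
Qed.

Lemma leb2_cell c : leb2 (cell c `&` @unit_square R) = ((M%:R ^+ 2)^-1)%:E.
Proof.
rewrite setIidl; last by move=> x [/cell1_01 ? /cell1_01].
have len i : lebesgue_measure (cell1 i) = (M%:R^-1 : R)%:E.
  rewrite /cell1 lebesgue_measure_itv /= lte_fin ltr_pM2r ?invr_gt0 ?ltr0n//.
  rewrite ltr_nat ltnSn -EFinD -mulrBl; congr EFin.
  by rewrite -natrB// subSnn mul1r.
rewrite /leb2 product_measure1E; [|exact: measurable_cell1..].
by rewrite [X in (X * _)%E](len c.1) [X in (_ * X)%E](len c.2) -EFinM -invfM -expr2.
Qed.

Definition config h n := {ffun 'I_h -> {ffun 'I_n -> 'I_M * 'I_M}}.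

Definition located h n (pos : 'I_h -> 'I_n -> R * R) (f : config h n) :=
  forall k v, cell (f k v) (pos k v).

Lemma located_inj h n pos (f g : config h n) :
  located pos f -> located pos g -> f = g.
Proof.
move=> pf pg; apply/ffunP => k; apply/ffunP => v.
have [fx fy] := pf k v; have [gx gy] := pg k v.
move: fx fy gx gy; case: (f k v) => a b; case: (g k v) => a' b' /=.
by move=> /cell1_inj E1 /cell1_inj E2 /E1 -> /E2 ->.
Qed.

(** Each configuration is a box of cells of probability 1 / #|config|, and distinct boxes are
    disjoint because cells are half-open. Points with a coordinate equal to 1 lie in no cell, so the
    boxes only fill a part of [E]; the inequality is in the direction that both halves of the
    theorem use. *)
Lemma pr_grid_le d (Omega : measurableType d) (P : probability Omega R) h n
  (pos : 'I_h -> 'I_n -> Omega -> R * R) (E : set Omega)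
  (good : pred (config h n)) :
  iid_uniform_positions P pos -> measurable E ->
  (forall w f, located (fun k v => pos k v w) f -> good f -> E w) ->
  ((pr R good)%:E <= P E)%E.
Proof.
move=> [mpos iid] mE gE.
pose Z (f : config h n) := [set w | located (fun k v => pos k v w) f].
have mZ f : measurable (Z f).
  rewrite (_ : Z f = \bigcap_(kv in [set: 'I_h * 'I_n])
      ([set: Omega] `&` pos kv.1 kv.2 @^-1` cell (f kv.1 kv.2))); last first.
    apply/seteqP; split=> [w Zw kv _|w Zw k v]; first by split => //; exact: Zw.
    by case: (Zw (k, v) I).
  apply: fin_bigcap_measurable => // kv _.
  by apply: mpos => //; exact: measurable_cell.
have PZ f : P (Z f) = ((#|config h n|%:R)^-1)%:E.
  rewrite (iid (fun k v => cell (f k v))); last by move=> *; exact: measurable_cell.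
  under eq_bigr do under eq_bigr do rewrite leb2_cell.
  under eq_bigr do rewrite prodEFin; rewrite prodEFin; congr EFin.
  rewrite !prodr_const !card_ord !exprVn; congr (_^-1).
  by rewrite -!natrX !card_ffun card_prod !card_ord mulnn.
have fG : finite_set [set f | good f].
  exact: finite_finset.
have -> : (pr R good)%:E = P (\bigcup_(f in [set f | good f]) Z f).
  rewrite measure_fin_bigcup//; last first.
    by move=> f g _ _ [w [Zf Zg]]; exact: located_inj Zf Zg.
  rewrite fsbig_finite//= prE.
  under eq_bigr do rewrite PZ.
  rewrite sumEFin big_const_seq iter_addr_0 count_predT mulr_natl.
  congr (_ *+ _)%:E.
  rewrite cardE; apply: perm_size.
  apply: uniq_perm; rewrite ?enum_uniq ?finmap.fset_uniq// => f.
  rewrite mem_enum in_fset_set//.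
  by apply/idP/idP; rewrite inE.
apply: le_measure; rewrite ?inE//.
  by apply: fin_bigcup_measurable => // f _; exact: mZ.
by move=> w [f gf Zf]; exact: gE Zf gf.
Qed.

End Grid.

(** * Measurability of the rainbow event, and a criterion for convergence to 1 *)

Lemma measurable_edge (R : realType) d (Omega : measurableType d) h n
  (pos : 'I_h -> 'I_n -> Omega -> R * R) (r : R) k u v :
  (forall k v, measurable_fun setT (pos k v)) ->
  measurable [set w | rgg_edge (fun k v => pos k v w) r k u v].
Proof.
move=> mpos; rewrite /rgg_edge; case: (u != v); last first.
  rewrite (_ : [set _ | _] = set0)//.
  by apply/seteqP; split.
have mc (F : R * R -> R) : measurable_fun setT F ->
    forall a, measurable_fun setT (fun w => F (pos k a w)).
  by move=> mF a; exact: measurableT_comp.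
have m2 (F : R * R -> R) : measurable_fun setT F ->
    measurable_fun setT (fun w => (F (pos k u w) - F (pos k v w)) ^+ 2).
  move=> mF; apply: measurable_funX.
  by apply: measurable_funB; exact: mc.
have := @measurable_fun_ler _ _ _ setT
  (fun w => (((pos k u w).1 - (pos k v w).1) ^+ 2 +
             ((pos k u w).2 - (pos k v w).2) ^+ 2) : R) (cst (r ^+ 2)).
move=> /(_ (measurable_funD (m2 _ measurable_fst) (m2 _ measurable_snd))).
move=> /(_ (measurable_cst _)) mle.
(* Comparing squared distances requires r >= 0; for negative r there is no edge at all. *)
have [r0|r0] := leP 0 r; last first.
  rewrite (_ : [set _ | _] = set0)//; apply/seteqP; split=> // w /=.
  by move=> H; have := le_lt_trans H r0; rewrite ltNge sqrtr_ge0.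
have := mle measurableT [set true] _; rewrite setTI.
rewrite (_ : _ @^-1` _ = [set w | true && (Defs.edist (pos k u w) (pos k v w) <= r)]).
  exact.
apply/seteqP; split=> w /=; rewrite /Defs.edist.
  by move=> H; rewrite -(ger0_norm r0) -sqrtr_sqr; exact: ler_wsqrtr.
move=> H; rewrite -[leLHS]sqr_sqrtr ?addr_ge0 ?sqr_ge0//.
by rewrite ler_pXn2r// nnegrE sqrtr_ge0.
Qed.

(** Connectivity depends only on the finite table of edges, so the event is a finite union, over the
    connected tables, of finite intersections of edge events and their complements. *)
Lemma measurable_rainbow_event (R : realType) d (Omega : measurableType d) h n
  (pos : 'I_h -> 'I_n -> Omega -> R * R) (r : R) :
  (forall k v, measurable_fun setT (pos k v)) ->
  measurable (rainbow_event pos r).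
Proof.
move=> mpos.
pose X : finType := {ffun 'I_h * 'I_n * 'I_n -> bool}.
pose adj (b : X) k u v := b (k, u, v).
rewrite (_ : rainbow_event pos r =
  \bigcup_(b in [set b : X | rainbow_connected (adj b)])
  \bigcap_(t in [set: 'I_h * 'I_n * 'I_n])
   (if b t then [set w | rgg_edge (fun k v => pos k v w) r t.1.1 t.1.2 t.2]
    else ~` [set w | rgg_edge (fun k v => pos k v w) r t.1.1 t.1.2 t.2])).
  apply: fin_bigcup_measurable; first exact: finite_finset.
  move=> b _; apply: fin_bigcap_measurable; first exact: finite_finset.
  move=> t _; case: (b t); last apply: measurableC; exact: measurable_edge.
apply/seteqP; split=> [w Ew|w [b bc Hb]].
  pose b : X := [ffun t => rgg_edge (fun k v => pos k v w) r t.1.1 t.1.2 t.2].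
  have Eadj : adj b = rgg_edge (fun k v => pos k v w) r.
    by apply/funext => k; apply/funext => u; apply/funext => v; rewrite /adj ffunE.
  exists b => [|t _] /=; first by rewrite Eadj.
  by rewrite ffunE; case: ifP => // /negP.
suff Eadj : adj b = rgg_edge (fun k v => pos k v w) r.
  by rewrite /rainbow_event /= -Eadj.
apply/funext => k; apply/funext => u; apply/funext => v.
have := Hb (k, u, v) I; rewrite /adj; case: (b _) => /=; first by move=> ->.
by move=> /negP/negbTE ->.
Qed.

Lemma rainbow_event_mono (R : realType) d (Omega : measurableType d) h n
  (pos : 'I_h -> 'I_n -> Omega -> R * R) (r s : R) :
  r <= s -> rainbow_event pos r `<=` rainbow_event pos s.
Proof.
move=> rs w Ew u v uv; have [vs [cs [sz u1 u2 la al]]] := Ew u v uv.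
exists vs, cs; split => //; apply: sub_all al => t /andP[nt et].
by rewrite /rgg_edge nt (le_trans et).
Qed.

Lemma probability_cvg1 (R : realType) (d : nat -> measure_display)
  (Omega : forall n, measurableType (d n)) (P : forall n, probability (Omega n) R)
  (E : forall n, set (Omega n)) (p : nat -> R) :
  (forall n, measurable (E n)) ->
  (\forall n \near \oo, ((1 - p n)%:E <= P n (E n))%E) ->
  (forall e : R, 0 < e -> \forall n \near \oo, p n <= e) ->
  (P n (E n))%E @[n --> \oo] --> 1%E.
Proof.
move=> mE pE p0; apply/fine_cvgP; split.
  by near=> n; exact: fin_num_measure.
apply/cvgrPdist_le => e e0; near=> n.
have fE : P n (E n) \is a fin_num by exact: fin_num_measure.
have PE1 : fine (P n (E n)) <= 1.
  by rewrite -lee_fin fineK//; exact: probability_le1.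
rewrite ger0_norm ?subr_ge0//= lerBlDl -lerBlDr.
apply: (@le_trans _ _ (1 - p n)); first by rewrite lerB//; near: n; exact: p0.
by rewrite -lee_fin fineK//; near: n.
Unshelve. all: by end_near. Qed.

(** * Numerical bounds on pi *)

Section PiBounds.
Variable R : realType.

(** Each Taylor bound below follows from the previous one, which is the sign of its derivative. *)
Lemma derive_ge0_ge0 (f df : R -> R) : (forall x : R, is_derive x 1 f (df x)) ->
  f 0 = 0 -> (forall x, 0 <= x -> 0 <= df x) -> forall x, 0 <= x -> 0 <= f x.
Proof.
move=> fdf f0 df0 x x0.
have [|y yx] := @MVT_segment R f df 0 x x0 (fun y _ => fdf y).
  by apply: derivable_within_continuous => y _; exact: ex_derive.
rewrite f0 !subr0 => ->; apply: mulr_ge0 => //; apply: df0.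
by move: yx; rewrite in_itv => /andP[].
Qed.

Lemma sin_le (x : R) : 0 <= x -> 0 <= x - sin x.
Proof.
apply: (@derive_ge0_ge0 (id - sin) (fun x => 1 - cos x)).
- by rewrite !fctE sin0 subr0.
- by move=> y _; rewrite subr_ge0 cos_le1.
Qed.

Lemma cos_ge (x : R) : 0 <= x -> 0 <= cos x - 1 + x ^+ 2 / 2.
Proof.
move=> x0.
have := @derive_ge0_ge0 (cos - cst 1 + 2^-1 \*: (id ^+ 2)) (fun x => x - sin x) _ _ sin_le x x0.
rewrite !fctE /= => H.
have -> : cos x - 1 + x ^+ 2 / 2 = cos x - 1 + 2^-1 *: x ^+ 2 by rewrite [in RHS]/GRing.scale /= mulrC.
apply: H => [y|]; last by rewrite cos0 expr0n /= scaler0 subrr addr0.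
by apply: is_derive_eq; rewrite /GRing.scale /=; field.
Qed.

Lemma sin_ge (x : R) : 0 <= x -> 0 <= sin x - x + x ^+ 3 / 6.
Proof.
move=> x0.
have := @derive_ge0_ge0 (sin - id + 6^-1 \*: (id ^+ 3))
  (fun x => cos x - 1 + x ^+ 2 / 2) _ _ cos_ge x x0.
rewrite !fctE /= => H.
have -> : sin x - x + x ^+ 3 / 6 = sin x - x + 6^-1 *: x ^+ 3.
  by rewrite [in RHS]/GRing.scale /= mulrC.
apply: H => [y|]; last by rewrite sin0 expr0n /= scaler0 subrr addr0.
by apply: is_derive_eq; rewrite /GRing.scale /=; field.
Qed.

Lemma cos_le (x : R) : 0 <= x -> cos x <= 1 - x ^+ 2 / 2 + x ^+ 4 / 24.
Proof.
move=> x0; rewrite -subr_ge0.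
have := @derive_ge0_ge0 (cst 1 - 2^-1 \*: (id ^+ 2) + 24^-1 \*: (id ^+ 4) - cos)
  (fun x => sin x - x + x ^+ 3 / 6) _ _ sin_ge x x0.
rewrite !fctE /= => H.
have -> : 1 - x ^+ 2 / 2 + x ^+ 4 / 24 - cos x =
    1 - 2^-1 *: x ^+ 2 + 24^-1 *: x ^+ 4 - cos x.
  by rewrite /GRing.scale /= [2^-1 * _]mulrC [24^-1 * _]mulrC.
apply: H => [y|]; last by rewrite cos0 !expr0n /= !scaler0 subr0 addr0 subrr.
by apply: is_derive_eq; rewrite /GRing.scale /=; field.
Qed.

(** The bound cos x >= 1 - x ^ 2 / 2 at the zero pi / 2. It serves to compare the constant bounding
    c with [subcritical]. *)
Lemma pi_sqr_ge8 : 8 <= (pi : R) ^+ 2.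
Proof.
have := @cos_ge (pi / 2) (divr_ge0 (pi_ge0 R) (ler0n _ 2)).
rewrite cos_pihalf exprMn; lra.
Qed.

Lemma pi_cube_le32 : (pi : R) ^+ 3 <= 32.
Proof.
have pi2 := pi_ge2 R; have pi4 : pi < 4 :> R by have := pihalf_lt2 R; lra.
have x0 : 0 <= pi / 4 :> R by lra.
have c0 : 0 <= cos (pi / 4 : R) by apply: cos_ge0_pihalf; lra.
have := cosD (pi / 4 : R) (pi / 4).
have -> : pi / 4 + pi / 4 = pi / 2 :> R by lra.
have := cos2Dsin2 (pi / 4 : R); rewrite cos_pihalf => E1 E2.
have c2 : cos (pi / 4 : R) ^+ 2 = 1 / 2 by lra.
have := cos_le x0; set x : R := pi / 4 in x0 c0 c2 *.
(* Already 3.17 ^ 3 < 32. If pi > 3.17, the Taylor bound gives cos (pi / 4) <= 0.703, whose square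
   is below the exact value 1 / 2. *)
have [pi317|] := leP (pi : R) (317 / 100); first by move=> _; nra.
move=> pi317 cx.
have xl : 7925 / 10000 <= x by rewrite /x; lra.
have xu : x <= 1 by rewrite /x; lra.
have y1 : 628 / 1000 <= x ^+ 2 by nra.
have y2 : x ^+ 2 <= 1 by nra.
have : cos x <= 703 / 1000.
  apply: (le_trans cx); rewrite (_ : x ^+ 4 = (x ^+ 2) ^+ 2); last by rewrite -exprM.
  by move: (x ^+ 2) y1 y2 => y y1 y2; nra.
nra.
Qed.

End PiBounds.

Local Close Scope classical_set_scope.

(** * Geometry of the grid *)

(** One of the two truncated differences vanishes, so this is the absolute difference. *)
Definition ndist (i j : nat) : nat := (i - j) + (j - i).

Lemma ndistC : commutative ndist.
Proof. by move=> i j; rewrite /ndist addnC. Qed.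

Section GridGeometry.
Variables (R : realType) (M : nat).
Hypothesis M0 : (0 < M)%N.
Implicit Types (i j : 'I_M) (c : 'I_M * 'I_M).

Lemma cell1_dist i j (x y : R) : cell1 i x -> cell1 j y ->
  `|x - y| * M%:R <= (ndist i j).+1%:R.
Proof.
rewrite /cell1 /= !in_itv /= !ler_pdivrMr ?ltr0n// !ltr_pdivlMr ?ltr0n//.
move=> /andP[ix xi] /andP[jy yj].
rewrite -{1}(ger0_norm (ler0n R M)) -normrM mulrBl ler_norml.
have -> : (ndist i j).+1%:R = (ndist i j)%:R + 1 :> R by rewrite -natr1.
have h1 : (i%:R <= j%:R + (ndist i j)%:R :> R).
  by rewrite -natrD ler_nat /ndist; lia.
have h2 : (j%:R <= i%:R + (ndist i j)%:R :> R).
  by rewrite -natrD ler_nat /ndist; lia.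
move: ix xi jy yj; rewrite -!natr1; lra.
Qed.

Lemma cell1_dist_le1 i j (x y : R) : cell1 i x -> cell1 j y ->
  `|x - y| * M%:R <= 1 -> (ndist i j <= 1)%N.
Proof.
rewrite /cell1 /= !in_itv /= !ler_pdivrMr ?ltr0n// !ltr_pdivlMr ?ltr0n//.
move=> /andP[ix xi] /andP[jy yj].
rewrite -{1}(ger0_norm (ler0n R M)) -normrM mulrBl ler_norml => /andP[h1 h2].
have a1 : (i%:R < j.+2%:R :> R) by move: ix xi jy yj; rewrite -!natr1; lra.
have a2 : (j%:R < i.+2%:R :> R) by move: ix xi jy yj; rewrite -!natr1; lra.
by move: a1 a2; rewrite !ltr_nat /ndist; lia.
Qed.

(** Ball for the maximum norm: an outer approximation of a Euclidean neighbourhood, used below the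
    threshold. *)
Definition block (s : nat) c : {set 'I_M * 'I_M} :=
  [set c' : 'I_M * 'I_M | (ndist c.1 c'.1 <= s)%N && (ndist c.2 c'.2 <= s)%N].

(** Inner approximation of a Euclidean disk of radius K cell sides. The successors make membership
    valid wherever the two points lie in their cells. *)
Definition disk (K : nat) c : {set 'I_M * 'I_M} :=
  [set c' : 'I_M * 'I_M | ((ndist c.1 c'.1).+1 ^ 2 + (ndist c.2 c'.2).+1 ^ 2 <= K ^ 2)%N].

Lemma edist_disk K c c' (x y : R * R) (r : R) :
  K%:R <= r * M%:R -> cell c x -> cell c' y -> c' \in disk K c ->
  Defs.edist x y <= r.
Proof.
move=> Kr [x1 x2] [y1 y2]; rewrite inE -(ler_nat R) natrD !natrX => cK.
have M0' : 0 < M%:R :> R by rewrite ltr0n.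
have r0 : 0 <= r.
  by rewrite -(pmulr_lge0 _ M0') (le_trans _ Kr).
rewrite /Defs.edist -(ger0_norm r0) -sqrtr_sqr; apply: ler_wsqrtr.
rewrite -(ler_pM2r (exprn_gt0 2 M0')) mulrDl -!exprMn.
have sq (a b : R) : `|a| <= b -> a ^+ 2 <= b ^+ 2.
  move=> ab; rewrite -(real_normK (num_real a)) ler_pXn2r// nnegrE//.
  exact: le_trans ab.
have h1 := cell1_dist x1 y1; have h2 := cell1_dist x2 y2.
rewrite -{1}(ger0_norm (ler0n R M)) -normrM in h1.
rewrite -{1}(ger0_norm (ler0n R M)) -normrM in h2.
apply: le_trans (lerD (sq _ _ h1) (sq _ _ h2)) _.
by apply: (le_trans cK); rewrite ler_pXn2r// nnegrE// mulr_ge0.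
Qed.

Lemma edist_block c c' (x y : R * R) (r : R) :
  r * M%:R <= 1 -> cell c x -> cell c' y -> Defs.edist x y <= r ->
  c' \in block 1 c.
Proof.
move=> rM [x1 x2] [y1 y2] xy; rewrite inE.
have le1 (a b : R) : a ^+ 2 <= b -> Num.sqrt b <= r -> `|a| * M%:R <= 1.
  move=> ab br; apply: le_trans rM; rewrite ler_wpM2r//.
  by rewrite -sqrtr_sqr (le_trans _ br)// ler_wsqrtr.
apply/andP; split.
  apply: cell1_dist_le1 x1 y1 _; apply: le1 xy.
  by rewrite lerDl sqr_ge0.
apply: cell1_dist_le1 x2 y2 _; apply: le1 xy.
by rewrite lerDr sqr_ge0.
Qed.

Lemma block_sym s c c' : (c' \in block s c) = (c \in block s c').
Proof. by rewrite !inE (ndistC c.1) (ndistC c.2). Qed.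

Lemma disk_sym K c c' : (c' \in disk K c) = (c \in disk K c').
Proof. by rewrite !inE (ndistC c.1) (ndistC c.2). Qed.

Lemma block_trans s t c c' c'' :
  c' \in block s c -> c'' \in block t c' -> c'' \in block (s + t) c.
Proof. by rewrite !inE /ndist; lia. Qed.

Lemma disk_block K c : disk K c \subset block K c.
Proof.
apply/fintype.subsetP => c'; rewrite !inE => cK.
by apply/andP; split; rewrite -(@leq_exp2r _ _ 2)//; nia.
Qed.

Lemma card_le_inj (T U : finType) (A : {set T}) (f : T -> U) :
  {in A &, injective f} -> (#|A| <= #|U|)%N.
Proof. by move=> fI; rewrite -(card_in_imset fI) max_card. Qed.

Lemma card_block s c : (#|block s c| <= (2 * s + 1) ^ 2)%N.
Proof.
have -> : block s c = finset.setX [set j : 'I_M | (ndist c.1 j <= s)%N]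
                          [set j : 'I_M | (ndist c.2 j <= s)%N].
  by apply/finset.setP => c'; rewrite !inE.
have b1 i : (#|[set j : 'I_M | (ndist i j <= s)%N]| <= 2 * s + 1)%N.
  rewrite addn1 -[leqRHS](card_ord (2 * s).+1).
  apply: (@card_le_inj _ _ _ (fun j : 'I_M => inord (j + s - i) : 'I_(2 * s).+1)).
  move=> j k; rewrite !inE /ndist => ij ik /(congr1 val).
  rewrite /= !inordK; try lia.
  by move=> E; apply: val_inj => /=; lia.
by rewrite cardsX expnS expn1 leq_mul.
Qed.

(** For K > 0, the indices outside the margin are those from which every move by at most K - 1, in
    either direction, stays in the grid. *)
Definition margin K (i : nat) := ((i < K) || (M < i + K))%N.

Definition corner K c := margin K c.1 && margin K c.2.

Lemma card_corner K : (#|[set c | corner K c]| <= (2 * K) ^ 2)%N.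
Proof.
have [->|K0] := posnP K.
  rewrite (_ : [set c | _] = finset.set0) ?cards0//; apply/finset.setP => -[i j].
  by rewrite !inE /corner /margin /=; have := ltn_ord i; lia.
have -> : [set c | corner K c] =
    finset.setX [set j : 'I_M | margin K j] [set j : 'I_M | margin K j].
  by apply/finset.setP => c'; rewrite !inE.
have b1 : (#|[set j : 'I_M | margin K j]| <= 2 * K)%N.
  have -> : (2 * K)%N = #|'I_(2 * K).-1.+1| by rewrite card_ord prednK// muln_gt0.
  (* The lower margin keeps its indices and the upper one is shifted down to end at 2K - 1; the two
     margins may overlap, and the first then takes precedence. *)
  apply: (@card_le_inj _ _ _
    (fun j : 'I_M => inord (if (j < K)%N then nat_of_ord j else j + 2 * K - M)%N
       : 'I_(2 * K).-1.+1)).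
  move=> j k; rewrite !inE /margin => ij ik /(congr1 val).
  have := ltn_ord j; have := ltn_ord k => jM kM.
  rewrite /= !inordK; [|case: ifP; lia..].
  move=> E; apply: val_inj => /=; move: E; do 2 case: ifP; lia.
by rewrite cardsX expnS expn1 leq_mul.
Qed.

(** Reduces a lower bound on a disk to counting pairs of integers, independent of the grid and the
    centre, which can be evaluated. The maps [e1] and [e2] realise the moves along each axis, and
    [d1] and [d2] bound their lengths. *)
Lemma disk_count (s1 s2 : seq nat) (e1 e2 : nat -> 'I_M) (d1 d2 : nat -> nat) K c :
  uniq s1 -> uniq s2 -> {in s1 &, injective e1} -> {in s2 &, injective e2} ->
  {in s1, forall a, ndist c.1 (e1 a) <= d1 a}%N ->
  {in s2, forall a, ndist c.2 (e2 a) <= d2 a}%N ->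
  (count (fun p => (d1 p.1).+1 ^ 2 + (d2 p.2).+1 ^ 2 <= K ^ 2)
     [seq (a, b) | a <- s1, b <- s2] <= #|disk K c|)%N.
Proof.
move=> u1 u2 i1 i2 n1 n2; set p := (fun p => _); set s := [seq _ | _ <- _, _ <- _].
have us : uniq (seq.filter p s).
  by apply: filter_uniq; apply: allpairs_uniq => // -[? ?] [? ?].
pose e (ab : nat * nat) := (e1 ab.1, e2 ab.2).
rewrite -size_filter -(size_map e).
have ue : uniq (map e (seq.filter p s)).
  rewrite map_inj_in_uniq// => -[a b] [a' b']; rewrite !mem_filter.
  move=> /andP[_ /allpairsP[[? ?] [/= ? ? [-> ->]]]].
  move=> /andP[_ /allpairsP[[? ?] [/= ? ? [-> ->]]]].
  by move=> [/i1 -> // /i2 ->].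
rewrite -(card_uniqP ue); apply: subset_leq_card; apply/fintype.subsetP => c'.
move=> /mapP[[a b]]; rewrite mem_filter /p /=.
move=> /andP[pab /allpairsP[[? ?] [/= as1 bs2 [E1 E2]]]] ->.
rewrite inE /=; apply: leq_trans pab; subst.
by apply: leq_add; rewrite leq_exp2r// ltnS ?n1 ?n2.
Qed.

(** Moves go upwards when K cells are available there, and otherwise downwards; 2K <= M guarantees
    one of the two. *)
Lemma quarter_moves K i : (2 * K <= M)%N -> exists e : nat -> 'I_M,
  {in iota 0 K &, injective e} /\ {in iota 0 K, forall a, ndist i (e a) <= a}%N.
Proof.
move=> KM; have iM := ltn_ord i.
exists (fun a => insubd i (if (i + K <= M)%N then (i + a)%N else (i - a)%N)).
split=> [a b|a]; rewrite !mem_iota.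
  move=> aK bK /(congr1 val); rewrite /= !val_insubd.
  by do ?case: ifP; lia.
by move=> aK; rewrite /= !val_insubd /ndist; do ?case: ifP; lia.
Qed.

Lemma half_moves K i : (0 < K)%N -> ~~ margin K i -> exists e : nat -> 'I_M,
  {in iota 0 (2 * K).-1 &, injective e} /\
  {in iota 0 (2 * K).-1, forall a, ndist i (e a) <= ndist a K.-1}%N.
Proof.
rewrite /margin => K0 Ki; have iM := ltn_ord i.
exists (fun a => insubd i (i + a - K.-1)%N).
split=> [a b|a]; rewrite !mem_iota.
  move=> aK bK /(congr1 val); rewrite /= !val_insubd.
  by do ?case: ifP; lia.
by move=> aK; rewrite /= !val_insubd /ndist; do ?case: ifP; lia.
Qed.

(** A quarter disk actually counts 294 cells. A half disk counts 2 * 294 - 19 = 569, since the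
    central line of 19 cells is shared; 284 is chosen so that its double is still a bound for the
    half disk. *)
Lemma card_disk_ge c : (40 <= M)%N -> (284 <= #|disk 20 c|)%N.
Proof.
move=> M40.
have [e1 [i1 n1]] := @quarter_moves 20 c.1 M40.
have [e2 [i2 n2]] := @quarter_moves 20 c.2 M40.
apply: leq_trans (disk_count 20 (iota_uniq _ _) (iota_uniq _ _) i1 i2 n1 n2).
by vm_compute.
Qed.

Lemma card_disk_ge2 c : (40 <= M)%N -> ~~ corner 20 c ->
  (568 <= #|disk 20 c|)%N.
Proof.
move=> M40; rewrite negb_and => /orP[|] nm.
  have [e1 [i1 n1]] := @half_moves 20 c.1 isT nm.
  have [e2 [i2 n2]] := @quarter_moves 20 c.2 M40.
  apply: leq_trans (disk_count 20 (iota_uniq _ _) (iota_uniq _ _) i1 i2 n1 n2).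
  by vm_compute.
have [e1 [i1 n1]] := @quarter_moves 20 c.1 M40.
have [e2 [i2 n2]] := @half_moves 20 c.2 isT nm.
apply: leq_trans (disk_count 20 (iota_uniq _ _) (iota_uniq _ _) i1 i2 n1 n2).
by vm_compute.
Qed.

End GridGeometry.

(** * Growth of rainbow neighbourhoods, one layer at a time *)

Section Growth.
Variables (R : realType) (C V : finType) (B : C -> {set C}).
Variables (alpha beta : R).
Hypotheses (alpha0 : 0 <= alpha) (beta0 : 0 <= beta).
Hypothesis C0 : (0 < #|C|)%N.
Hypothesis B_ge : forall c, alpha * #|C|%:R <= #|B c|%:R.
Hypothesis B_meet : forall c,
  #|[set c' | ~~ [disjoint B c' & B c]]|%:R <= beta * #|C|%:R.

Definition nbhd_of (g : {ffun V -> C}) (S : {set V}) : {set C} :=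
  \bigcup_(s in S) B (g s).

Let cR0 : 0 < #|C|%:R :> R.
Proof. by rewrite ltr0n. Qed.

(** The vertices of [S] are placed one by one. By the union bound, a new neighbourhood meets the
    earlier ones with probability at most (|S| - 1) [beta] <= [eta]; otherwise it adds at least
    [alpha] to the covered proportion. This gives one factor per vertex. *)
Lemma avg_cover (tau eta : R) (S : {set V}) : 0 <= tau ->
  #|S|.-1%:R * beta <= eta -> eta <= 1 ->
  avg (fun g : {ffun V -> C} => expR (- (tau * (#|nbhd_of g S|%:R / #|C|%:R)))) <=
  (eta + (1 - eta) * expR (- (tau * alpha))) ^+ #|S|.
Proof.
move=> tau0; elim: {S}#|S| {-2}S (erefl #|S|) => [|k IHk] S Sk Seta eta1.
  rewrite Sk expr0; apply: avg_le => // g.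
  by rewrite expR_le1 oppr_le0 mulr_ge0.
have /card_gt0P[s sS] : (0 < #|S|)%N by rewrite Sk.
have S'k : #|S :\ s| = k.
  by apply/eqP; rewrite -eqSS -Sk (cardsD1 s S) sS.
have Seta' : k%:R * beta <= eta by rewrite Sk in Seta.
have IH : #|S :\ s|.-1%:R * beta <= eta.
  apply: le_trans Seta'; apply: ler_wpM2r => //.
  by rewrite ler_nat S'k leq_pred.
have {}IHk := IHk _ S'k IH eta1.
set q := _ + _ in IHk *.
have eta0 : 0 <= eta by apply: le_trans Seta'; rewrite mulr_ge0.
rewrite Sk exprSr -S'k; apply: le_trans (ler_wpM2r _ IHk); last first.
  by rewrite addr_ge0// mulr_ge0 ?subr_ge0// expR_ge0.
(* The cells of all other vertices are fixed, and only that of [s] is redrawn. *)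
rewrite (avg_splice [set~ s]) -avgMr; apply: ler_avg => g.
have splice_cover g' : nbhd_of (splice [set~ s] g g') S = nbhd_of g (S :\ s) :|: B (g' s).
  rewrite /nbhd_of (big_setD1 s)//= finset.setUC; congr (_ :|: B _); last first.
    by rewrite ffunE !inE eqxx.
  by apply: eq_bigr => i; rewrite !inE => /andP[is_ _]; rewrite ffunE !inE is_.
under eq_avg do rewrite splice_cover.
rewrite (avg_coord s (fun x => expR (- (tau *
  (#|nbhd_of g (S :\ s) :|: B x|%:R / #|C|%:R)))))//.
set U := nbhd_of g (S :\ s).
pose bad x := ~~ [disjoint B x & U].
have pbad : pr R bad <= eta.
  pose meets i x := (i \in S :\ s) && ~~ [disjoint B x & B (g i)].
  apply: (@le_trans _ _ (\sum_i pr R (meets i))).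
    apply: pr_exists_le => x; rewrite /bad disjoint_sym -setI_eq0.
    move=> /set0Pn[y]; rewrite inE => /andP[/bigcupP[i iS yi] yx].
    exists i; rewrite /meets iS -setI_eq0; apply/set0Pn.
    by exists y; rewrite inE yx.
  apply: le_trans Seta'; rewrite -S'k -sum1_card natr_sum mulr_suml.
  rewrite [leRHS]big_mkcond; apply: ler_sum => i _.
  rewrite prE ler_pdivrMr// /meets; case: (i \in S :\ s) => /=.
    by rewrite mul1r (le_trans _ (B_meet (g i)))// ler_nat cardsE.
  by rewrite eq_card0 ?mul0r// => x; rewrite inE.
apply: (@le_trans _ _ (expR (- (tau * (#|U|%:R / #|C|%:R))) *
  avg (fun x => (bad x)%:R + (1 - (bad x)%:R) * expR (- (tau * alpha))))).
  rewrite -avgMl; apply: ler_avg => x; case: (boolP (bad x)) => [_|/negPn dj].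
    rewrite subrr mul0r addr0 mulr1 ler_expR lerN2 ler_wpM2l//.
    by rewrite ler_pM2r ?invr_gt0// ler_nat subset_leq_card// finset.subsetUl.
  rewrite add0r subr0 mul1r -expRD ler_expR -opprD lerN2 -mulrDr ler_wpM2l//.
  rewrite -(ler_pM2r cR0) mulrDl divfK ?gt_eqF// divfK ?gt_eqF//.
  rewrite cardsU disjoint_setI0 1?disjoint_sym// cards0 subn0 natrD.
  by rewrite lerD2l.
rewrite ler_wpM2l ?expR_ge0// avgD avgMr -/(pr R bad).
have -> : avg (fun x => 1 - (bad x)%:R) = 1 - pr R bad :> R.
  rewrite -prC//; apply: eq_avg => x; case: (bad x); by rewrite ?subrr ?subr0.
have e1 : expR (- (tau * alpha)) <= 1 by rewrite expR_le1 oppr_le0 mulr_ge0.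
by rewrite /q; move: (expR _) e1 => e e1; nra.
Qed.

(** Once the cells of [S] are fixed, the vertices of [T] fall independently into the region covered.
    The generating function of their number is then at most an exponential in the covered
    proportion, to which [avg_cover] applies with tau = t (1 - z). *)
Lemma avg_growth (z eta t : R) (S T : {set V}) :
  0 <= z <= 1 -> 0 <= t <= #|T|%:R -> [disjoint S & T] ->
  #|S|.-1%:R * beta <= eta -> eta <= 1 ->
  avg (fun g : {ffun V -> C} => z ^+ #|[set w in T | g w \in nbhd_of g S]|) <=
  (eta + (1 - eta) * expR (- (t * (1 - z) * alpha))) ^+ #|S|.
Proof.
move=> /andP[z0 z1] /andP[t0 tT] dST Seta eta1.
apply: le_trans (avg_cover _ Seta eta1); last by rewrite mulr_ge0// subr_ge0.
rewrite (avg_splice S); apply: ler_avg => g.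
have coverE g' : nbhd_of (splice S g g') S = nbhd_of g S.
  by apply: eq_bigr => i iS; rewrite ffunE iS.
set U := nbhd_of g S.
have prodE g' : z ^+ #|[set w in T | splice S g g' w \in nbhd_of (splice S g g') S]| =
    \prod_(w in T) (if g' w \in U then z else 1).
  rewrite -prodr_const big_mkcond [RHS]big_mkcond; apply: eq_bigr => w _.
  rewrite inE coverE; case: (boolP (w \in T)) => //= wT.
  by rewrite ffunE (disjointFl dST wT).
under eq_avg do rewrite prodE.
rewrite (avg_prod (fun w => w \in T) (fun _ c => if c \in U then z else 1))//.
rewrite prodr_const.
have -> : avg (fun c => if c \in U then z else 1) =
    1 - (1 - z) * (#|U|%:R / #|C|%:R).
  transitivity (avg (fun c => 1 - (c \in U)%:R * (1 - z)) : R).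
    by apply: eq_avg => c; case: (c \in U); rewrite ?mul0r ?subr0// mul1r; ring.
  rewrite avgD avg_cst//; congr (_ + _).
  under eq_avg do rewrite -mulrN.
  by rewrite avgMr -/(pr R (fun c => c \in U)) prE mulrN mulrC.
set y := (1 - z) * _.
have y0 : 0 <= y by rewrite mulr_ge0 ?subr_ge0.
have y1 : y <= 1.
  rewrite mulr_ile1 ?subr_ge0// ?lerBlDr ?lerDl//.
  by rewrite ler_pdivrMr// mul1r ler_nat max_card.
apply: (@le_trans _ _ (expR (- y) ^+ #|T|)).
  rewrite lerXn2r ?nnegrE ?subr_ge0 ?expR_ge0//.
  by have := expR_ge1Dx (- y).
by rewrite -expRM_natl ler_expR -mulrA mulrN lerN2 ler_wpM2r.
Qed.

(** By symmetry of [B] the cell of [v] may be fixed first; the vertices of [S] then miss its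
    neighbourhood independently. *)
Lemma avg_hit (S : {set V}) (v : V) : (forall c c', (c' \in B c) = (c \in B c')) ->
  alpha <= 1 -> v \notin S ->
  pr R (fun g : {ffun V -> C} => [forall s in S, g v \notin B (g s)]) <=
  (1 - alpha) ^+ #|S|.
Proof.
move=> symB alpha1 vS; rewrite /pr (avg_splice [set v]); apply: avg_le => [|g].
  by rewrite exprn_ge0 ?subr_ge0.
have prodE g' : [forall s in S, splice [set v] g g' v \notin
    B (splice [set v] g g' s)]%:R =
    \prod_(s in S) (g' s \notin B (g v))%:R :> R.
  rewrite -natr_prod; congr _%:R.
  have -> : [forall s in S, splice [set v] g g' v \notin B (splice [set v] g g' s)] =
            [forall s in S, g' s \notin B (g v)].
    apply: eq_forallb => s; case: (boolP (s \in S)) => //= sS.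
    by rewrite !ffunE !inE eqxx symB (negPf (memPn vS s sS)).
  case: forall_inP => [H|]; first by rewrite big1// => s /H ->.
  move=> /forall_inP/forall_inPn[s sS nH].
  by rewrite (bigD1 s)//= (negPf nH).
under eq_avg do rewrite prodE.
rewrite (avg_prod (fun s => s \in S) (fun _ c => (c \notin B (g v))%:R))//.
rewrite prodr_const; apply: lerXn2r; rewrite ?nnegrE ?subr_ge0//.
  by apply: avg_ge0 => c; rewrite ler0n.
rewrite -/(pr R (fun c => c \notin B (g v))) prC// prE lerD2l lerN2.
by rewrite ler_pdivlMr// (le_trans (B_ge (g v))).
Qed.

Section Walks.
Variable L : finType.
Hypothesis symB : forall c c', (c' \in B c) = (c \in B c').

(** All colours are used, in the given order. Consecutive vertices must differ because there are no
    loops, but other repetitions are allowed and are removed only when a path is extracted. *)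
Fixpoint walk (f : {ffun L -> {ffun V -> C}}) (ks : seq L) (x v : V) : bool :=
  if ks is k :: ks' then
    [exists w, [&& x != w, f k w \in B (f k x) & walk f ks' w v]]
  else x == v.

Definition no_walk ks (S : {set V}) v f := [forall s in S, ~~ walk f ks s v].

(** The power of 1 - x is stable under revealing a layer: averaging it over the random set reached
    is the generating function bounded by [avg_growth] at z = 1 - x. *)
Definition no_walk_le (ks : seq L) (v : V) (x delta : R) (m : nat) :=
  forall S : {set V}, v \notin S -> (#|S| <= m)%N ->
  pr R (no_walk ks S v) <= (1 - x) ^+ #|S| + delta.

Lemma no_walk_le1 k v m : alpha <= 1 -> no_walk_le [:: k] v alpha 0 m.
Proof.
move=> alpha1 S vS _; rewrite addr0; apply: le_trans (avg_hit symB alpha1 vS).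
pose F (g : {ffun V -> C}) : R := [forall s in S, g v \notin B (g s)]%:R.
have T0 : (0 < #|{ffun V -> C}|)%N by exact: card_ffun_gt0.
rewrite -[leRHS](avg_coord k F T0).
apply: ler_avg => f; rewrite /F ler_nat; case: forall_inP => //; rewrite ?leq_b1//.
move=> nw; case: (boolP (no_walk _ _ _ _)) => // /forall_inP nw'; case: nw.
move=> s sS; apply: contra (nw' s sS) => fv; apply/existsP; exists v => /=.
by rewrite fv eqxx !andbT; apply: contraNneq vS => <-.
Qed.

Lemma walk_ext ks x v (f g : {ffun L -> {ffun V -> C}}) : {in ks, forall k, f k = g k} ->
  walk f ks x v = walk g ks x v.
Proof.
elim: ks x => //= k ks IH x fg; apply: eq_existsb => w.
rewrite (fg k) ?mem_head// IH// => i iks.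
by apply: fg; rewrite inE iks orbT.
Qed.

(** Layer [k] is revealed while the layers in [ks] stay independent of it. A walk from the new
    neighbours of [S] through [ks] extends to one from [S], so the inductive bound is applied to
    those neighbours and averaged. *)
Lemma no_walk_le_cons k ks v (x x' delta : R) (m m' : nat) (eta t : R) :
  k \notin ks -> 0 <= x <= 1 -> eta <= 1 -> m'.-1%:R * beta <= eta ->
  0 <= t -> t + m'%:R + 1 <= #|V|%:R ->
  eta + (1 - eta) * expR (- (t * x * alpha)) <= 1 - x' ->
  no_walk_le ks v x delta m ->
  no_walk_le (k :: ks) v x' (delta + (1 - x) ^+ m) m'.
Proof.
move=> kks /andP[x0 x1] eta1 meta t0 tV xx' IH S vS Sm'.
(* Leaving out [S] makes the new vertices independent of [S] and different from their predecessors;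
   leaving out [v] meets the condition of the inductive bound. *)
pose T := ~: (v |: S).
pose N (g : {ffun V -> C}) := [set w in T | g w \in nbhd_of g S].
have z0 : 0 <= 1 - x by rewrite subr_ge0.
have z1 : 1 - x <= 1 by rewrite lerBlDr lerDl.
have T0 : (0 < #|{ffun V -> C}|)%N by exact: card_ffun_gt0.
apply: (@le_trans _ _ (avg (fun f : {ffun L -> {ffun V -> C}} =>
   (1 - x) ^+ #|N (f k)|) + (delta + (1 - x) ^+ m))); last first.
  rewrite lerD2r (avg_coord k (fun g => (1 - x) ^+ #|N g|))//.
  have tT : 0 <= t <= #|T|%:R.
    rewrite t0 /=; have := cardsC (v |: S); rewrite cardsU1 vS.
    move=> /(congr1 (fun n => n%:R : R)); rewrite natrD -natr1 => VE.
    rewrite -/T in VE.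
    have : #|S|%:R <= m'%:R :> R by rewrite ler_nat.
    move: tV; rewrite -VE; lra.
  apply: le_trans (avg_growth _ tT _ _ eta1) _; rewrite ?z0 ?z1//.
  - by rewrite -finset.setI_eq0; apply/eqP/finset.setP => w; rewrite !inE;
      case: (w \in S); rewrite ?orbT ?andbF.
  - apply: le_trans meta; rewrite ler_wpM2r// ler_nat.
    by case: #|S| Sm' => [|a]; case: m' {tV} => //=.
  have eta0 : 0 <= eta by apply: le_trans meta; rewrite mulr_ge0.
  rewrite lerXn2r ?nnegrE//.
  - by rewrite addr_ge0// mulr_ge0 ?subr_ge0 ?expR_ge0.
  - apply: le_trans xx'; rewrite addr_ge0// mulr_ge0 ?subr_ge0 ?expR_ge0//.
  - by rewrite opprB addrCA subrr addr0.
rewrite /pr (avg_splice [set k]) [in X in _ <= X + _](avg_splice [set k]).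
rewrite -[X in _ <= _ + X](@avg_cst R {ffun L -> {ffun V -> C}}); last exact: card_ffun_gt0.
rewrite -avgD; apply: ler_avg => f.
under [X in _ <= X + _]eq_avg do rewrite ffunE inE eqxx.
rewrite avg_cst; last exact: card_ffun_gt0.
(* The inductive bound only covers sets of size at most [m]; a larger set is cut down to size [m],
   which costs the extra term (1 - x) ^ m. *)
have [S' sub [S'm S'E]] : exists2 S' : {set V}, S' \subset N (f k) &
    (#|S'| <= m)%N /\ (1 - x) ^+ #|S'| <= (1 - x) ^+ #|N (f k)| + (1 - x) ^+ m.
  have [Nm|mN] := leqP #|N (f k)| m.
    by exists (N (f k)) => //; split=> //; rewrite lerDl exprn_ge0.
  have /card_geqP : (m <= #|N (f k)|)%N by exact: ltnW.
  move=> [s [us ss sub]]; exists [set x in s].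
    by apply/fintype.subsetP => w; rewrite inE; exact: sub.
  have -> : #|[set x in s]| = m by rewrite cardsE (card_uniqP us).
  by split=> //; rewrite lerDr exprn_ge0.
have vS' : v \notin S'.
  by apply/negP => /(fintype.subsetP sub); rewrite !inE eqxx.
rewrite addrCA; apply: le_trans (_ : _ <= (1 - x) ^+ #|S'| + delta) _; last first.
  by rewrite [leLHS]addrC lerD2l.
apply: le_trans (IH _ vS' S'm); apply: ler_avg => g; rewrite ler_nat.
case: (boolP (no_walk (k :: ks) _ _ _)) => // /forall_inP nw.
suff -> : no_walk ks S' v g by [].
apply/forall_inP => w /(fintype.subsetP sub); rewrite inE => /andP[wT].
move=> /bigcupP[s sS ws]; apply: contra (nw s sS) => gw /=.
apply/existsP; exists w; rewrite !ffunE inE eqxx ws /=.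
rewrite (@walk_ext ks w v _ g) ?gw ?andbT.
  by apply: contraTneq wT => <-; rewrite !inE sS orbT.
by move=> i iks; rewrite !ffunE inE; case: eqP iks kks => // -> ->.
Qed.

End Walks.
End Growth.

(** * Two layers: joining through a third vertex, in both colour orders *)

Section TwoLayers.
Variables (R : realType) (C V L : finType) (B : C -> {set C}).
Hypothesis C0 : (0 < #|C|)%N.
Hypothesis symB : forall c c', (c' \in B c) = (c \in B c').

Let dens (c : C) : R := #|B c|%:R / #|C|%:R.

Let damp (t : R) c c' := expR (- (t * (dens c * dens c'))).

(* A vertex [w] can join [u] to [v] through the colours [i, j] or [j, i]; the
   probability of the union of the two events is at least half their sum, and
   this makes the two colour orders independent once [u] and [v] are averaged. *)
Lemma no_walk_two_layers (i j : L) (u v : V) (t : R) :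
  i != j -> u != v -> 0 <= t -> 2 * t + 2 <= #|V|%:R ->
  pr R (fun f => ~~ walk B f [:: i; j] u v && ~~ walk B f [:: j; i] u v) <=
  (avg (fun c => avg (damp t c))) ^+ 2.
Proof.
move=> ij uv t0 tV.
pose s (a b x : {ffun L -> C}) := ~~ ((x i \in B (a i)) && (x j \in B (b j))) &&
  ~~ ((x j \in B (a j)) && (x i \in B (b i))).
pose T : {set V} := ~: [set u; v].
have L0 : (0 < #|{ffun L -> C}|)%N by exact: card_ffun_gt0.
have fail_le f : (~~ walk B f [:: i; j] u v && ~~ walk B f [:: j; i] u v)%:R <=
    \prod_(w in T) (s (transp f u) (transp f v) (transp f w))%:R :> R.
  rewrite -natr_prod ler_nat; case: (boolP (~~ _ && ~~ _)) => // /andP[n1 n2].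
  rewrite big1// => w; rewrite !inE negb_or => /andP[wu wv].
  rewrite /s !ffunE.
  suff step k l : ~~ walk B f [:: k; l] u v ->
      ~~ ((f k w \in B (f k u)) && (f l w \in B (f l v))).
    by rewrite (step _ _ n1) (step _ _ n2).
  apply: contra => /andP[wk wl]; apply/existsP; exists w.
  rewrite eq_sym wu wk; apply/existsP; exists v.
  by rewrite wv symB wl eqxx.
apply: (le_trans (ler_avg fail_le)).
rewrite avg_transp; under eq_avg do rewrite transpK.
have dens0 c : 0 <= dens c by rewrite divr_ge0.
have dens_pr c : pr R (fun x => x \in B c) = dens c by rewrite prE.
(* The two factors involve disjoint pairs among the four cells of [u] and [v] in layers [i] and [j],
   hence are independent; the average of [phi] is therefore a square. *)
pose phi (a b : {ffun L -> C}) : R := damp t (a i) (b j) * damp t (a j) (b i).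
have L_avg (a b : {ffun L -> C}) :
    avg (fun x => (s a b x)%:R) <= 1 - (dens (a i) * dens (b j) + dens (a j) * dens (b i)) / 2.
  have pair k l : k != l ->
      pr R (fun x : {ffun L -> C} => (x k \in B (a k)) && (x l \in B (b l))) =
      dens (a k) * dens (b l).
    move=> kl; rewrite -!dens_pr -avgMr.
    have E := avg_coord2 (fun x y => (x \in B (a k))%:R * (y \in B (b l))%:R : R) C0 kl.
    apply: etrans (etrans E _); apply: eq_avg => x; last exact: avgMl.
    by rewrite -natrM mulnb.
  rewrite -(pair i j ij) -(pair j i); last by rewrite eq_sym.
  rewrite lerBrDl -[leRHS](avg_cst 1 L0) -avgD -avgMr -avgD.
  apply: ler_avg => x; rewrite /s.
  case: (_ && _); case: (_ && _) => /=; lra.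
have T_card : #|T|%:R = #|V|%:R - 2 :> R.
  rewrite -(cardsC [set u; v]) natrD cards2 uv /= -/T; lra.
apply: (@le_trans _ _ (avg (fun g : {ffun V -> {ffun L -> C}} => phi (g u) (g v)))).
  rewrite (avg_splice [set u; v]) [leRHS](avg_splice [set u; v]).
  apply: ler_avg => g; under [leRHS]eq_avg do rewrite !ffunE !inE !eqxx /= orbT.
  rewrite [leRHS]avg_cst; last exact: card_ffun_gt0.
  have prodE g' : \prod_(w in T) (s (splice [set u; v] g g' u)
      (splice [set u; v] g g' v) (splice [set u; v] g g' w))%:R =
      \prod_(w in T) (s (g u) (g v) (g' w))%:R :> R.
    apply: eq_bigr => w; rewrite !inE => /negPf wT.
    by rewrite !ffunE !inE !eqxx /= orbT wT.
  under eq_avg do rewrite prodE.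
  rewrite (avg_prod (fun w => w \in T) (fun _ x => (s (g u) (g v) x)%:R))//.
  rewrite prodr_const.
  have {}L_avg := L_avg (g u) (g v).
  set z := dens (g u i) * _ + _ in L_avg.
  apply: (@le_trans _ _ (expR (- (z / 2)) ^+ #|T|)).
    rewrite lerXn2r ?nnegrE ?expR_ge0//; first by apply: avg_ge0 => x; rewrite ler0n.
    by apply: (le_trans L_avg); exact: expR_ge1Dx.
  rewrite -expRM_natl /phi /damp -expRD ler_expR T_card.
  have z0 : 0 <= z by rewrite addr_ge0// mulr_ge0.
  rewrite -opprD -mulrDr -/z mulrN lerN2; nra.
rewrite (avg_coord2 phi L0 uv).
pose psi c := avg (damp t c).
have psiE a : avg (phi a) = psi (a i) * psi (a j).
  have ji : j != i by rewrite eq_sym.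
  apply: etrans (avg_coord2 (fun x y => damp t (a i) x * damp t (a j) y) C0 ji) _.
  by rewrite /psi -avgMr; apply: eq_avg => x; exact: avgMl.
under eq_avg do rewrite psiE.
rewrite (avg_coord2 (fun x y => psi x * psi y) C0 ij) expr2 -avgMr.
by apply: ler_avg => x; rewrite avgMl.
Qed.

(** [D] is the set of corner cells. The product of two densities is at least 4 a ^ 2, 2 a ^ 2 or a ^
    2 according as none, one or both of the cells lie in [D], hence the powers 4, 2 and 1, weighted
    by the probability of falling into [D]. *)
Lemma avg_damp_le (t a k : R) (D : {set C}) :
  0 <= t -> 0 <= a -> #|D|%:R <= k * #|C|%:R ->
  (forall c, a <= dens c) -> (forall c, c \notin D -> 2 * a <= dens c) ->
  avg (fun c => avg (damp t c)) <=
  expR (- (t * a ^+ 2)) ^+ 4 + 2 * k * expR (- (t * a ^+ 2)) ^+ 2 +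
  k ^+ 2 * expR (- (t * a ^+ 2)).
Proof.
move=> t0 a0 Dk ad ad2; set e := expR _.
have e0 : 0 <= e by exact: expR_ge0.
have dl n c c' (k1 k2 : R) : 0 <= k1 -> 0 <= k2 -> k1 * k2 = n%:R ->
    k1 * a <= dens c -> k2 * a <= dens c' -> damp t c c' <= e ^+ n.
  move=> k10 k20 kn h1 h2; rewrite /e -expRM_natl ler_expR mulrN lerN2 -kn.
  rewrite [leLHS](_ : _ = t * ((k1 * a) * (k2 * a))); last by ring.
  by rewrite ler_wpM2l// ler_pM// mulr_ge0.
have q2 := exprn_ge0 2 e0; have q4 := exprn_ge0 4 e0.
have inD c c' : damp t c c' <=
    e ^+ 4 + ((c \in D)%:R + (c' \in D)%:R) * e ^+ 2 + (c \in D)%:R * (c' \in D)%:R * e.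
  case: (boolP (c \in D)) => cD; case: (boolP (c' \in D)) => c'D;
    rewrite /= ?mulr0n ?mulr1n.
  - have := dl 1%N c c' 1 1; rewrite !mul1r expr1 => /(_ ler01 ler01 erefl (ad _) (ad _)); lra.
  - have := dl 2%N c c' 1 2; rewrite !mul1r => /(_ ler01 (ler0n _ 2) erefl (ad _) (ad2 _ c'D)); lra.
  - have := dl 2%N c c' 2 1; rewrite !mul1r mulr1 => /(_ (ler0n _ 2) ler01 erefl (ad2 _ cD) (ad _)); lra.
  - have := dl 4%N c c' 2 2; rewrite -natrM => /(_ (ler0n _ 2) (ler0n _ 2) erefl (ad2 _ cD) (ad2 _ c'D)); lra.
have pD : pr R (fun c => c \in D) <= k by rewrite prE ler_pdivrMr ?ltr0n.
set p := pr R _ in pD.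
have p0 : 0 <= p by exact: pr_ge0.
have inner c : avg (damp t c) <= e ^+ 4 + ((c \in D)%:R + p) * e ^+ 2 + (c \in D)%:R * p * e.
  apply: (le_trans (ler_avg (inD c))).
  rewrite !avgD !avgMr avgD avgMl !avg_cst//.
apply: (le_trans (ler_avg inner)).
rewrite !avgD !avgMr avgD !avg_cst// -/(pr R (fun c => c \in D)) -/p.
have e20 := exprn_ge0 2 e0.
rewrite lerD// ?lerD// ?ler_wpM2r//; [lra|].
by rewrite expr2 ler_pM.
Qed.

End TwoLayers.

(** * From walks in the grid to rainbow paths *)

Lemma rainbow_path_suffix h n (adj : 'I_h -> 'I_n -> 'I_n -> bool) u v x vs cs :
  rainbow_path adj u v vs cs -> x \in u :: vs ->
  exists vs' cs', rainbow_path adj x v vs' cs' /\ subseq cs' cs.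
Proof.
elim: vs u cs => [|w vs IH] u cs ruv.
  by rewrite inE => /eqP ->; exists [::], cs; split.
rewrite inE => /orP[/eqP ->|]; first by exists (w :: vs), cs.
case: ruv; case: cs => [|c cs] // [sz] u1 /andP[_ u2] la /= /andP[_ al] xin.
have /andP[_ u1'] : (u \notin w :: vs) && uniq (w :: vs) by [].
have [vs' [cs' [r' s']]] := IH w cs (And5 sz u1' u2 la al) xin.
by exists vs', cs'; split=> //; apply: subseq_trans s' (subseq_cons _ _).
Qed.

(* A walk with distinct colours is shortened to a path by cutting its cycles. *)
Lemma walk_rainbow_path (C : finType) (B : C -> {set C}) h n
  (f : {ffun 'I_h -> {ffun 'I_n -> C}}) (adj : 'I_h -> 'I_n -> 'I_n -> bool) ks u v :
  (forall k x w, x != w -> f k w \in B (f k x) -> adj k x w) ->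
  uniq ks -> walk B f ks u v ->
  exists vs cs, rainbow_path adj u v vs cs /\ subseq cs ks.
Proof.
move=> fadj; elim: ks u => [|k ks IH] u /=.
  by move=> _ /eqP ->; exists [::], [::].
move=> /andP[kks uks] /existsP[w /and3P[uw kuw wkw]].
have [vs [cs [r s]]] := IH w uks wkw.
have [uvs|uvs] := boolP (u \in w :: vs).
  have [vs' [cs' [r' s']]] := rainbow_path_suffix r uvs.
  exists vs', cs'; split=> //.
  exact: (subseq_trans s' (subseq_trans s (subseq_cons _ _))).
case: r => sz u1 u2 la al; exists (w :: vs), (k :: cs); split; last by rewrite /= eqxx.
split => //=; first by rewrite sz.
- by rewrite uvs.
- by rewrite u2 andbT; apply: contra kks; exact: mem_subseq.
- by rewrite fadj.
Qed.

(** Union bound over the ordered pairs. [KS] lists the colour orders that may be tried: one order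
    for h >= 3, two for h = 2. *)
Lemma rainbow_event_ge (R : realType) d (Omega : measurableType d)
  (P : probability Omega R) h n M (pos : 'I_h -> 'I_n -> Omega -> R * R) (r p : R)
  (KS : seq (seq 'I_h)) :
  iid_uniform_positions P pos -> (0 < M)%N -> 20 <= r * M%:R -> all uniq KS -> 0 <= p ->
  (forall u v, u != v ->
     pr R (fun f : config M h n => all (fun ks => ~~ walk (disk 20) f ks u v) KS) <= p) ->
  ((1 - n%:R ^+ 2 * p)%:E <= P (rainbow_event pos r))%E.
Proof.
move=> Hpos M0 rM uKS p0 Hp.
pose bad (f : config M h n) :=
  [exists uv : 'I_n * 'I_n, (uv.1 != uv.2) &&
    all (fun ks => ~~ walk (disk 20) f ks uv.1 uv.2) KS].
have C0 : (0 < #|config M h n|)%N.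
  by do 2 apply: card_ffun_gt0; rewrite card_prod card_ord muln_gt0 M0.
have Hbad : pr R bad <= n%:R ^+ 2 * p.
  apply: (@le_trans _ _ (\sum_(uv : 'I_n * 'I_n) pr R (fun f => (uv.1 != uv.2) &&
    all (fun ks => ~~ walk (disk 20) f ks uv.1 uv.2) KS))).
    by apply: pr_exists_le => f /existsP.
  have le_p (uv : 'I_n * 'I_n) : true -> pr R (fun f : config M h n => (uv.1 != uv.2) &&
      all (fun ks => ~~ walk (disk 20) f ks uv.1 uv.2) KS) <= p.
    move=> _; case: uv => u v /=; have [->|uv] := eqVneq u v => /=; last exact: Hp.
    by rewrite prE eq_card0 ?mul0r.
  apply: (le_trans (ler_sum _ le_p)).
  by rewrite sumr_const card_prod !card_ord -[p *+ _]mulr_natl natrM -expr2 lexx.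
apply: le_trans (_ : ((1 - pr R bad)%:E <= _)%E); first by rewrite lee_fin lerB.
rewrite -prC//; apply: (pr_grid_le M0 Hpos) => [|w f lf].
  by apply: measurable_rainbow_event; case: Hpos.
rewrite negb_exists => /forallP nb u v uv.
have := nb (u, v); rewrite uv /= -has_predC => /hasP[ks ksKS /= /negPn wk].
have kadj k x y : x != y -> f k y \in disk 20 (f k x) ->
    rgg_edge (fun k v => pos k v w) r k x y.
  by move=> xy kxy; rewrite /rgg_edge xy; apply: (edist_disk M0 rM _ _ kxy).
have [vs [cs [rp _]]] := walk_rainbow_path kadj (allP uKS _ ksKS) wk.
by exists vs, cs.
Qed.

Lemma expRN_le_sub (R : realType) (y e : R) : 0 <= y -> y <= e ->
  expR (- y) <= 1 - y * (1 - e).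
Proof.
move=> y0 ye; have y1 : 0 < 1 + y by lra.
rewrite expRN; apply: (@le_trans _ _ (1 + y)^-1).
  by rewrite lef_pV2 ?posrE ?expR_gt0// expR_ge1Dx.
rewrite -[leLHS]mul1r ler_pdivrMr// -subr_ge0.
rewrite (_ : _ - 1 = y * ((e - y) + e * y)); last by ring.
by rewrite mulr_ge0// addr_ge0 ?subr_ge0// mulr_ge0// (le_trans y0).
Qed.

(** * Iteration of the one-layer bound through all layers *)

Section AllLayers.
Variables (R : realType) (C V L : finType) (B : C -> {set C}).
Variables (a beta rho e lam : R).
Hypotheses (a0 : 0 < a) (a1 : a <= 1) (beta0 : 0 <= beta) (C0 : (0 < #|C|)%N).
Hypothesis symB : forall c c', (c' \in B c) = (c \in B c').
Hypothesis B_ge : forall c, a * #|C|%:R <= #|B c|%:R.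
Hypothesis B_meet : forall c,
  #|[set c' | ~~ [disjoint B c' & B c]]|%:R <= beta * #|C|%:R.
Hypotheses (e0 : 0 <= e) (e1 : e < 1) (rho0 : 0 < rho) (rho1 : rho <= (1 - e) ^+ 3).
Hypothesis lam0 : 0 <= lam.

Let n : R := #|V|%:R.
(** [q] is the growth factor of one layer, [x k] the success rate through k + 1 layers, and [m k] is
    large enough to make the cost of cutting a set to that size at most exp (- 3 lam), where lam
    will be log n. *)
Let q := rho * n * a.
Let x k := a * q ^+ k.
Let m k : nat := (Num.truncn (3 * lam / x k)).+1.

Variable H : nat.
Hypothesis q1 : 1 <= q.
Hypothesis growth_le : n * a * x H <= e.
Hypothesis m_beta : (3 * lam / x 1 + 1) * beta <= e.
Hypothesis m_n : 3 * lam / x 1 + 2 <= e * n.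

Let x_gt0 k : 0 < x k.
Proof. by rewrite mulr_gt0// exprn_gt0// (lt_le_trans ltr01). Qed.

Let x_mono k l : (k <= l)%N -> x k <= x l.
Proof. by move=> kl; rewrite ler_pM2l// ler_weXn2l. Qed.

Let m_le k : (m k)%:R <= 3 * lam / x k + 1.
Proof.
rewrite /m -natr1 lerD2r truncn_le; apply: divr_ge0; last exact: ltW.
exact: mulr_ge0.
Qed.

Let m_ge k : 3 * lam <= x k * (m k)%:R.
Proof.
rewrite [leRHS]mulrC -ler_pdivrMr//; apply/ltW.
by rewrite /m; apply: truncnS_gt.
Qed.

Let x_le1 k : (k <= H.+1)%N -> x k <= 1.
Proof.
move=> kH; apply: le_trans (x_mono kH) _; rewrite /x exprS mulrCA.
rewrite (_ : q * _ = rho * (n * a * x H)); last by rewrite /q /x; ring.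
apply: mulr_ile1.
- exact: ltW.
- apply: mulr_ge0; last exact: ltW.
  by rewrite mulr_ge0 ?ler0n// ltW.
- apply: (le_trans rho1); apply: exprn_ile1; first by rewrite subr_ge0 ltW.
  by rewrite lerBlDr lerDl.
- exact: ltW (le_lt_trans growth_le e1).
Qed.

Let powE k : (1 - x k) ^+ m k <= expR (- (3 * lam)) \/ 1 < x k.
Proof.
have [xk1|] := leP (x k) 1; [left|by right].
apply: (@le_trans _ _ (expR (- x k) ^+ m k)).
  by rewrite lerXn2r ?nnegrE ?subr_ge0 ?expR_ge0//; exact: expR_ge1Dx.
by rewrite -expRM_natl ler_expR mulrN lerN2 (mulrC _ (x k)) m_ge.
Qed.

(** The base case holds for sets of every size, so only [m k] with k >= 1 must be controlled; these
    are largest at k = 1, which explains the role of [x 1] in the hypotheses. *)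
Lemma no_walk_le_layers k (v : V) (ks : seq L) : (k <= H.+1)%N -> uniq ks -> size ks = k.+1 ->
  no_walk_le B ks v (x k) (k%:R * expR (- (3 * lam))) (m k).
Proof.
elim: k ks => [|k IHk] [|k0 ks] //= kH /andP[k0ks uks] [sz].
  case: ks sz {k0ks uks} => // _; rewrite mul0r /x expr0 mulr1.
  exact: no_walk_le1.
have IH := IHk ks (ltnW kH) uks sz.
have m1 : (m k.+1)%:R <= 3 * lam / x 1 + 1.
  apply: (le_trans (m_le _)); rewrite lerD2r ler_wpM2l ?mulr_ge0//.
  by rewrite lef_pV2 ?posrE// x_mono.
have x01 : 0 <= x k <= 1 by rewrite ltW//= x_le1// ltnW.
have y0 : 0 <= (1 - e) * n * x k * a.
  have := ltW (x_gt0 k); have := ltW a0; have : 0 <= n by exact: ler0n.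
  have : 0 <= 1 - e by rewrite subr_ge0 ltW.
  by move=> h1 h2 h3 h4; exact: mulr_ge0 (mulr_ge0 (mulr_ge0 h1 h2) h4) h3.
have := @no_walk_le_cons R C V B a beta (ltW a0) beta0 C0 B_ge B_meet L
  k0 ks v (x k) (x k.+1) (k%:R * expR (- (3 * lam))) (m k) (m k.+1) e ((1 - e) * n)
  k0ks x01 (ltW e1).
move=> /(_ _ _ _ _ IH) K S vS Sm; apply: le_trans (K _ _ _ _ S vS Sm) _.
- apply: le_trans m_beta; rewrite ler_wpM2r//; apply: le_trans m1.
  by rewrite ler_nat leq_pred.
- by rewrite mulr_ge0 ?ler0n// subr_ge0 ltW.
- move: m1 m_n; rewrite -/n; move: (3 * lam / x 1) ((m k.+1)%:R : R) n => w mk nn; lra.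
- have ye : (1 - e) * n * x k * a <= e.
    apply: le_trans growth_le; have := x_mono (kH : (k <= H)%N); have := x_gt0 k.
    have : 0 <= n by exact: ler0n.
    move: (x k) (x H) => X Y n0 X0 XY.
    rewrite (_ : n * a * Y = n * Y * a); last by ring.
    apply: ler_wpM2r; first exact: ltW.
    rewrite -mulrA; apply: le_trans (ler_wpM2l n0 XY).
    by rewrite ler_piMl ?mulr_ge0 ?lerBlDr ?lerDl// ltW.
  (* Three factors 1 - e are lost: for overlapping neighbourhoods, for the vertices excluded from
     growth, and for linearising the exponential. Hence rho <= (1 - e) ^ 3. *)
  have := expRN_le_sub y0 ye.
  have -> : x k.+1 = rho * (n * a * x k) by rewrite /x /q exprS; ring.
  set E := expR _ => HE.
  have : (1 - e) * E <= (1 - e) * (1 - (1 - e) * n * x k * a * (1 - e)).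
    by rewrite ler_wpM2l// subr_ge0 ltW.
  have : rho * (n * a * x k) <= (1 - e) ^+ 3 * (n * a * x k).
    apply: ler_wpM2r => //; apply: mulr_ge0; last exact: ltW.
    by apply: mulr_ge0; [exact: ler0n|exact: ltW].
  move=> h1 h2; rewrite -subr_ge0.
  have -> : 1 - rho * (n * a * x k) - (e + (1 - e) * E) =
   ((1 - e) ^+ 3 * (n * a * x k) - rho * (n * a * x k)) +
   ((1 - e) * (1 - (1 - e) * n * x k * a * (1 - e)) - (1 - e) * E) by ring.
  by rewrite addr_ge0// subr_ge0.
- rewrite lerD2l -[k.+1%:R]natr1 [(_ + 1) * expR _]mulrDl mul1r lerD2l.
  case: (powE k) => // /(le_lt_trans (x_le1 (ltnW kH))); by rewrite ltxx.
Qed.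

(** The layer next to [u] is revealed last. A single vertex causes no overlap, so eta = 0, and the
    exponential is kept because its exponent is now large. *)
Lemma pr_no_walk_le (u v : V) (ks : seq L) : uniq ks -> size ks = H.+3 -> u != v ->
  pr R (fun f => ~~ walk B f ks u v) <=
  expR (- ((n - 2) * a * x H.+1)) + H.+2%:R * expR (- (3 * lam)).
Proof.
case: ks => // k0 ks /andP[k0ks uks] [sz] uv.
have IH := @no_walk_le_layers _ v _ (leqnn H.+1) uks sz.
have n2 : 2 <= n.
  rewrite /n ler_nat; have := max_card [set u; v].
  by rewrite cards2 uv.
set E := expR (- (_ * _)).
have x01 : 0 <= x H.+1 <= 1 by rewrite ltW//= x_le1.
have := @no_walk_le_cons R C V B a beta (ltW a0) beta0 C0 B_ge B_meet L
  k0 ks v (x H.+1) (1 - E) (H.+1%:R * expR (- (3 * lam))) (m H.+1) 1 0 (n - 2)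
  k0ks x01 ler01.
rewrite mul0r lexx subr_ge0 n2 -/n => /(_ isT isT _ _ IH [set u]).
rewrite cards1 !inE eq_sym uv expr1 => K.
have {}K : pr R (no_walk B (k0 :: ks) [set u] v) <=
   1 - (1 - E) + (H.+1%:R * expR (- (3 * lam)) + (1 - x H.+1) ^+ m H.+1).
  apply: K => //; first by lra.
  rewrite add0r subr0 mul1r subKr ler_expR lerN2.
  by rewrite [leRHS]mulrAC.
apply: (@le_trans _ _ (pr R (no_walk B (k0 :: ks) [set u] v))).
  by apply: ler_pr => f nw; apply/forall_inP => w; rewrite inE => /eqP ->.
apply: (le_trans K); rewrite subKr lerD2l -[H.+2%:R]natr1 [(_ + 1) * expR _]mulrDl mul1r lerD2l.
case: (powE H.+1) => // /(le_lt_trans (x_le1 (leqnn _))); by rewrite ltxx.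
Qed.

End AllLayers.

(** * Exploration of the neighbourhood of a vertex, below the threshold *)

Section Exploration.
Variables (R : realType) (C V L : finType) (B : C -> {set C}) (b : nat).
Hypothesis C0 : (0 < #|C|)%N.
Hypothesis symB : forall c c', (c' \in B c) = (c \in B c').
Hypothesis B_le : forall c, (#|B c| <= b)%N.

Let m : R := #|C|%:R.
Let conf := {ffun L -> {ffun V -> C}}.

Let m0 : 0 < m.
Proof. by rewrite ltr0n. Qed.

(** Quantifying over cells rather than vertices makes each event concern a fixed block, whatever the
    configuration. *)
Definition max_degree (D : nat) (f : conf) :=
  [forall k, forall c, #|[set w | f k w \in B c]| <= D]%N.

(** A Chernoff bound in base 2: the mean of 2 ^ N factors over the vertices, each contributing 1 +
    |B c| / m. *)
Lemma pr_degree_gt (D : nat) (c : C) :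
  pr R (fun g : {ffun V -> C} => (D <= #|[set w | g w \in B c]|)%N) <=
  2 ^- D * expR (#|V|%:R * (b%:R / m)).
Proof.
have twoX k : 0 <= (2 : R) ^+ k by rewrite exprn_ge0.
pose F (g : {ffun V -> C}) : R := 2 ^+ #|[set w | g w \in B c]|.
have mk := @markov_avg R _ F (fun g => (D <= #|[set w | g w \in B c]|)%N) (2 ^+ D).
apply: le_trans (mk _ _ _) _.
- by rewrite exprn_gt0.
- by move=> g; exact: twoX.
- by move=> g Dg; apply: ler_weXn2l => //; rewrite ler1n.
rewrite mulrC ler_wpM2l ?invr_ge0//.
have prodE (g : {ffun V -> C}) : F g =
    \prod_w (if g w \in B c then 2 else 1) :> R.
  by rewrite /F -prodr_const [LHS]big_mkcond; apply: eq_bigr => w _; rewrite inE.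
rewrite (eq_avg prodE) (avg_prod xpredT (fun _ x => if x \in B c then 2 else 1))//.
rewrite prodr_const expRM_natl; apply: lerXn2r; rewrite ?nnegrE ?expR_ge0//.
  by apply: avg_ge0 => x; case: (x \in B c); rewrite ?ler0n ?ler01.
have -> : avg (fun x => if x \in B c then 2 else 1) = 1 + #|B c|%:R / m :> R.
  have <- : pr R (fun x => x \in B c) = #|B c|%:R / m by rewrite prE.
  rewrite -[1 in RHS](avg_cst 1 C0) -avgD; apply: eq_avg => x.
  by case: (x \in B c); rewrite ?addr0.
apply: le_trans (expR_ge1Dx _) _; rewrite ler_expR.
by rewrite ler_wpM2r ?invr_ge0 ?(ltW m0)// ler_nat.
Qed.

Lemma pr_max_degree (D : nat) :
  pr R (fun f : conf => ~~ max_degree D f) <=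
  #|L|%:R * m * (2 ^- D * expR (#|V|%:R * (b%:R / m))).
Proof.
pose ev (p : L * C) (f : conf) := (D <= #|[set w | f p.1 w \in B p.2]|)%N.
apply: (@le_trans _ _ (\sum_p pr R (ev p))).
  apply: pr_exists_le => f /forallPn[k /forallPn[c nc]].
  by exists (k, c); rewrite /ev /= ltnW// ltnNge.
have le_p (p : L * C) : true -> pr R (ev p) <=
    2 ^- D * expR (#|V|%:R * (b%:R / m)).
  move=> _; rewrite /pr /ev; have T0 : (0 < #|{ffun V -> C}|)%N by exact: card_ffun_gt0.
  rewrite (avg_coord p.1 (fun g : {ffun V -> C} => ((D <= #|[set w | g w \in B p.2]|)%N)%:R) T0).
  exact: pr_degree_gt.
apply: (le_trans (ler_sum _ le_p)).
by rewrite sumr_const card_prod -[_ *+ _]mulr_natl natrM.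
Qed.

(** The restriction to [A], the complement of the reserved set, keeps the cells of the reserved
    vertices unrevealed. *)
Definition grow (f : conf) (A : {set V}) (ks : seq L) (S : {set V}) : {set V} :=
  foldl (fun S k => [set w in A | f k w \in nbhd_of B (f k) S]) S ks.

Lemma grow_rcons f A ks k S : grow f A (rcons ks k) S =
  [set w in A | f k w \in nbhd_of B (f k) (grow f A ks S)].
Proof. by rewrite /grow foldl_rcons. Qed.

Lemma card_grow f A ks S D : max_degree D f ->
  (#|grow f A ks S| <= #|S| * D ^ size ks)%N.
Proof.
move=> /forallP degf; elim/last_ind: ks => [|ks k IH]; first by rewrite muln1.
rewrite grow_rcons size_rcons expnSr mulnA; apply: leq_trans (leq_mul IH (leqnn D)).
set T := grow f A ks S; have /forallP degk := degf k.
apply: (@leq_trans #|\bigcup_(s in T) [set w | f k w \in B (f k s)]|).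
  apply: subset_leq_card; apply/fintype.subsetP => w; rewrite inE.
  by move=> /andP[_ /bigcupP[s sT ws]]; apply/bigcupP; exists s; rewrite // inE.
rewrite -sum_nat_const; elim/big_ind2: _ => [|X1 x1 X2 x2 h1 h2|s _].
- by rewrite cards0.
- by apply: leq_trans (leq_card_setU _ _).1 _; exact: leq_add.
- exact: degk.
Qed.

Lemma grow_ext (f g : conf) (A : {set V}) (ks : seq L) (S : {set V}) : S \subset A ->
  {in ks, forall k, {in A, f k =1 g k}} -> grow f A ks S = grow g A ks S.
Proof.
elim: ks S => //= k ks IH S SA fg.
have E : [set w in A | f k w \in nbhd_of B (f k) S] =
         [set w in A | g k w \in nbhd_of B (g k) S].
  have -> : nbhd_of B (f k) S = nbhd_of B (g k) S.
    apply: eq_bigr => s sS; congr (B _); apply: fg; first exact: mem_head.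
    exact: (fintype.subsetP SA).
  apply/finset.setP => w; rewrite !inE; case: (boolP (w \in A)) => //= wA.
  by rewrite (fg k (mem_head _ _) w wA).
rewrite /grow /= E; apply: IH => [|k' k'ks].
  by apply/fintype.subsetP => w; rewrite inE => /andP[].
by apply: fg; rewrite inE k'ks orbT.
Qed.

(** Avoiding colour [k] makes this set independent of layer [k]. Colours may repeat in [t], which
    only enlarges the set and simplifies the count. *)
Definition explored (f : conf) (A : {set V}) (u : V) (k : L) : {set V} :=
  \bigcup_(j < #|L|) \bigcup_(t : j.-tuple L | k \notin t) grow f A t [set u].

Lemma card_explored f A u k D : max_degree D f ->
  (#|explored f A u k| <= \sum_(j < #|L|) #|L| ^ j * D ^ j)%N.
Proof.
move=> degf; rewrite /explored; elim/big_ind2: _ => [|X1 x1 X2 x2 h1 h2|j _].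
- by rewrite cards0.
- by apply: leq_trans (leq_card_setU _ _).1 _; exact: leq_add.
apply: (@leq_trans (\sum_(t : j.-tuple L | k \notin t) D ^ j)); last first.
  by rewrite sum_nat_const leq_mul// (leq_trans (max_card _))// card_tuple.
elim/big_ind2: _ => [|X1 x1 X2 x2 h1 h2|t _].
- by rewrite cards0.
- by apply: leq_trans (leq_card_setU _ _).1 _; exact: leq_add.
- by have := card_grow A t [set u] degf; rewrite cards1 mul1n size_tuple.
Qed.

Lemma explored_ext (f g : conf) (A : {set V}) u k : u \in A ->
  (forall k', k' != k -> {in A, f k' =1 g k'}) ->
  explored f A u k = explored g A u k.
Proof.
move=> uA fg; apply: eq_bigr => j _; apply: eq_bigr => t kt.
apply: grow_ext => [|k' k't]; first by rewrite finset.sub1set.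
by apply: fg; apply: contraNneq kt => <-.
Qed.

Lemma explored_sub f (A : {set V}) u k : u \in A -> explored f A u k \subset A.
Proof.
move=> uA; apply/bigcupsP => j _; apply/bigcupsP => t _.
elim/last_ind: (tval t) => [|ks k' _]; first by rewrite finset.sub1set.
by rewrite grow_rcons; apply/fintype.subsetP => w; rewrite inE => /andP[].
Qed.

End Exploration.

Section Uncovered.
Variables (R : realType) (C V L : finType) (B : C -> {set C}) (b q : nat).
Hypothesis C0 : (0 < #|C|)%N.
Hypothesis symB : forall c c', (c' \in B c) = (c \in B c').
Hypothesis B_le : forall c, (#|B c| <= b)%N.
Hypothesis B_meet : forall c, (#|[set c' | ~~ [disjoint B c' & B c]]| <= q)%N.

Let m : R := #|C|%:R.
Let conf := {ffun L -> {ffun V -> C}}.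

Let m0 : 0 < m.
Proof. by rewrite ltr0n. Qed.

Let avg_avoid (S : {set V}) (X : {set C}) :
  avg (fun g : {ffun V -> C} => \prod_(s in S) (g s \notin X)%:R) =
  (1 - #|X|%:R / m) ^+ #|S| :> R.
Proof.
rewrite (avg_prod (fun s => s \in S) (fun _ c => (c \notin X)%:R))// prodr_const.
congr (_ ^+ _); have := @prC R _ (fun c => c \in X) C0; rewrite /pr => ->.
by rewrite -/(pr R (fun c => c \in X)) prE.
Qed.

(* Second moment method: far away cells are negatively correlated. *)
Lemma pr_few_uncovered (S : {set V}) (s : nat) : (#|S| <= s)%N -> b%:R < m ->
  pr R (fun g : {ffun V -> C} =>
    2 * #|~: nbhd_of B g S|%:R <= m * (1 - b%:R / m) ^+ s) <=
  4 * q%:R / (m * (1 - b%:R / m) ^+ s).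
Proof.
move=> Ss bm.
pose unc (g : {ffun V -> C}) x : R := \prod_(s in S) (g s \notin B x)%:R.
have uncE g x : unc g x = (x \notin nbhd_of B g S)%:R.
  rewrite /unc -natr_prod; congr _%:R; case: (boolP (x \in _)) => [/bigcupP[v vS xv]|nx].
    by rewrite (bigD1 v)//= symB xv.
  rewrite big1// => v vS; case: (boolP (g v \in B x)) => // gx.
  by case/negP: nx; apply/bigcupP; exists v => //; rewrite symB.
pose d x : R := #|B x|%:R / m.
have d_ge0 x : 0 <= d x by rewrite divr_ge0// ltW.
have d_le x : d x <= b%:R / m by rewrite ler_wpM2r ?invr_ge0 ?ler_nat// ltW.
have bm1 : b%:R / m < 1 by rewrite ltr_pdivrMr// mul1r.
pose p x : R := (1 - d x) ^+ #|S|.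
have base_ge0 x : 0 <= 1 - d x by rewrite subr_ge0 (le_trans (d_le x))// ltW.
have p_ge0 x : 0 <= p x by rewrite exprn_ge0.
have avg_unc x : avg (fun g => unc g x) = p x by exact: avg_avoid.
have avg_unc2 x y : avg (fun g => unc g x * unc g y) = (1 - #|B x :|: B y|%:R / m) ^+ #|S|.
  rewrite -avg_avoid; apply: eq_avg => g; rewrite -big_split; apply: eq_bigr => v _ /=.
  by rewrite -natrM mulnb finset.in_setU negb_or.
pose Y g : R := \sum_x unc g x.
have YE g : Y g = #|~: nbhd_of B g S|%:R.
  rewrite /Y; under eq_bigr do rewrite uncE.
  rewrite -natr_sum -sum1_card big_mkcond [in RHS]big_mkcond /=; congr _%:R.
  by apply: eq_bigr => x _; rewrite inE; case: (x \in _).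
pose E := \sum_x p x.
set mu := (1 - _) ^+ s.
have mu0 : 0 < mu by rewrite exprn_gt0// subr_gt0.
have mu_p x : mu <= p x.
  apply: (@le_trans _ _ ((1 - b%:R / m) ^+ #|S|)).
    have b0 : 0 <= 1 - b%:R / m by rewrite subr_ge0 ltW.
    rewrite /mu -(subnK Ss) exprD; apply: ler_piMl; first exact: exprn_ge0.
    by apply: exprn_ile1 => //; rewrite lerBlDr lerDl divr_ge0// ltW.
  apply: lerXn2r; last by rewrite lerD2l lerN2.
    by rewrite nnegrE subr_ge0 ltW.
  by rewrite nnegrE.
have E_ge : m * mu <= E.
  apply: le_trans (_ : \sum_(x : C) mu <= E); last by apply: ler_sum => x _.
  by rewrite sumr_const -[_ *+ _]mulr_natl.
have mmu0 : 0 < m * mu by exact: mulr_gt0.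
have E0 : 0 < E by exact: lt_le_trans E_ge.
have avgY : avg Y = E by rewrite avg_sum; apply: eq_bigr => x _.
(* For disjoint neighbourhoods 1 - d x - d y <= (1 - d x) (1 - d y); the other pairs are bounded by
   [p x] alone, and there are at most [q] of them for each [x]. *)
have p2_le x y : (1 - #|B x :|: B y|%:R / m) ^+ #|S| <=
    p x * p y + (~~ [disjoint B y & B x])%:R * p x.
  have u1 : #|B x :|: B y|%:R / m <= 1.
    by rewrite ler_pdivrMr// mul1r ler_nat max_card.
  case: (boolP [disjoint B y & B x]) => dj /=.
    rewrite mul0r addr0 -exprMn; apply: lerXn2r.
    - by rewrite nnegrE subr_ge0.
    - by rewrite nnegrE mulr_ge0.
    rewrite cardsU finset.setIC disjoint_setI0// cards0 subn0 natrD mulrDl.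
    rewrite -/(d x) -/(d y) -subr_ge0.
    rewrite (_ : _ - _ = d x * d y); last by ring.
    exact: mulr_ge0.
  rewrite mul1r; apply: le_trans (_ : p x <= _); last by rewrite lerDr mulr_ge0.
  apply: lerXn2r.
  - by rewrite nnegrE subr_ge0.
  - by rewrite nnegrE.
  - rewrite lerD2l lerN2 ler_wpM2r ?invr_ge0 ?(ltW m0)// ler_nat.
    by rewrite subset_leq_card// finset.subsetUl.
have varY : avg (fun g => (Y g - E) ^+ 2) <= q%:R * E.
  have -> : avg (fun g => (Y g - E) ^+ 2) = avg (fun g => Y g * Y g) - E ^+ 2.
    transitivity (avg (fun g => Y g * Y g + (- (2 * E)) * Y g + E ^+ 2)).
      by apply: eq_avg => g; ring.
    rewrite avgD avgD avgMl avgY avg_cst; first by ring.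
    exact: card_ffun_gt0.
  have -> : avg (fun g => Y g * Y g) = \sum_x \sum_y (1 - #|B x :|: B y|%:R / m) ^+ #|S|.
    transitivity (avg (fun g => \sum_x \sum_y unc g x * unc g y)).
      apply: eq_avg => g; rewrite /Y mulr_suml; apply: eq_bigr => x _.
      by rewrite mulr_sumr.
    rewrite avg_sum; apply: eq_bigr => x _; rewrite avg_sum; apply: eq_bigr => y _.
    exact: avg_unc2.
  rewrite lerBlDr.
  apply: (@le_trans _ _ (\sum_x (p x * E + q%:R * p x))).
    apply: ler_sum => x _; rewrite mulr_sumr.
    apply: (@le_trans _ _ (\sum_y (p x * p y + (~~ [disjoint B y & B x])%:R * p x))).
      by apply: ler_sum => y _; exact: p2_le.
    rewrite big_split /= lerD2l -mulr_suml ler_wpM2r// -natr_sum ler_nat.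
    apply: leq_trans (B_meet x); rewrite -sum1_card [leqRHS]big_mkcond /=.
    by apply: eq_leq; apply: eq_bigr => y _; rewrite inE; case: [disjoint _ & _].
  by rewrite big_split /= -mulr_suml -mulr_sumr expr2 addrC.
have mk := @markov_avg R _ (fun g => (Y g - E) ^+ 2) (fun g : {ffun V -> C} =>
    2 * #|~: nbhd_of B g S|%:R <= m * mu) (E ^+ 2 / 4).
apply: le_trans (mk _ _ _) _.
- by rewrite divr_gt0// exprn_gt0.
- by move=> g; exact: sqr_ge0.
(* Chebyshev: since m mu <= E, the event forces Y <= E / 2, that is a deviation of at least E /
   2. *)
- move=> g; rewrite -YE => Yg.
  have : 2 * Y g <= E by exact: le_trans E_ge.
  have : 0 <= Y g by rewrite YE.
  move=> h1 h2; rewrite -subr_ge0.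
  rewrite (_ : _ - _ = (E - 2 * Y g) * (3 / 2 * E - Y g) / 2); last by field.
  by rewrite divr_ge0// mulr_ge0//; lra.
apply: (@le_trans _ _ (q%:R * E / (E ^+ 2 / 4))).
  by rewrite ler_wpM2r// invr_ge0 divr_ge0// sqr_ge0.
rewrite [leLHS](_ : _ = 4 * q%:R / E); last by field; rewrite gt_eqF.
by rewrite ler_wpM2l ?mulr_ge0// lef_pV2.
Qed.

Definition touched (f : conf) (A : {set V}) u (v : V) :=
  [exists k, f k v \in nbhd_of B (f k) (explored B f A u k)].

(** With the cells outside [W] fixed, the covered regions are fixed, and each vertex of [W]
    independently avoids them in all layers with probability at least theta ^ |L|. *)
Lemma pr_all_touched (W : {set V}) (u : V) (theta : R) : u \notin W -> 0 <= theta ->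
  pr R (fun f : conf =>
    [forall k, theta * m <= #|~: nbhd_of B (f k) (explored B f (~: W) u k)|%:R] &&
    [forall v in W, touched f (~: W) u v]) <=
  expR (- (#|W|%:R * theta ^+ #|L|)).
Proof.
move=> uW th0; have uA : u \in ~: W by rewrite inE.
pose U (f : conf) k := nbhd_of B (f k) (explored B f (~: W) u k).
(* Vertex-first form, so that redrawing [W] redraws its vertices in every layer at once. *)
rewrite /pr avg_transp (avg_splice (~: W)); apply: avg_le => [|g]; first exact: expR_ge0.
have UE g' k : U (transp (splice (~: W) g g')) k = U (transp g) k.
  have E k' v : v \in ~: W -> transp (splice (~: W) g g') k' v = transp g k' v.
    by move=> vA; rewrite !ffunE vA.
  rewrite /U (@explored_ext _ _ _ B _ (transp g))// => [|k' _ v vA]; last exact: E.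
  apply: eq_bigr => v /(fintype.subsetP (explored_sub B _ _ uA)) vA.
  by rewrite E.
have L0 : (0 < #|{ffun L -> C}|)%N by exact: card_ffun_gt0.
case: (boolP [forall k, theta * m <= #|~: U (transp g) k|%:R]) => [/forallP thU|nU]; last first.
  rewrite (@eq_avg _ _ _ (fun=> 0)); first by rewrite avg_cst ?expR_ge0// card_ffun_gt0.
  move=> g'; apply/eqP; rewrite pnatr_eq0 eqb0; apply: contra nU => /andP[/forallP H _].
  by apply/forallP => k; have := H k; rewrite -/(U _ k) UE.
pose hit (x : {ffun L -> C}) := [exists k, x k \in U (transp g) k].
apply: (@le_trans _ _ (avg (fun g' : {ffun V -> {ffun L -> C}} =>
    \prod_(v in W) (hit (g' v))%:R))).
  apply: ler_avg => g'; rewrite -natr_prod ler_nat.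
  case: (boolP (_ && _)) => // /andP[_ /forall_inP tch].
  rewrite big1// => v vW; have /existsP[k kv] := tch v vW.
  suff -> : hit (g' v) by [].
  apply/existsP; exists k; rewrite -(UE g').
  by rewrite /U; move: kv; rewrite !ffunE inE vW.
rewrite (avg_prod (fun v => v \in W) (fun _ x => (hit x)%:R))// prodr_const -mulrN expRM_natl.
have -> : avg (fun x => (hit x)%:R) = 1 - \prod_k (#|~: U (transp g) k|%:R / m) :> R.
  have prk k : pr R (fun c => c \notin U (transp g) k) = #|~: U (transp g) k|%:R / m.
    by rewrite prE; congr (_%:R / _); apply: eq_card => c; rewrite inE.
  under eq_bigr do rewrite -prk.
  rewrite -(avg_prod xpredT (fun k c => (c \notin U (transp g) k)%:R : R) C0).
  apply/eqP; rewrite eq_sym subr_eq -avgD -[eqbLHS](avg_cst 1 L0); apply/eqP.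
  apply: eq_avg => x; rewrite -natr_prod -natrD -[LHS]/(1%:R); congr _%:R.
  case: (boolP (hit x)) => [/existsP[k kU]|/existsPn nU].
    by rewrite (bigD1 k)//= kU.
  by rewrite big1// => k _; rewrite nU.
apply: lerXn2r; rewrite ?nnegrE ?expR_ge0//.
  rewrite subr_ge0; apply: prodr_ile1 => k; rewrite divr_ge0 ?(ltW m0)//=.
  by rewrite ler_pdivrMr// mul1r ler_nat max_card.
apply: le_trans (expR_ge1Dx _); rewrite lerD2l lerN2 -prodr_const.
apply: ler_prod => k _; rewrite th0 /=.
by rewrite ler_pdivlMr.
Qed.

End Uncovered.

Lemma pr_pred0 (R : realFieldType) (T : finType) (A : pred T) :
  (forall x, ~~ A x) -> pr R A = 0.
Proof. by move=> nA; rewrite prE eq_card0 ?mul0r// => x; exact/negbTE/nA. Qed.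

Section Layers.
Variables (R : realType) (C V L : finType) (B : C -> {set C}) (b q : nat).
Hypothesis C0 : (0 < #|C|)%N.
Hypothesis symB : forall c c', (c' \in B c) = (c \in B c').
Hypothesis B_le : forall c, (#|B c| <= b)%N.
Hypothesis B_meet : forall c, (#|[set c' | ~~ [disjoint B c' & B c]]| <= q)%N.

Let m : R := #|C|%:R.
Let conf := {ffun L -> {ffun V -> C}}.

Let m0 : 0 < m.
Proof. by rewrite ltr0n. Qed.

(** All layers but [k] are fixed, which fixes the explored set; the second moment bound then applies
    to layer [k]. *)
Lemma pr_few_uncovered_layer (A : {set V}) (u : V) (k : L) (s : nat) :
  u \in A -> b%:R < m ->
  pr R (fun f : conf => (#|explored B f A u k| <= s)%N &&
    (2 * #|~: nbhd_of B (f k) (explored B f A u k)|%:R <=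
     m * (1 - b%:R / m) ^+ s)) <=
  4 * q%:R / (m * (1 - b%:R / m) ^+ s).
Proof.
move=> uA bm; set mu := (1 - _) ^+ s.
have mu0 : 0 < mu by rewrite exprn_gt0// subr_gt0 ltr_pdivrMr// mul1r.
have bd0 : 0 <= 4 * q%:R / (m * mu).
  by rewrite divr_ge0 ?mulr_ge0//; exact: ltW.
rewrite /pr (avg_splice (~: [set k])); apply: avg_le => [//|g].
have expE (g' : conf) :
    explored B (splice (~: [set k]) g g') A u k = explored B g A u k.
  apply: explored_ext => // k' k'k v _.
  by rewrite ffunE !inE k'k.
pose F (x : {ffun V -> C}) : R :=
  ((2 * #|~: nbhd_of B x (explored B g A u k)|%:R <= m * mu)%R)%:R.
have [small|big] := leqP #|explored B g A u k| s; last first.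
  rewrite (@eq_avg _ _ _ (fun=> 0)); first by rewrite avg_cst// card_ffun_gt0// card_ffun_gt0.
  by move=> g'; rewrite expE leqNgt big.
have T0 : (0 < #|{ffun V -> C}|)%N by exact: card_ffun_gt0.
apply: (@le_trans _ _ (avg (fun g' : conf => F (g' k)))).
  by apply: ler_avg => g'; rewrite expE small /F ffunE !inE eqxx.
by rewrite (avg_coord k F T0); exact: pr_few_uncovered.
Qed.

(** Unlike [walk], it has no empty case and its intermediate vertices differ from [v]. This keeps
    the ends of every edge distinct in the union bound, so that their cells are independent. *)
Fixpoint chain (f : conf) (ks : seq L) (x v : V) : bool :=
  match ks with
  | [::] => false
  | [:: k] => f k v \in B (f k x)
  | k :: ks' => [exists w, [&& w != v, w != x, f k w \in B (f k x) & chain f ks' w v]]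
  end.

Lemma chain_ext ks x v (f g : conf) : {in ks, forall k, f k = g k} ->
  chain f ks x v = chain g ks x v.
Proof.
elim: ks x => //= k [|k' ks] IH x fg; first by rewrite fg ?mem_head.
apply: eq_existsb => w; rewrite (fg k) ?mem_head//.
rewrite (_ : chain f (k' :: ks) w v = chain g (k' :: ks) w v)//; apply: IH => i iks.
by apply: fg; rewrite inE iks orbT.
Qed.

Let pr_adj (k : L) (x w : V) : w != x ->
  pr R (fun f : conf => f k w \in B (f k x)) <= b%:R / m.
Proof.
move=> wx; have T0 : (0 < #|{ffun V -> C}|)%N by exact: card_ffun_gt0.
rewrite /pr (avg_coord k (fun g : {ffun V -> C} => (g w \in B (g x))%:R) T0).
rewrite (avg_coord2 (fun c c' => (c \in B c')%:R) C0 wx).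
apply: avg_le => [|c]; first by rewrite divr_ge0// ltW.
have -> : avg (fun c' => (c \in B c')%:R) = pr R (fun c' => c' \in B c).
  by apply: eq_avg => c'; rewrite symB.
rewrite prE; apply: ler_wpM2r; first by rewrite invr_ge0 ltW.
by rewrite ler_nat; exact: B_le.
Qed.

Lemma pr_chain k ks (x v : V) : uniq (k :: ks) -> x != v ->
  pr R (fun f : conf => chain f (k :: ks) x v) <=
  b%:R / m * (#|V|%:R * (b%:R / m)) ^+ size ks.
Proof.
have bm0 : 0 <= b%:R / m by rewrite divr_ge0// ltW.
elim: ks k x => [|k' ks IH] k x.
  by move=> _ xv; rewrite mulr1; apply: pr_adj; rewrite eq_sym.
move=> /andP[kks uks] xv.
set beta := b%:R / m in bm0 IH *; set N := #|V|%:R * beta in IH *.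
have N0 : 0 <= N by rewrite mulr_ge0.
pose ev w (f : conf) := [&& w != v, w != x, f k w \in B (f k x) & chain f (k' :: ks) w v].
apply: (@le_trans _ _ (\sum_w pr R (ev w))).
  by apply: pr_exists_le => f /existsP.
have le_w w : true -> pr R (ev w) <= beta * (beta * N ^+ size ks).
  have bd0 : 0 <= beta * (beta * N ^+ size ks).
    exact: mulr_ge0 bm0 (mulr_ge0 bm0 (exprn_ge0 _ N0)).
  move=> _.
  have [wv|wv] := eqVneq w v.
    by rewrite pr_pred0// => f; rewrite /ev wv eqxx.
  have [wx|wx] := eqVneq w x.
    by rewrite pr_pred0// => f; rewrite /ev wx eqxx andbF.
  rewrite /pr (avg_splice [set k]).
  apply: (@le_trans _ _ (avg (fun f : conf => (f k w \in B (f k x))%:R *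
      pr R (fun g : conf => chain g (k' :: ks) w v)))).
    apply: ler_avg => f; rewrite -avgMl; apply: ler_avg => g.
    have E : chain (splice [set k] f g) (k' :: ks) w v = chain g (k' :: ks) w v.
      apply: chain_ext => i iks; rewrite ffunE inE.
      by case: eqP iks kks => // -> ->.
    by rewrite /ev wv wx E ffunE inE eqxx -natrM mulnb.
  rewrite avgMr; apply: ler_pM; rewrite ?pr_ge0//; first exact: pr_adj.
  exact: IH.
apply: (le_trans (ler_sum _ le_w)).
rewrite sumr_const -[_ *+ _]mulr_natl mulrCA [#|_|%:R * (_ * _)]mulrA.
by rewrite /= exprS.
Qed.

(** At most |L| - 1 colours are allowed, because a path from [u] spends at least one colour to enter
    [W]. This saves the factor that makes links unlikely. *)
Definition linked (W : {set V}) (f : conf) :=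
  [exists w in W, exists v in W, exists j : 'I_(#|L|).-1, exists t : j.+1.-tuple L,
    [&& w != v, uniq t & chain f t w v]].

(** The expected number of neighbours is at least 1, so the longest chains dominate and every chain
    gets their bound. *)
Lemma pr_linked (W : {set V}) : (1 < #|L|)%N -> 1 <= #|V|%:R * (b%:R / m) ->
  pr R (linked W) <= #|W|%:R ^+ 2 * (#|L|%:R ^+ #|L| * (b%:R / m *
    (#|V|%:R * (b%:R / m)) ^+ (#|L| - 2))).
Proof.
move=> L1 N1; set N := #|V|%:R * _ in N1 *; set beta := b%:R / m.
have beta0 : 0 <= beta by rewrite divr_ge0// ltW.
pose K : R := beta * N ^+ (#|L| - 2).
have K0 : 0 <= K by rewrite mulr_ge0// exprn_ge0// (le_trans ler01).
pose ev (w v : V) (j : 'I_(#|L|).-1) (t : j.+1.-tuple L) (f : conf) :=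
  [&& w != v, uniq t & chain f t w v].
have pr_ev w v j t : pr R (@ev w v j t) <= K.
  rewrite /ev; have [wv|wv] := eqVneq w v.
    by rewrite pr_pred0.
  have [ut|nut] := boolP (uniq t); last first.
    by rewrite pr_pred0// => f; rewrite andbF.
  case/tupleP: t ut => k ks ukks.
  apply: (le_trans (pr_chain ukks wv)); rewrite /K ler_wpM2l// size_tuple.
  have L2 : (0 < #|L|.-1)%N by rewrite -ltnS prednK// ltnW.
  by apply: ler_weXn2l => //; rewrite subn2 -ltnS prednK.
pose evj w v (j : 'I_(#|L|).-1) f := [exists t, @ev w v j t f].
have pr_evj w v j : pr R (evj w v j) <= #|L|%:R ^+ j.+1 * K.
  apply: (@le_trans _ _ (\sum_(t : j.+1.-tuple L) pr R (@ev w v j t))).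
    by apply: pr_exists_le => f /existsP.
  apply: (le_trans (ler_sum _ (fun t _ => pr_ev w v j t))).
  by rewrite sumr_const card_tuple -[_ *+ _]mulr_natl natrX.
pose evw w v f := [exists j, evj w v j f].
have LR1 : 1 <= #|L|%:R :> R by rewrite ler1n ltnW.
have pr_evw w v : pr R (evw w v) <= #|L|%:R ^+ #|L| * K.
  apply: (@le_trans _ _ (\sum_(j : 'I_(#|L|).-1) pr R (evj w v j))).
    by apply: pr_exists_le => f /existsP.
  apply: (@le_trans _ _ (\sum_(j : 'I_(#|L|).-1) #|L|%:R ^+ (#|L|).-1 * K)).
    apply: ler_sum => j _; apply: (le_trans (pr_evj w v j)).
    by rewrite ler_wpM2r// ler_weXn2l//; exact: ltn_ord.
  rewrite sumr_const card_ord -[_ *+ _]mulr_natl mulrA ler_wpM2r//.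
  case: #|L| L1 => // l _; rewrite exprS /= ler_wpM2r ?exprn_ge0//.
  by rewrite ler_nat.
pose evW (p : V * V) f := [&& p.1 \in W, p.2 \in W & evw p.1 p.2 f].
apply: (@le_trans _ _ (\sum_p pr R (evW p))).
  apply: pr_exists_le => f /exists_inP[w wW /exists_inP[v vW wv]].
  by exists (w, v); rewrite /evW wW vW.
apply: (@le_trans _ _ (\sum_(p : V * V) ((p.1 \in W) && (p.2 \in W))%:R * (#|L|%:R ^+ #|L| * K))).
  apply: ler_sum => -[w v] _ /=.
  case: (boolP ((w \in W) && (v \in W))) => [/andP[wW vW]|nW].
    rewrite mul1r; apply: le_trans (pr_evw w v); apply: ler_pr => f.
    by rewrite /evW => /and3P[].
  by rewrite mul0r pr_pred0// => f; rewrite /evW /= andbA (negPf nW).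
rewrite -mulr_suml; apply: ler_wpM2r.
  exact: mulr_ge0 (exprn_ge0 _ (ler0n _ _)) K0.
rewrite -natr_sum -natrX ler_nat -mulnn -cardsX -sum1_card [leqRHS]big_mkcond /=.
by apply: eq_leq; apply: eq_bigr => -[w v] _; rewrite finset.in_setX; case: (_ && _).
Qed.

End Layers.

(** * Why no rainbow path reaches an untouched vertex *)

Section Untouched.
Variables (C : finType) (B : C -> {set C}) (h n : nat).
Variables (f : {ffun 'I_h -> {ffun 'I_n -> C}}) (adj : 'I_h -> 'I_n -> 'I_n -> bool).
Hypothesis f_adj : forall k x y, adj k x y -> f k y \in B (f k x).

Lemma chain_rainbow_path y v vs cs :
  rainbow_path adj y v vs cs -> y != v -> chain B f cs y v.
Proof.
elim: vs y cs => [|z vs IH] y [|c cs] [] // sz u1 u2 la al yv.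
  by move: la yv => /= ->; rewrite eqxx.
case: vs IH sz u1 la al => [|z' vs] IH sz u1 la al.
  move: sz la al; case: cs {u2} => // _ /= <-.
  by rewrite andbT; exact: f_adj.
case: cs u2 sz al => // c' cs u2 sz al.
apply/existsP; exists z.
have /andP[yz al'] : adj c y z && all (fun t => adj t.2.2 t.1 t.2.1)
  (zip (z :: z' :: vs) (zip (z' :: vs) (c' :: cs))) by [].
have /andP[ny u1'] : (y \notin z :: z' :: vs) && uniq (z :: z' :: vs) by [].
have zv : z != v.
  have vl : v \in z' :: vs by rewrite -la /=; exact: mem_last.
  by move: u1' => /andP[nz _]; apply: contraNneq nz => ->.
have zy : z != y.
  by rewrite eq_sym; apply: contraNneq ny => ->; exact: mem_head.
apply/and4P; split => //; first exact: f_adj.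
have rp : rainbow_path adj z v (z' :: vs) (c' :: cs).
  split => //; first by case: sz => sz; congr _.+1.
  by move/andP: u2 => [].
exact: IH rp zv.
Qed.

Lemma untouched_no_path (W : {set 'I_n}) u v vs cs :
  u \notin W -> v \in W -> ~~ touched B f (~: W) u v -> ~~ linked B W f ->
  ~ rainbow_path adj u v vs cs.
Proof.
move=> uW vW nt nl.
(* The path is followed to its first vertex in [W]; [ps] holds the colours already spent. If that
   vertex is [v], its last colour is not in [ps], so [v] is touched; otherwise the rest of the path
   links two vertices of [W]. *)
suff main ps x : x \in grow B f (~: W) ps [set u] -> x \notin W ->
    uniq (ps ++ cs) -> ~ rainbow_path adj x v vs cs.
  move=> rp; apply: (main [::] u) (rp) => //; first exact: set11.
  by case: rp.
elim: vs cs ps x => [|y vs IH] [|c cs] ps x xg xW ups [] // sz u1 u2 la al.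
  by move: la xW => /= ->; rewrite vW.
have /andP[xy al'] : adj c x y && all (fun t => adj t.2.2 t.1 t.2.1)
  (zip (y :: vs) (zip vs cs)) by [].
have rp : rainbow_path adj y v vs cs.
  split=> //; first by move: sz => [].
  - by move: u1 => /andP[].
  - by move: u2 => /andP[].
have sizes : (size ps + size cs < h)%N.
  by have := max_card [in ps ++ c :: cs]; rewrite (card_uniqP ups) size_cat card_ord /= addnS.
have y_nbhd : f c y \in nbhd_of B (f c) (grow B f (~: W) ps [set u]).
  by apply/bigcupP; exists x => //; exact: f_adj.
have [yW|yW] := boolP (y \in W); last first.
  apply: (IH cs (rcons ps c) y _ yW _ rp); last by rewrite cat_rcons.
  by rewrite grow_rcons !inE yW.
have [yv|yv] := eqVneq y v.
  case/negP: nt; apply/existsP; exists c; rewrite -yv.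
  case/bigcupP: y_nbhd => w wg yw; apply/bigcupP; exists w => //.
  have ps_h : (size ps < #|'I_h|)%N.
    by rewrite card_ord (leq_ltn_trans _ sizes)// leq_addr.
  apply/bigcupP; exists (Ordinal ps_h) => //; apply/bigcupP; exists (in_tuple ps) => //=.
  by move: ups; rewrite cat_uniq /= => /and3P[_ /norP[]].
case/negP: nl; apply/exists_inP; exists y => //; apply/exists_inP; exists v => //.
have ch := chain_rainbow_path rp yv.
case: cs ch sizes u2 {IH ups sz u1 la al al' rp} => // c' cs ch sizes u2.
have cs_h : (size cs < #|'I_h|.-1)%N.
  rewrite card_ord -ltnS prednK; last exact: leq_ltn_trans sizes.
  by apply: leq_ltn_trans sizes; rewrite leq_addl.
apply/existsP; exists (Ordinal cs_h); apply/existsP; exists (in_tuple (c' :: cs)).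
by rewrite yv ch andbT; move: u2 => /andP[].
Qed.

End Untouched.

(** One term for each way to fail: a link inside [W], a crowded block, a layer almost covered, or
    every vertex of [W] touched. A block of radius 1 has at most 9 cells and meets only blocks
    centred within radius 2, at most 25 cells; 100 is 4 * 25. *)
Lemma rainbow_event_compl_ge (R : realType) d (Omega : measurableType d)
  (P : probability Omega R) h n M (pos : 'I_h -> 'I_n -> Omega -> R * R)
  (r mu : R) (D s : nat) (u : 'I_n) (W : {set 'I_n}) :
  iid_uniform_positions P pos -> (0 < M)%N -> r * M%:R <= 1 -> (1 < h)%N ->
  u \notin W -> W != finset.set0 -> (\sum_(j < h) h ^ j * D ^ j <= s)%N ->
  let m : R := #|{: 'I_M * 'I_M}|%:R in 9 < m -> 1 <= n%:R * (9 / m) ->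
  mu = (1 - 9 / m) ^+ s ->
  ((1 - (#|W|%:R ^+ 2 * (h%:R ^+ h * (9 / m * (n%:R * (9 / m)) ^+ (h - 2))) +
    (h%:R * m * (2 ^- D * expR (n%:R * (9 / m))) +
     (h%:R * (100 / (m * mu)) + expR (- (#|W|%:R * (mu / 2) ^+ h))))))%:E <=
   P (~` rainbow_event pos r)%classic)%E.
Proof.
move=> Hpos M0 rM h1 uW W0 Ds m m9 n9 muE.
have C0 : (0 < #|{: 'I_M * 'I_M}|)%N by rewrite card_prod card_ord muln_gt0 M0.
have symB (c c' : 'I_M * 'I_M) : (c' \in block 1 c) = (c \in block 1 c') by exact: block_sym.
have B_le (c : 'I_M * 'I_M) : (#|block 1 c| <= 9)%N by exact: (card_block M0 1 c).
have B_meet (c : 'I_M * 'I_M) : (#|[set c' | ~~ [disjoint block 1 c' & block 1 c]]| <= 25)%N.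
  apply: leq_trans (card_block M0 2 c); apply: subset_leq_card.
  apply/fintype.subsetP => c'; rewrite inE -finset.setI_eq0 => /set0Pn[x].
  rewrite inE => /andP[h2 h3].
  by apply: (@block_trans _ M0 1 1 _ _ _ h3); rewrite block_sym.
have mu0 : 0 < mu.
  by rewrite muE exprn_gt0// subr_gt0 ltr_pdivrMr ?mul1r// (lt_trans _ m9).
pose conf := config M h n.
pose rea (f : conf) k := explored (block 1) f (~: W) u k.
pose good (f : conf) := [exists v in W, ~~ touched (block 1) f (~: W) u v] &&
  ~~ linked (block 1) W f.
pose bad1 (f : conf) := linked (block 1) W f.
pose bad2 (f : conf) := ~~ max_degree (block 1) D f.
pose bad3 k (f : conf) := (#|rea f k| <= s)%N &&
  (2 * #|~: nbhd_of (block 1) (f k) (rea f k)|%:R <= m * mu).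
pose bad4 (f : conf) := [forall k, mu / 2 * m <= #|~: nbhd_of (block 1) (f k) (rea f k)|%:R] &&
  [forall v in W, touched (block 1) f (~: W) u v].
have conf0 : (0 < #|{: conf}|)%N by do 2 apply: card_ffun_gt0.
have p1 : pr R bad1 <= #|W|%:R ^+ 2 * (h%:R ^+ h * (9 / m * (n%:R * (9 / m)) ^+ (h - 2))).
  have := @pr_linked R _ 'I_n 'I_h (block 1) 9 C0 symB B_le W.
  by rewrite !card_ord; apply.
have p2 : pr R bad2 <= h%:R * m * (2 ^- D * expR (n%:R * (9 / m))).
  have := @pr_max_degree R _ 'I_n 'I_h (block 1) 9 C0 B_le D.
  by rewrite !card_ord.
have p3 : pr R (fun f => [exists k, bad3 k f]) <= h%:R * (100 / (m * mu)).
  apply: (@le_trans _ _ (\sum_k pr R (bad3 k))).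
    by apply: pr_exists_le => f /existsP.
  have le_k (k : 'I_h) : true -> pr R (bad3 k) <= 100 / (m * mu).
    move=> _; rewrite /bad3 muE.
    have uA : u \in ~: W by rewrite inE.
    apply: le_trans (@pr_few_uncovered_layer R _ 'I_n 'I_h (block 1) 9 25 C0
      symB B_le B_meet (~: W) u k s uA m9) _.
    by rewrite -natrM.
  apply: (le_trans (ler_sum _ le_k)).
  by rewrite sumr_const card_ord -[_ *+ _]mulr_natl.
have p4 : pr R bad4 <= expR (- (#|W|%:R * (mu / 2) ^+ h)).
  have th0 : 0 <= mu / 2 by rewrite divr_ge0// ltW.
  by have := @pr_all_touched R _ 'I_n 'I_h (block 1) C0 W u (mu / 2) uW th0; rewrite card_ord.
have pbad : pr R (fun f => ~~ good f) <= pr R bad1 + (pr R bad2 +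
    (pr R (fun f => [exists k, bad3 k f]) + pr R bad4)).
  pose bad34 f := [exists k, bad3 k f] || bad4 f.
  pose bad234 f := bad2 f || bad34 f.
  apply: le_trans (@prU_le R _ _ bad1 bad234 _) _.
    move=> f; rewrite /bad234 /bad34 /bad1 /good negb_and => /orP[nt|/negPn -> //].
    case: (linked _ _ _) => //=.
    have [//|/negPn deg] := boolP (bad2 f).
    have [//|/existsPn nb3] := boolP [exists k, bad3 k f].
    rewrite /bad4; apply/andP; split; last first.
      apply/forall_inP => v vW; apply: contraR nt => nt.
      by apply/exists_inP; exists v.
    apply/forallP => k; have := nb3 k; rewrite /bad3.
    have -> : (#|rea f k| <= s)%N.
      by apply: leq_trans Ds; have := card_explored (~: W) u k deg; rewrite card_ord.
    by rewrite /= -ltNge => /ltW H; rewrite mulrAC ler_pdivrMr// mulrC [leRHS]mulrC.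
  rewrite lerD2l.
  apply: le_trans (@prU_le R _ _ bad2 bad34 (fun f H => H)) _.
  by rewrite lerD2l; exact: prU_le.
apply: le_trans (_ : ((1 - pr R (fun f => ~~ good f))%:E <= _)%E).
  by rewrite lee_fin lerB// (le_trans pbad)// lerD// lerD// lerD.
rewrite -prC//.
apply: le_trans (_ : ((pr R good)%:E <= _)%E).
  by rewrite lee_fin; apply: ler_pr => f; rewrite negbK.
apply: (pr_grid_le M0 Hpos) => [|w f lf].
  by apply: measurableC; apply: measurable_rainbow_event; case: Hpos.
move=> /andP[/exists_inP[v vW nt] nl] rc.
have uv : u != v by apply: contraNneq uW => ->.
have [vs [cs rp]] := rc u v uv.
apply: (untouched_no_path _ uW vW nt nl rp) => k x y /andP[_ xy].
exact: (edist_block M0 rM (lf k x) (lf k y) xy).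
Qed.

Local Open Scope classical_set_scope.
Local Open Scope ring_scope.

(** * Asymptotics of the threshold *)

Lemma near_ln_ge (R : realType) (K : R) : \forall n \near \oo, K <= ln (n%:R : R).
Proof.
near=> n; have n0 : 0 < n%:R :> R by rewrite ltr0n; near: n; exact: nbhs_infty_gt.
by rewrite -ler_expR lnK ?posrE//; near: n; exact: nbhs_infty_ger.
Unshelve. all: by end_near. Qed.

(** The exponential is a square of a number at least 1 + a x / 2, hence at least a ^ 2 x ^ 2 / 4. *)
Lemma le_expR_lin (R : realType) (a K x : R) : 0 < a -> 0 <= K ->
  4 * K / a ^+ 2 <= x -> K * x <= expR (a * x).
Proof.
move=> a0 K0; have a20 := exprn_gt0 2 a0; rewrite ler_pdivrMr// => Kx.
have x0 : 0 <= x.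
  have : 0 <= x * a ^+ 2 by apply: le_trans Kx; rewrite mulr_ge0.
  by rewrite pmulr_lge0.
have -> : a * x = a * x / 2 + a * x / 2 by field.
rewrite expRD; have := expR_ge1Dx (a * x / 2).
set E := expR _ => HE; have ax0 : 0 <= a * x / 2 by rewrite divr_ge0// mulr_ge0// ltW.
have E2 : (a * x / 2) * (a * x / 2) <= E * E by apply: ler_pM => //; lra.
apply: le_trans E2; rewrite (_ : _ / 2 * _ = x * a ^+ 2 * x / 4); last by field.
by rewrite ler_pdivlMr// mulrAC ler_wpM2r// mulrC.
Qed.

Section Threshold.
Variables (R : realType) (h : nat).
Hypothesis hh : (2 <= h)%N.

Let h0 : h%:R != 0 :> R.
Proof. by rewrite pnatr_eq0; lia. Qed.

Definition rootn (n : nat) : R := expR (ln n%:R / h%:R).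
Definition rootln (n : nat) : R := (ln n%:R) `^ (h%:R^-1).
Definition threshold (n : nat) : R :=
  (ln n%:R / n%:R ^+ (h - 1)) `^ (1 / (2 * h%:R)).

Lemma rootn_gt0 n : 0 < rootn n.
Proof. exact: expR_gt0. Qed.

Lemma rootnX n : (0 < n)%N -> rootn n ^+ h = n%:R.
Proof.
move=> n0; rewrite /rootn -expRM_natl mulrC divfK//.
by rewrite lnK// posrE ltr0n.
Qed.

Lemma rootlnX n : 0 <= ln (n%:R : R) -> rootln n ^+ h = ln n%:R.
Proof.
move=> L0; rewrite /rootln -powR_mulrn ?powR_ge0// -powRrM mulVf//.
exact: powRr1.
Qed.

Lemma rootln_ge1 n : 1 <= ln (n%:R : R) -> 1 <= rootln n.
Proof.
move=> L1; have {1}<- : 1 `^ (h%:R^-1) = 1 :> R by rewrite powR1.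
apply: ge0_ler_powR => //.
  by rewrite nnegrE.
by rewrite nnegrE (le_trans ler01).
Qed.

Lemma rootlnX_le n k : 1 <= ln (n%:R : R) -> (k <= h)%N -> rootln n ^+ k <= ln n%:R.
Proof.
move=> L1 kh; rewrite -rootlnX; last exact: le_trans L1.
by apply: ler_weXn2l => //; exact: rootln_ge1.
Qed.

(** Areas, hence all densities, involve the square of the radius, where only the h-th roots of n and
    log n remain. *)
Lemma thresholdE n : 0 <= ln (n%:R : R) -> (0 < n)%N ->
  threshold n ^+ 2 = rootln n / rootn n ^+ (h - 1).
Proof.
move=> L0 n0; rewrite /threshold -powR_mulrn ?powR_ge0// -powRrM.
have -> : 1 / (2 * h%:R) * 2 = h%:R^-1 :> R by field.
rewrite powRM ?invr_ge0 ?exprn_ge0//; congr (_ * _).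
set y := (rootn n ^+ (h - 1))^-1.
have y0 : 0 <= y by rewrite invr_ge0 exprn_ge0// ltW// rootn_gt0.
have -> : (n%:R ^+ (h - 1))^-1 = y `^ h%:R.
  by rewrite powR_mulrn// -(rootnX n0) exprVn exprAC.
by rewrite -powRrM mulfV// powRr1.
Qed.

Lemma near_rootn (K : R) : \forall n \near \oo, K * ln n%:R <= rootn n.
Proof.
have [K0|K0] := leP 0 K; last first.
  near=> n; apply: (@le_trans _ _ 0); last exact: ltW (rootn_gt0 n).
  by rewrite nmulr_rle0//; near: n; exact: near_ln_ge.
near=> n; rewrite /rootn [ln _ / _]mulrC; apply: le_expR_lin => //.
  by rewrite invr_gt0 ltr0n; lia.
by near: n; exact: near_ln_ge.
Unshelve. all: by end_near. Qed.

Lemma near_threshold (K : R) : 0 < K -> \forall n \near \oo, threshold n ^+ 2 <= K.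
Proof.
move=> K0; near=> n.
have L1 : 1 <= ln (n%:R : R) by near: n; exact: near_ln_ge.
have L0 : 0 <= ln (n%:R : R) by exact: le_trans L1.
have n0 : (0 < n)%N by near: n; exact: nbhs_infty_gt.
have Kn : K^-1 * ln n%:R <= rootn n by near: n; exact: near_rootn.
have N1 : 1 <= rootn n.
  by rewrite -expR0 ler_expR divr_ge0.
rewrite thresholdE// ler_pdivrMr ?exprn_gt0 ?rootn_gt0//.
apply: (@le_trans _ _ (ln n%:R)).
  by rewrite -[leLHS]expr1 rootlnX_le//; lia.
rewrite ler_pdivrMl// in Kn; apply: (le_trans Kn); rewrite ler_pM2l//.
by rewrite -[leLHS]expr1 ler_weXn2l//; lia.
Unshelve. all: by end_near. Qed.

End Threshold.

(** M is 20 / r rounded up, so r M lies between 20 and 20 + r; [rho] absorbs this rounding, and 71 /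
    100 * 400 = 284. *)
Lemma disk_grid (R : realType) (r rho : R) : 0 < r -> 0 < rho < 1 ->
  r <= 2^-1 -> (20 + r) ^+ 2 * rho <= 400 -> exists M : nat,
  [/\ (0 < M)%N, 20 <= r * M%:R, (40 <= M)%N,
    rho * (71 / 100) * r ^+ 2 * #|{: 'I_M * 'I_M}|%:R <= 284 &
    400 <= r ^+ 2 * #|{: 'I_M * 'I_M}|%:R].
Proof.
move=> r0 /andP[rho0 rho1] r2 rrho.
pose M := (Num.truncn (20 / r)).+1; exists M.
have M1 : 20 / r < M%:R by rewrite /M; exact: truncnS_gt.
have M2 : M%:R <= 20 / r + 1 by rewrite /M -natr1 lerD2r truncn_le divr_ge0// ltW.
have rM : 20 <= r * M%:R by rewrite mulrC -ler_pdivrMr// ltW.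
have rM2 : r * M%:R <= 20 + r.
  have -> : 20 + r = r * (20 / r + 1) by field; rewrite gt_eqF.
  by rewrite ler_pM2l.
have cE : r ^+ 2 * #|{: 'I_M * 'I_M}|%:R = (r * M%:R) ^+ 2.
  by rewrite card_prod card_ord natrM exprMn expr2.
split=> //.
- by rewrite -(ler_nat R); nra.
- rewrite -mulrA cE.
  have : (r * M%:R) ^+ 2 <= (20 + r) ^+ 2 by rewrite ler_pXn2r ?nnegrE//; lra.
  nra.
- by rewrite cE; nra.
Qed.

Lemma disk_meet_le (M K : nat) (c : 'I_M * 'I_M) :
  (#|[set c' | ~~ [disjoint disk K c' & disk K c]]%SET| <= (4 * K + 1) ^ 2)%N.
Proof.
have -> : (4 * K)%N = (2 * (K + K))%N by lia.
have M0 : (0 < M)%N by case: (c) => i _; exact: leq_ltn_trans (ltn_ord i).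
apply: leq_trans (card_block M0 (K + K) c); apply: subset_leq_card.
apply/fintype.subsetP => c'; rewrite inE -finset.setI_eq0 => /set0Pn[x].
rewrite inE => /andP[/(fintype.subsetP (disk_block M0 _ _)) h1].
move=> /(fintype.subsetP (disk_block M0 _ _)) h2.
by apply: (block_trans M0 h2); rewrite block_sym.
Qed.

(** * Connectivity above the threshold *)

Section Connectivity.
Variables (R : realType) (h : nat).
Hypothesis hh : (2 <= h)%N.
Variable b : R.
Hypothesis b0 : 0 < b.

Let g : R := 71 / 100 * b ^+ 2.

(* [r := b * threshold n] and the cells have side about [r / 20]; then
   [71/100 = 284/20^2], where 284 cells lie in a quarter of a disk, and 17 and
   4 bound [(4*20+1)^2/20^2] and [(2*20)^2/20^2]. *)
Definition disk_grid_bounds (rho : R) (n M : nat) : Prop :=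
  [/\ (0 < M)%N,
    20 <= b * threshold R h n * M%:R,
    forall c : 'I_M * 'I_M, rho * g * threshold R h n ^+ 2 * #|{: 'I_M * 'I_M}|%:R <=
      #|disk 20 c|%:R,
    forall c : 'I_M * 'I_M, ~~ corner 20 c ->
      2 * (rho * g * threshold R h n ^+ 2) <= #|disk 20 c|%:R / #|{: 'I_M * 'I_M}|%:R &
    (forall c : 'I_M * 'I_M, #|[set c' | ~~ [disjoint disk 20 c' & disk 20 c]]%SET|%:R <=
      17 * (b ^+ 2 * threshold R h n ^+ 2) * #|{: 'I_M * 'I_M}|%:R) /\
    #|[set c : 'I_M * 'I_M | corner 20 c]%SET|%:R <=
      4 * (b ^+ 2 * threshold R h n ^+ 2) * #|{: 'I_M * 'I_M}|%:R].

Lemma near_disk_grid (rho : R) : 0 < rho < 1 ->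
  \forall n \near \oo, exists M : nat, disk_grid_bounds rho n M.
Proof.
(* For k <= 1, (20 + k) ^ 2 <= 400 + 41 k, which the choice of [k] keeps below 400 / rho. *)
move=> rho01; have /andP[rho0 rho1] := rho01; pose k : R := Num.min 2^-1 (400 / rho - 400) / 41.
have k0 : 0 < k.
  apply: divr_gt0; last by rewrite ltr0n.
  rewrite lt_min invr_gt0 ltr0n subr_gt0; apply/andP; split=> [//|].
  have h4 : 0 < 400 :> R by rewrite ltr0n.
  by rewrite (ltr_pdivlMr _ _ rho0) (gtr_pMr _ h4) rho1.
have k41 : 41 != 0 :> R by rewrite pnatr_eq0.
have k1 : k * 41 <= 2^-1 by rewrite (divfK k41) ge_min lexx.
have k2 : k * 41 <= 400 / rho - 400 by rewrite (divfK k41) ge_min lexx orbT.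
near=> n.
set t := threshold R h n.
have b20 : 0 < b ^+ 2 by exact: exprn_gt0.
have L1 : 1 <= ln (n%:R : R) by near: n; exact: near_ln_ge.
have n0 : (0 < n)%N by near: n; exact: nbhs_infty_gt.
have t0 : 0 < t.
  rewrite /t /threshold powR_gt0// divr_gt0 ?exprn_gt0 ?ltr0n//.
  exact: lt_le_trans L1.
have tk : t ^+ 2 <= (k / b) ^+ 2.
  by rewrite /t; near: n; exact: (near_threshold hh (exprn_gt0 2 (divr_gt0 k0 b0))).
have {}tk : b * t <= k.
  rewrite mulrC -ler_pdivlMr// -(@ler_pXn2r _ 2) ?nnegrE// ltW//.
  by rewrite divr_gt0.
have r0 : 0 < b * t by exact: mulr_gt0.
have [] := @disk_grid R (b * t) rho r0 rho01.
- lra.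
- rewrite -ler_pdivlMr//; apply: (@le_trans _ _ (400 + 41 * k)); last lra.
  have : (20 + b * t) ^+ 2 <= (20 + k) ^+ 2 by rewrite ler_pXn2r ?nnegrE//; lra.
  nra.
move=> M [M_gt0 rM M40 h284 h400]; exists M.
have C0 : 0 < #|{: 'I_M * 'I_M}|%:R :> R.
  by rewrite ltr0n card_prod card_ord muln_gt0 M_gt0.
have E : rho * g * t ^+ 2 = rho * (71 / 100) * (b * t) ^+ 2 by rewrite /g; ring.
rewrite /disk_grid_bounds -/t E -exprMn; split => //.
- by move=> c; apply: (le_trans h284); rewrite ler_nat card_disk_ge.
- move=> c nc; rewrite ler_pdivlMr// -mulrA.
  apply: (@le_trans _ _ 568); first by lra.
  by rewrite ler_nat card_disk_ge2.
split.
- move=> c; apply: (@le_trans _ _ (6561%:R)); first by rewrite ler_nat disk_meet_le.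
  by rewrite -mulrA; lra.
- apply: (@le_trans _ _ (1600%:R)); first by rewrite ler_nat card_corner.
  by rewrite -mulrA; lra.
Unshelve. all: by end_near. Qed.

Lemma near_ratio (K : R) : 0 < K -> \forall n \near \oo, ln n%:R / rootn R h n <= K.
Proof.
move=> K0; near=> n; rewrite ler_pdivrMr ?rootn_gt0// -ler_pdivrMl//.
by near: n; exact: near_rootn.
Unshelve. all: by end_near. Qed.

(** The bound 28 / 10 lies just below 5.68 ^ 3 / 64. Losing a factor 3 / 4 leaves the exponent 21 /
    10, still above the 2 needed for the union bound. *)
Lemma near_walk_ge3 : (3 <= h)%N -> 28 / 10 <= g ^+ h ->
  \forall n \near \oo, exists M : nat, [/\ (0 < M)%N,
    20 <= b * threshold R h n * M%:R &
    forall u v : 'I_n, u != v ->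
      pr R (fun f : config M h n => ~~ walk (disk 20) f (enum 'I_h) u v) <=
      expR (- (21 / 10 * ln n%:R)) + h%:R * expR (- (3 * ln n%:R))].
Proof.
move=> h3 gh.
have h1E : ((h - 1).+1 = h)%N by lia.
have h1_gt0 : (1 <= h - 1)%N by lia.
have h1E3 : (h - 1 = (h - 3).+2)%N by lia.
have h3E : (h = (h - 3).+3)%N by lia.
have h2E : (2 * h - 1 = (h - 3) + (h - 3) + 5)%N by lia.
have h3_le : ((h - 3).+2 <= h)%N by lia.
(* The final exponent contains rho ^ (2h - 1), which is at least 3 / 4 by the Bernoulli
   inequality. *)
pose rho : R := 1 - (8 * h%:R)^-1.
have h8 : 24 <= 8 * h%:R :> R by rewrite -natrM ler_nat; lia.
have rho_lb : 23 / 24 <= rho.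
  rewrite /rho; have : (8 * h%:R)^-1 <= 24^-1 :> R by rewrite lef_pV2 ?posrE//; lra.
  lra.
have rho1 : rho < 1 by rewrite /rho gtrBl invr_gt0; lra.
have rho01 : 0 < rho < 1 by rewrite rho1 andbT; lra.
have rho0 : 0 < rho by lra.
have rhoX : 3 / 4 <= rho ^+ (2 * h - 1).
  have bern (k : nat) : 1 - k%:R * (8 * h%:R)^-1 <= rho ^+ k.
    elim: k => [|k IHk]; first by rewrite mul0r subr0 expr0.
    rewrite exprSr -natr1; set i := (8 * h%:R)^-1 in IHk *.
    have i0 : 0 <= i by rewrite invr_ge0; lra.
    apply: le_trans (ler_wpM2r (ltW rho0) IHk).
    rewrite /rho -/i -subr_ge0 (_ : _ - _ = k%:R * (i * i)); last by ring.
    by rewrite !mulr_ge0.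
  apply: le_trans (bern _); rewrite lerBrDl -lerBrDr ler_pdivrMr; last lra.
  have : (2 * h - 1)%:R <= 2 * h%:R :> R by rewrite -natrM ler_nat; lia.
  lra.
have b20 : 0 < b ^+ 2 by exact: exprn_gt0.
have g0 : 0 < g by rewrite /g; lra.
pose kap := rho * g; have kap0 : 0 < kap by exact: mulr_gt0.
(* Then (1 - e) ^ 3 >= 1 - 3 e = rho. *)
pose e : R := (1 - rho) / 3.
have e0 : 0 < e by rewrite /e; lra.
have e1 : e < 1 by rewrite /e; lra.
have rho_e : rho <= (1 - e) ^+ 3.
  have -> : rho = 1 - 3 * e by rewrite /e; field.
  rewrite -subr_ge0 (_ : _ - _ = e ^+ 2 * (3 - e)); last by ring.
  by rewrite mulr_ge0 ?exprn_ge0 ?subr_ge0//; lra.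
pose c2 : R := 17 * b ^+ 2 / kap.
have c20 : 0 < c2 by rewrite divr_gt0// mulr_gt0.
have K20 : 0 < c2 * (3 / (rho * kap) + kap).
  by rewrite mulr_gt0// addr_gt0// divr_gt0// mulr_gt0.
have K30 : 0 < 3 / (rho * kap) + 2 * kap.
  by rewrite addr_gt0// ?divr_gt0// mulr_gt0.
have K00 : 0 < rho * kap by exact: mulr_gt0.
have K10 : 0 < e / kap ^+ (h - 1) by rewrite divr_gt0// exprn_gt0.
have K40 : 0 < kap^-1 by rewrite invr_gt0.
near=> n.
have L1 : 1 <= ln (n%:R : R) by near: n; exact: near_ln_ge.
have L0 : 0 <= ln (n%:R : R) by exact: le_trans L1.
have n0 : (0 < n)%N by near: n; exact: nbhs_infty_gt.
have [M [M0 rM deg _ [meet _]]] : exists M : nat, disk_grid_bounds rho n M.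
  by near: n; exact: near_disk_grid.
exists M; split=> // u v uv.
(* In order, [F0] to [F5] give q >= 1, the validity of linearisation, few overlaps, enough vertices
   left for growth, a <= 1, and rho n <= n - 2. *)
have F0 : ln n%:R / rootn R h n <= rho * kap.
  by near: n; exact: near_ratio.
have F1 : ln n%:R / rootn R h n <= e / kap ^+ (h - 1).
  by near: n; exact: near_ratio.
have F2 : ln n%:R / rootn R h n <= e / (c2 * (3 / (rho * kap) + kap)).
  by near: n; apply: near_ratio (divr_gt0 e0 _).
have F3 : ln n%:R / rootn R h n <= e / (3 / (rho * kap) + 2 * kap).
  by near: n; apply: near_ratio (divr_gt0 e0 _).
have F4 : ln n%:R / rootn R h n <= kap^-1.
  by near: n; exact: near_ratio.
have F5 : 2 / (1 - rho) <= n%:R by near: n; exact: nbhs_infty_ger.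
have Lam1 : 1 <= rootln R h n by exact: rootln_ge1.
have LamL : rootln R h n ^+ (h - 1) <= ln n%:R by exact: (rootlnX_le hh L1 (leq_subr 1 h)).
have LamX : rootln R h n ^+ h = ln n%:R by exact: (rootlnX hh L0).
have N0 : 0 < rootn R h n by exact: rootn_gt0.
have N1 : 1 <= rootn R h n by rewrite -expR0 ler_expR divr_ge0.
have tE : threshold R h n ^+ 2 = rootln R h n / rootn R h n ^+ (h - 1).
  exact: (thresholdE hh L0 n0).
have nE : n%:R = rootn R h n ^+ h by rewrite (rootnX R hh n0).
have LamL1 : rootln R h n <= ln n%:R by rewrite -[leLHS]expr1 (rootlnX_le hh L1 (ltnW hh)).
move: F0 F1 F2 F3 F4 Lam1 LamL LamX LamL1 N0 N1 tE nE L1 L0.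
set Lg := ln n%:R; set N := rootn R h n; set Lam := rootln R h n.
move=> F0 F1 F2 F3 F4 Lam1 LamL LamX LamL1 N0 N1 tE nE L1 L0.
have Lam0 : 0 <= Lam by exact: le_trans Lam1.
pose a := kap * (Lam / N ^+ (h - 1)).
have aE : rho * g * threshold R h n ^+ 2 = a by rewrite tE.
have Nh0 : 0 < N ^+ (h - 1) by exact: exprn_gt0.
have a0 : 0 < a by rewrite mulr_gt0// divr_gt0// (lt_le_trans ltr01).
have naE : n%:R * a = kap * Lam * N.
  rewrite /a nE (_ : N ^+ h = N * N ^+ (h - 1)); last by rewrite -exprS h1E.
  by field; rewrite gt_eqF.
have LN0 : 0 <= Lg / N by rewrite divr_ge0// ltW.
have a_le : a <= kap * (Lg / N).
  rewrite ler_pM2l//; apply: ler_pM => //; first by rewrite invr_ge0 ltW.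
  by rewrite lef_pV2 ?posrE// -[leLHS]expr1 (ler_weXn2l N1 h1_gt0).
pose q := rho * n%:R * a.
have qE : q = rho * kap * (Lam * N) by rewrite /q -mulrA naE; ring.
have qX l : q ^+ l = rho ^+ l * kap ^+ l * (Lam ^+ l * N ^+ l).
  by rewrite qE exprMn [(rho * kap) ^+ l]exprMn [(Lam * N) ^+ l]exprMn.
have rk0 : 0 < rho * kap by exact: mulr_gt0.
have qN : rho * kap * N <= q by rewrite qE ler_pM2l// ler_peMl// ltW.
have q1 : 1 <= q.
  by apply: le_trans qN; rewrite ler_pdivrMr// in F0; exact: le_trans F0.
have q0 : 0 < q by lra.
have x1E : 3 * Lg / (a * q ^+ 1) * a <= 3 / (rho * kap) * (Lg / N).
  rewrite expr1 (_ : 3 * Lg / (a * q) * a = 3 * Lg / q); last first.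
    by field; rewrite !gt_eqF.
  rewrite (_ : 3 / _ * _ = 3 * Lg / (rho * kap * N)); last first.
    by field; rewrite !gt_eqF.
  rewrite ler_wpM2l ?mulr_ge0// lef_pV2 ?posrE//.
  exact: mulr_gt0.
have beta_le : 17 * (b ^+ 2 * threshold R h n ^+ 2) = c2 * a.
  by rewrite tE /c2 /a; field; rewrite !gt_eqF.
have := @pr_no_walk_le R ('I_M * 'I_M)%type 'I_n 'I_h (disk 20) a (c2 * a) rho e Lg a0.
rewrite card_ord -/q => K.
apply: le_trans (K _ _ _ _ _ _ (ltW e0) e1 rho0 rho_e L0 (h - 3)%N q1 _ _ _ u v (enum 'I_h) _ _ uv) _.
- apply: (le_trans a_le); rewrite mulrC -ler_pdivlMr// div1r//.
- by rewrite mulr_ge0// ltW.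
- by rewrite card_prod card_ord muln_gt0 M0.
- by move=> c c'; rewrite disk_sym.
- by move=> c; rewrite -aE.
- by move=> c; rewrite -beta_le.
- have -> : n%:R * a * (a * q ^+ (h - 3)) =
      rho ^+ (h - 3) * (kap ^+ (h - 1) * Lam ^+ (h - 1) / N).
    rewrite qX naE /a.
    rewrite h1E3.
    have Nk : N ^+ (h - 3) != 0 by rewrite expf_neq0// gt_eqF.
    have NN : N != 0 by rewrite gt_eqF.
    rewrite !exprS.
    move: (N ^+ _) Nk (rho ^+ _) (kap ^+ (h - 3)) (Lam ^+ (h - 3)).
    by move=> x1 x10 x2 x3 x4; field; rewrite NN x10.
  apply: le_trans (_ : kap ^+ (h - 1) * (Lg / N) <= _); last first.
    by rewrite [leLHS]mulrC -ler_pdivlMr ?exprn_gt0.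
  apply: (@le_trans _ _ (kap ^+ (h - 1) * Lam ^+ (h - 1) / N)).
    rewrite ler_piMl//; last by rewrite exprn_ile1// ltW.
    by rewrite divr_ge0 ?mulr_ge0 ?exprn_ge0// ltW.
  rewrite -mulrA; apply: ler_wpM2l; first by rewrite exprn_ge0// ltW.
  by apply: ler_wpM2r; first by rewrite invr_ge0 ltW.
- rewrite mulrCA [(_ + 1) * a]mulrDl mul1r.
  apply: (@le_trans _ _ (c2 * ((3 / (rho * kap) + kap) * (Lg / N)))).
    by rewrite ler_pM2l// [leRHS]mulrDl lerD.
  by rewrite mulrA [leLHS]mulrC -ler_pdivlMr.
- rewrite -(ler_pM2r a0) mulrDl -[leRHS]mulrA.
  apply: (@le_trans _ _ ((3 / (rho * kap) + 2 * kap) * (Lg / N))).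
    by rewrite [leRHS]mulrDl lerD// -mulrA ler_pM2l.
  rewrite mulrC -ler_pdivlMr//; apply: (le_trans F3).
  rewrite ler_pM2r ?invr_gt0// ler_peMr//; first exact: ltW.
  have : rho * (n%:R * a) <= n%:R * a.
    by apply: ler_piMl; [rewrite mulr_ge0// ltW | exact: ltW].
  by apply: le_trans; rewrite mulrA.
- exact: enum_uniq.
- by rewrite size_enum_ord; exact: h3E.
rewrite lerD//; last by rewrite ler_wpM2r ?expR_ge0// ler_nat.
rewrite ler_expR lerN2.
have n2 : rho * n%:R <= n%:R - 2.
  have : 2 <= n%:R * (1 - rho) by rewrite -ler_pdivrMr ?subr_gt0.
  by rewrite mulrBr mulr1 [n%:R * rho]mulrC lerBrDl lerBrDr addrC.
apply: (@le_trans _ _ (rho * n%:R * a * (a * q ^+ (h - 3).+1))); last first.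
  apply: ler_wpM2r; first by rewrite mulr_ge0 ?exprn_ge0// ltW.
  by apply: ler_wpM2r => //; exact: ltW.
(* The powers of rho are one from n - 2, h - 2 from [q], and h from the densities; all powers of N
   cancel. *)
have -> : rho * n%:R * a * (a * q ^+ (h - 3).+1) = rho ^+ (2 * h - 1) * g ^+ h * Lg.
  have Nk : N ^+ (h - 3) != 0 by rewrite expf_neq0// gt_eqF.
  have NN : N != 0 by rewrite gt_eqF.
  have LgE : Lg = Lam ^+ (h - 3).+3 by rewrite -h3E LamX.
  have gE : g ^+ h = g ^+ (h - 3).+3 by rewrite -h3E.
  rewrite LgE gE [rho * n%:R * a]qE qX /a h2E h1E3.
  rewrite !exprD !exprS expr0 [kap ^+ _]exprMn /kap.
  move: (N ^+ (h - 3)) Nk (rho ^+ (h - 3)) (g ^+ (h - 3)) (Lam ^+ (h - 3)) => x1 x10 x2 x3 x4.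
  by field; rewrite NN x10.
rewrite ler_wpM2r//.
apply: (@le_trans _ _ (3 / 4 * (28 / 10))); first lra.
by apply: ler_pM => //; lra.
Unshelve. all: by end_near. Qed.

End Connectivity.

Section TwoLayersConnectivity.
Variables (R : realType) (h : nat).
Hypothesis hh : (2 <= h)%N.
Variable b : R.
Hypothesis b0 : 0 < b.

Let g : R := 71 / 100 * b ^+ 2.

(** The three terms of [avg_damp_le] are n ^ -1.004, n ^ -1.002 and n ^ -1.251 up to logarithms.
    Each beats 1 / n by at least n ^ -0.002, and the square then beats the number of pairs. *)
Lemma near_walk_2 (i j : 'I_h) : h = 2%N -> i != j -> 504 / 1000 <= g ^+ 2 ->
  \forall n \near \oo, exists M : nat, [/\ (0 < M)%N,
    20 <= b * threshold R h n * M%:R &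
    forall u v : 'I_n, u != v ->
      pr R (fun f : config M h n =>
        all (fun ks => ~~ walk (disk 20) f ks u v) [:: [:: i; j]; [:: j; i]]) <=
      ((1 + 8 * b ^+ 2 + 16 * b ^+ 4) * (ln n%:R * expR (- (2 / 1000 * ln n%:R))) / n%:R) ^+ 2].
Proof.
move=> h2 ij gh; pose rho : R := 999 / 1000.
have rho01 : 0 < rho < 1 by rewrite /rho; lra.
have /andP[rho0 rho1] := rho01.
have lin1 (x : R) : 0 <= x -> x + 4 * - (251 / 1000 * x) <= - (2 / 1000 * x) by lra.
have lin2 (x : R) : 0 <= x ->
    x + - (x / 2) + 2 * - (251 / 1000 * x) <= - (2 / 1000 * x) by lra.
have lin3 (x : R) : 0 <= x -> - (251 / 1000 * x) <= - (2 / 1000 * x) by lra.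
(* The margin is thin: 0.504 / 2 = 0.252 must stay above 1 / 4 after the loss of rho ^ 3, hence rho
   = 0.999. *)
have rho3 : 251 / 1000 <= rho ^+ 3 / 2 * (504 / 1000) by rewrite /rho; lra.
have b20 : 0 < b ^+ 2 by exact: exprn_gt0.
have g0 : 0 < g by rewrite /g; lra.
near=> n.
have L1 : 1 <= ln (n%:R : R) by near: n; exact: near_ln_ge.
have L0 : 0 <= ln (n%:R : R) by exact: le_trans L1.
have n0 : (0 < n)%N by near: n; exact: nbhs_infty_gt.
have [M [M0 rM deg deg2 [_ corn]]] : exists M : nat, disk_grid_bounds h b rho n M.
  by near: n; exact: (near_disk_grid hh b0 rho01).
exists M; split=> // u v uv.
have n00 : 0 < n%:R :> R by rewrite ltr0n.
have n_ge : 2 <= (1 - rho) * n%:R.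
  by rewrite mulrC -ler_pdivrMr// ?subr_gt0//; near: n; exact: nbhs_infty_ger.
have t0 : 0 <= (n%:R - 2) / 2 :> R.
  rewrite divr_ge0// subr_ge0 (le_trans n_ge)// ler_piMl// lerBlDr lerDl.
  exact: ltW.
have tn' : rho * n%:R / 2 <= (n%:R - 2) / 2.
  rewrite ler_pM2r ?invr_gt0// lerBrDl -lerBrDr.
  by rewrite -[X in _ <= X - _]mul1r -mulrBl.
have LamL1 : rootln R h n <= ln n%:R by rewrite -[leLHS]expr1 (rootlnX_le hh L1 (ltnW hh)).
have Lam1 : 1 <= rootln R h n by exact: rootln_ge1.
have LamX : rootln R h n ^+ 2 = ln n%:R by rewrite -[2%N]h2 (rootlnX hh L0).
have tE : threshold R h n ^+ 2 = rootln R h n / rootn R h n.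
  by rewrite (thresholdE hh L0 n0) [X in _ ^+ (X - 1)]h2 expr1.
have nE : n%:R = rootn R h n ^+ 2 by rewrite -[2%N]h2 (rootnX R hh n0).
have NE : rootn R h n = expR (ln n%:R / 2) by rewrite /rootn h2.
have n_exp : n%:R = expR (ln n%:R) :> R by rewrite lnK// posrE ltr0n.
move: LamL1 Lam1 LamX tE nE NE L1 L0 n_exp.
set Lg := ln n%:R; set N := rootn R h n; set Lam := rootln R h n.
move=> LamL1 Lam1 LamX tE nE NE L1 L0 n_exp.
have N0 : 0 < N by rewrite NE expR_gt0.
have Lam0 : 0 <= Lam by exact: le_trans Lam1.
have C0 : (0 < #|{: 'I_M * 'I_M}|)%N by rewrite card_prod card_ord muln_gt0 M0.
have CR0 : 0 < #|{: 'I_M * 'I_M}|%:R :> R by rewrite ltr0n.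
pose t : R := (n%:R - 2) / 2.
have tn : 2 * t + 2 <= #|'I_n|%:R.
  by rewrite card_ord /t mulrC divfK// subrK.
pose a := rho * g * threshold R h n ^+ 2.
have a0 : 0 <= a by rewrite /a mulr_ge0 ?sqr_ge0// mulr_ge0 ?ltW.
pose k := 4 * (b ^+ 2 * threshold R h n ^+ 2).
have k0 : 0 <= k.
  exact: mulr_ge0 (ler0n _ 4) (mulr_ge0 (ltW b20) (sqr_ge0 _)).
apply: (@le_trans _ _ (pr R (fun f : config M h n =>
    ~~ walk (disk 20) f [:: i; j] u v && ~~ walk (disk 20) f [:: j; i] u v))).
  by apply: ler_pr => f /=; rewrite andbT.
have symD (c c' : 'I_M * 'I_M) : (c' \in disk 20 c) = (c \in disk 20 c').
  by rewrite disk_sym.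
apply: (le_trans (no_walk_two_layers C0 symD ij uv t0 tn)).
have avg0 : 0 <= avg (fun c : 'I_M * 'I_M => avg (fun c' : 'I_M * 'I_M => expR (- (t *
    (#|disk 20 c|%:R / #|{: 'I_M * 'I_M}|%:R * (#|disk 20 c'|%:R / #|{: 'I_M * 'I_M}|%:R)))))).
  by apply: avg_ge0 => c; apply: avg_ge0 => c'; exact: expR_ge0.
apply: lerXn2r.
- by rewrite nnegrE; exact: avg0.
- rewrite nnegrE; apply: divr_ge0; last exact: ler0n.
  apply: mulr_ge0; last by rewrite mulr_ge0 ?expR_ge0.
  have b4 : 0 <= b ^+ 4 by rewrite exprn_ge0// ltW.
  have : 0 <= 8 * b ^+ 2 by rewrite mulr_ge0// ltW.
  have : 0 <= 16 * b ^+ 4 by rewrite mulr_ge0.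
  by move=> h16 h8; apply: addr_ge0 => //; apply: addr_ge0.
have := @avg_damp_le R _ (@disk M 20) C0 t a k [set c | corner 20 c]%SET t0 a0 corn.
move=> /(_ _ _) D; apply: (le_trans (D _ _)).
- by move=> c; rewrite ler_pdivlMr//; exact: deg.
- by move=> c; rewrite inE; exact: deg2.
set e := expR _.
have e_le : e <= expR (- (251 / 1000 * Lg)).
  rewrite ler_expR lerN2 /a tE.
  have -> : (rho * g * (Lam / N)) ^+ 2 = rho ^+ 2 * g ^+ 2 * Lg / n%:R.
    by rewrite nE -LamX; field; rewrite gt_eqF.
  apply: (@le_trans _ _ (rho * n%:R / 2 * (rho ^+ 2 * g ^+ 2 * Lg / n%:R))); last first.
    apply: ler_wpM2r; last exact: tn'.
    apply: divr_ge0; last exact: ltW.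
    exact: mulr_ge0 (mulr_ge0 (sqr_ge0 _) (sqr_ge0 _)) L0.
  rewrite (_ : rho * _ / 2 * _ = rho ^+ 3 / 2 * g ^+ 2 * Lg); last first.
    by field; rewrite gt_eqF.
  apply: ler_wpM2r; first exact: L0.
  apply: le_trans rho3 _; apply: ler_wpM2l; last exact: gh.
  by apply: divr_ge0; [rewrite exprn_ge0// ltW|].
have e0 : 0 <= e by exact: expR_ge0.
rewrite ler_pdivlMr// mulrC n_exp.
have kE : k = 4 * b ^+ 2 * Lam * expR (- (Lg / 2)).
  by rewrite /k tE NE expRN; ring.
have kE2 : k ^+ 2 = 16 * b ^+ 4 * Lg * expR (- Lg).
  have eh : expR (- (Lg / 2)) ^+ 2 = expR (- Lg).
    by rewrite -expRM_natl; congr expR; field.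
  rewrite -eh (_ : _ * Lg * _ = 16 * b ^+ 4 * Lam ^+ 2 * expR (- (Lg / 2)) ^+ 2).
    by rewrite kE; ring.
  by rewrite LamX.
set E := expR (- (251 / 1000 * Lg)) in e_le.
set F := expR (- (2 / 1000 * Lg)).
have F0 : 0 <= F by exact: expR_ge0.
have EX m : E ^+ m = expR (m%:R * - (251 / 1000 * Lg)) by rewrite /E -expRM_natl.
rewrite 2!mulrDr.
have T1 : expR Lg * e ^+ 4 <= Lg * F.
  apply: (@le_trans _ _ (expR Lg * E ^+ 4)).
    by rewrite ler_wpM2l ?expR_ge0// lerXn2r ?nnegrE ?expR_ge0.
  rewrite EX -expRD; apply: (@le_trans _ _ F); last by rewrite ler_peMl.
  by rewrite ler_expR; exact: lin1.
have T2 : expR Lg * (2 * k * e ^+ 2) <= 8 * b ^+ 2 * (Lg * F).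
  apply: (@le_trans _ _ (expR Lg * (2 * k * E ^+ 2))).
    apply: ler_wpM2l; first exact: expR_ge0.
    apply: ler_wpM2l; first exact: mulr_ge0.
    by apply: lerXn2r; rewrite ?nnegrE ?expR_ge0.
  rewrite EX kE.
  rewrite (_ : _ * _ = 8 * b ^+ 2 * (Lam *
    (expR Lg * expR (- (Lg / 2)) * expR (2%:R * - (251 / 1000 * Lg))))); last by ring.
  rewrite -!expRD; apply: ler_wpM2l; first by rewrite mulr_ge0// ltW.
  apply: ler_pM; [exact: Lam0|exact: expR_ge0|exact: LamL1|].
  by rewrite ler_expR; exact: lin2.
have T3 : expR Lg * (k ^+ 2 * e) <= 16 * b ^+ 4 * (Lg * F).
  rewrite kE2 (_ : _ * _ = 16 * b ^+ 4 * (Lg * (expR Lg * expR (- Lg) * e))); last by ring.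
  rewrite -expRD subrr expR0 mul1r; apply: ler_wpM2l.
    by rewrite mulr_ge0// exprn_ge0// ltW.
  apply: ler_wpM2l; first exact: L0.
  by apply: (le_trans e_le); rewrite ler_expR; exact: lin3.
rewrite [leRHS]mulrDl [(1 + _) * _]mulrDl mul1r; exact: lerD (lerD T1 T2) T3.
Unshelve. all: by end_near. Qed.

End TwoLayersConnectivity.

Lemma near_expRN (R : realType) (a e : R) : 0 < a -> 0 < e ->
  \forall n \near \oo, expR (- (a * ln n%:R)) <= e.
Proof.
move=> a0 e0; near=> n; rewrite -[leRHS]lnK ?posrE// ler_expR lerNl -ler_pdivrMl//.
by near: n; exact: near_ln_ge.
Unshelve. all: by end_near. Qed.

Lemma near_ln_expRN (R : realType) (a e : R) : 0 < a -> 0 < e ->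
  \forall n \near \oo, ln n%:R * expR (- (a * ln n%:R)) <= e.
Proof.
move=> a0 e0; have e0' : 0 <= e^-1 by rewrite invr_ge0 ltW.
near=> n; rewrite expRN ler_pdivrMr ?expR_gt0// -ler_pdivrMl//.
by apply: le_expR_lin => //; near: n; exact: near_ln_ge.
Unshelve. all: by end_near. Qed.

Section RainbowConnected.
Variables (R : realType) (h : nat).
Hypothesis hh : (2 <= h)%N.
Variable b : R.
Hypothesis hb : (2 ^+ (2 + 3 * (h - 1)) / pi ^+ 3) `^ (1 / (2 * h%:R)) < b.

Let b0 : 0 < b.
Proof. by apply: le_lt_trans hb; exact: powR_ge0. Qed.

(** Raised to the power 2h, the hypothesis gives b ^ (2h) >= 2 ^ (3h - 1) / pi ^ 3 >= 8 ^ h / 64, as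
    pi ^ 3 <= 32; and 71 / 100 * 8 = 568 / 100. *)
Let gh_ge : (568 / 100) ^+ h / 64 <= (71 / 100 * b ^+ 2) ^+ h.
Proof.
have pi30 : 0 < (pi : R) ^+ 3 by rewrite exprn_gt0// pi_gt0.
pose x : R := 2 ^+ (2 + 3 * (h - 1)) / pi ^+ 3.
have hx : x `^ (1 / (2 * h%:R)) < b by exact: hb.
have x0 : 0 <= x by apply: divr_ge0; [exact: exprn_ge0|exact: ltW].
have xb : x <= (b ^+ 2) ^+ h.
  rewrite -exprM -[x](@powRr1 R)//.
  have h2 : 2 * h%:R != 0 :> R by rewrite mulf_neq0// pnatr_eq0; lia.
  have -> : (1 : R) = 1 / (2 * h%:R) * (2 * h)%:R by rewrite natrM mul1r mulVf.
  rewrite powRrM powR_mulrn ?powR_ge0// lerXn2r ?nnegrE ?powR_ge0//; exact: ltW.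
rewrite [leRHS]exprMn; apply: le_trans (_ : (71 / 100) ^+ h * x <= _); last first.
  by apply: ler_wpM2l => //; rewrite exprn_ge0// divr_ge0.
rewrite (_ : 568 / 100 = 71 / 100 * 8); last by field.
rewrite exprMn -mulrA; apply: ler_wpM2l; first by rewrite exprn_ge0// divr_ge0.
rewrite /x (_ : (2 + 3 * (h - 1) = 3 * h - 1)%N); last by lia.
apply: (@le_trans _ _ (2 ^+ (3 * h - 1) / 32)); last first.
  by apply: ler_wpM2l; [rewrite exprn_ge0|rewrite lef_pV2 ?posrE// pi_cube_le32].
rewrite (_ : 8 = 2 ^+ 3); last by ring.
have e3 : (3 * h = (3 * h - 1).+1)%N by lia.
by rewrite -exprM [X in 2 ^+ X / 64]e3 exprSr; lra.
Qed.

Lemma rainbow_connected_whp (r : nat -> R) (d : nat -> measure_display)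
  (Omega : forall n, measurableType (d n)) (P : forall n, probability (Omega n) R)
  (pos : forall n, 'I_h -> 'I_n -> Omega n -> R * R) :
  (forall n, iid_uniform_positions (P n) (pos n)) ->
  (forall n : nat, b * threshold R h n <= r n) ->
  (P n (rainbow_event (pos n) (r n)))%E @[n --> \oo] --> 1%E.
Proof.
move=> Hpos rb.
suff [p pE p0] : exists2 p : nat -> R,
    (\forall n \near \oo, ((1 - n%:R ^+ 2 * p n)%:E <=
      P n (rainbow_event (pos n) (b * threshold R h n)))%E) &
    (forall e, 0 < e -> \forall n \near \oo, n%:R ^+ 2 * p n <= e).
  have mE n s : measurable (rainbow_event (pos n) s).
    by apply: measurable_rainbow_event; case: (Hpos n).
  apply: (@probability_cvg1 _ _ _ _ _ (fun n => n%:R ^+ 2 * p n)) p0 => [n|].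
    exact: mE.
  apply: filterS pE => n /le_trans; apply; apply: le_measure; rewrite ?inE//.
  exact: rainbow_event_mono.
have [h3|h_lt3] := leqP 3 h.
- exists (fun n => expR (- (21 / 10 * ln n%:R)) + h%:R * expR (- (3 * ln n%:R))).
    have gh : 28 / 10 <= (71 / 100 * b ^+ 2) ^+ h.
      apply: le_trans gh_ge; rewrite -(subnK h3) exprD.
      have : 1 <= (568 / 100 : R) ^+ (h - 3) by apply: exprn_ege1; lra.
      set y := _ ^+ (h - 3) => y1.
      rewrite -mulrA; apply: (@le_trans _ _ ((568 / 100) ^+ 3 / 64)); first by lra.
      have z0 : 0 <= (568 / 100) ^+ 3 / 64 :> R by lra.
      exact: ler_peMl z0 y1.
    apply: filterS (near_walk_ge3 hh b0 h3 gh) => n [M [M0 rM wM]].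
    apply: (@rainbow_event_ge _ _ _ _ _ _ _ _ _ _ [:: enum 'I_h] (Hpos n) M0 rM).
    + by rewrite /= enum_uniq.
    + by rewrite addr_ge0 ?mulr_ge0 ?expR_ge0.
    + move=> u v uv; apply: le_trans (wM u v uv); apply: ler_pr => f.
      by rewrite /= andbT.
  have hR : 0 < h%:R :> R by rewrite ltr0n ltnW.
  move=> e e0; near=> n.
  have n0 : 0 < n%:R :> R by rewrite ltr0n; near: n; exact: nbhs_infty_gt.
  have nE : n%:R ^+ 2 = expR (2 * ln n%:R) :> R by rewrite expRM_natl lnK// posrE.
  rewrite mulrDr nE mulrCA -!expRD.
  have -> : 2 * ln n%:R + - (21 / 10 * ln n%:R) = - (1 / 10 * ln n%:R) :> R by field.
  have -> : 2 * ln n%:R + - (3 * ln n%:R) = - (1 * ln n%:R) :> R by ring.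
  rewrite [leRHS]splitr; apply: lerD.
    by near: n; apply: near_expRN; [rewrite divr_gt0|rewrite divr_gt0].
  rewrite -ler_pdivlMl//; near: n; apply: near_expRN => //.
  by rewrite mulr_gt0 ?invr_gt0// divr_gt0.
- have h2 : h = 2%N by apply/eqP; rewrite eqn_leq hh andbT -ltnS.
  pose B := 1 + 8 * b ^+ 2 + 16 * b ^+ 4.
  have B0 : 0 < B.
    rewrite ltr_pwDl//; last by rewrite mulr_ge0// exprn_ge0// ltW.
    by rewrite ltr_pwDl// mulr_ge0// exprn_ge0// ltW.
  exists (fun n => (B * (ln n%:R * expR (- (2 / 1000 * ln n%:R))) / n%:R) ^+ 2).
    have gh : 504 / 1000 <= (71 / 100 * b ^+ 2) ^+ h.
      by apply: le_trans gh_ge; rewrite h2; lra.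
    rewrite [X in _ ^+ X]h2 in gh.
    have h1 : (1 < h)%N by [].
    pose i := Ordinal (ltnW hh); pose j := Ordinal h1.
    have ij : i != j by [].
    apply: filterS (near_walk_2 hh b0 h2 ij gh) => n [M [M0 rM wM]].
    apply: (@rainbow_event_ge _ _ _ _ _ _ _ _ _ _ _ (Hpos n) M0 rM _ _ wM).
      by [].
    exact: sqr_ge0.
  move=> e e0; near=> n.
  have n0 : 0 < n%:R :> R by rewrite ltr0n; near: n; exact: nbhs_infty_gt.
  have L0 : 0 <= ln n%:R :> R by near: n; exact: near_ln_ge.
  rewrite -exprMn mulrC divfK ?gt_eqF//.
  (* The error is F ^ 2, which is at most F once F <= 1. *)
  have m0 : 0 < Num.min 1 e by rewrite lt_min ltr01.
  have Fm : B * (ln n%:R * expR (- (2 / 1000 * ln n%:R))) <= Num.min 1 e.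
    rewrite -ler_pdivlMl//; near: n; apply: near_ln_expRN.
      by apply: divr_gt0; rewrite ltr0n.
    by rewrite mulr_gt0 ?invr_gt0// lt_min ltr01.
  set F := B * _ in Fm *.
  have F0 : 0 <= F by rewrite mulr_ge0 ?mulr_ge0 ?expR_ge0// ltW.
  have /andP[F1 Fe] : (F <= 1) && (F <= e) by rewrite -le_min.
  by rewrite expr2 (le_trans _ Fe)// ler_piMl.
Unshelve. all: by end_near. Qed.

End RainbowConnected.

(** * Disconnectivity below the threshold *)

Lemma near_expR_ge (R : realType) (a K : R) : 0 < a -> 0 <= K ->
  \forall n \near \oo, K * ln n%:R <= expR (a * ln n%:R).
Proof.
by move=> a0 K0; near=> n; apply: le_expR_lin => //; near: n; exact: near_ln_ge.
Unshelve. all: by end_near. Qed.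

Lemma sum_expn_le (x k : nat) : (2 <= x)%N -> (0 < k)%N ->
  (\sum_(j < k) x ^ j <= 2 * x ^ (k - 1))%N.
Proof.
move=> x2; case: k => // k _; rewrite subn1 /=.
elim: k => [|k IH]; first by rewrite big_ord1.
rewrite big_ord_recr /=; apply: (@leq_trans (2 * x ^ k + x ^ k.+1)); first exact: leq_add.
by rewrite [leqRHS]mul2n -addnn leq_add2r [leqRHS]expnS leq_mul2r x2 orbT.
Qed.

Lemma expRN2_le (R : realType) (x : R) : 0 <= x -> x <= 1 / 2 -> expR (- (2 * x)) <= 1 - x.
Proof.
move=> x0 x2; rewrite expRN -[leLHS]mul1r ler_pdivrMr ?expR_gt0//.
have := expR_ge1Dx (2 * x); set E := expR _ => HE.
apply: (@le_trans _ _ ((1 - x) * (1 + 2 * x))); last by rewrite ler_wpM2l//; lra.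
rewrite -subr_ge0 (_ : _ - _ = x * (1 - 2 * x)); last by ring.
by rewrite mulr_ge0//; lra.
Qed.

Lemma expN2_le (R : realType) (D : nat) (x : R) : 2 * x <= D%:R -> 2 ^- D <= expR (- x).
Proof.
move=> xD; apply: (@le_trans _ _ (expR (- (1 / 2)) ^+ D)).
  rewrite -exprVn lerXn2r ?nnegrE ?expR_ge0 ?invr_ge0//.
  by have := expR_ge1Dx (- (1 / 2) : R); lra.
by rewrite -expRM_natl ler_expR; lra.
Qed.

Lemma unit_grid (R : realType) (r : R) : 0 < r -> r <= 1 / 4 -> exists M : nat,
  [/\ (0 < M)%N, r * M%:R <= 1, 1 / 2 <= r ^+ 2 * #|{: 'I_M * 'I_M}|%:R &
      r ^+ 2 * #|{: 'I_M * 'I_M}|%:R <= 1].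
Proof.
move=> r0 r4; pose M := Num.truncn r^-1; exists M.
have M1 : r^-1 < M%:R + 1 by rewrite natr1 /M; exact: truncnS_gt.
have M2 : M%:R <= r^-1 by rewrite /M truncn_le invr_ge0 ltW.
have rM : r * M%:R <= 1 by rewrite -ler_pdivlMl// mulr1.
have rM1 : 1 < r * M%:R + r by rewrite -[X in _ + X]mulr1 -mulrDr -ltr_pdivrMl// mulr1.
have cE : r ^+ 2 * #|{: 'I_M * 'I_M}|%:R = (r * M%:R) ^+ 2.
  by rewrite card_prod card_ord natrM exprMn expr2.
split => //; last by rewrite cE exprn_ile1// mulr_ge0// ltW.
- rewrite lt0n; apply/eqP => M00; move: rM1; rewrite M00 mulr0 add0r; lra.
- have h : 3 / 4 <= r * M%:R by lra.
  rewrite cE; apply: (@le_trans _ _ ((3 / 4) ^+ 2)); first by lra.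
  by rewrite lerXn2r ?nnegrE//; lra.
Qed.

(** An upper bound for the square of the constant of the theorem, with pi ^ 2 replaced by 8: 4 / (9
    * 8) = 1 / 18 and 1 / (4 * 8) = 1 / 32. *)
Definition subcritical (R : realType) (h : nat) : R := 18^-1 * 32^-1 ^+ (h - 1).

(** The factor multiplying h ^ 2 is the coefficient of log n in the exponent of the uncovered
    proportion [mu]; the bound makes mu ^ h at least n ^ -(1/(8h)). The powers of 32 absorb those of
    h through h <= 2 ^ (h - 1). *)
Lemma subcritical_exponent (R : realType) (h : nat) : (2 <= h)%N ->
  h%:R ^+ 2 * (36 * (28 * h%:R) ^+ (h - 1) * (2 * subcritical R h) ^+ h) <= 1 / 8.
Proof.
move=> hh; have [a ->] : exists a, h = a.+2 by exists (h - 2)%N; lia.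
rewrite /subcritical subSS subn0.
have h2 : a.+2%:R <= (2 : R) ^+ a.+1.
  by rewrite -natrX ler_nat; elim: a {hh} => // a IH; rewrite expnS; lia.
set k : R := a.+2%:R in h2 *.
have k0 : 0 <= k by exact: ler0n.
have p2 : 0 < (2 : R) ^+ a.+1 by rewrite exprn_gt0.
have -> : (2 * (18^-1 * 32^-1 ^+ a.+1)) ^+ a.+2 =
    9^-1 ^+ a.+2 * (32^-1 ^+ a.+2) ^+ a.+1 :> R.
  by rewrite mulrA exprMn -!exprM mulnC; congr (_ ^+ _ * _); field.
rewrite [leLHS](_ : _ = 36 * 9^-1 ^+ a.+2 * (k ^+ 2 * (28 * k * 32^-1 ^+ a.+2) ^+ a.+1)); last first.
  rewrite [(28 * k * _) ^+ _]exprMn.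
  move: (9^-1 ^+ a.+2) ((32^-1 ^+ a.+2) ^+ a.+1) ((28 * k) ^+ a.+1) => x1 x2 x3; ring.
have d1 : 28 * k * 32^-1 ^+ a.+2 <= 16^-1 ^+ a.+1 :> R.
  apply: (@le_trans _ _ (28 * 2 ^+ a.+1 * 32^-1 ^+ a.+2)).
    by rewrite ler_wpM2r ?exprn_ge0// ler_wpM2l.
  rewrite [32^-1 ^+ a.+2]exprS (_ : 32^-1 ^+ a.+1 = 2^-1 ^+ a.+1 * 16^-1 ^+ a.+1 :> R); last first.
    by rewrite -exprMn; congr (_ ^+ _); field.
  rewrite [leLHS](_ : _ = 28 / 32 * ((2 * 2^-1) ^+ a.+1 * 16^-1 ^+ a.+1)); last first.
    by rewrite exprMn; move: (2 ^+ _) (2^-1 ^+ _) (16^-1 ^+ _) => x1 x2 x3; field.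
  rewrite divff// expr1n mul1r ler_piMl ?exprn_ge0//; lra.
have d0 : 0 <= 28 * k * 32^-1 ^+ a.+2.
  by apply: mulr_ge0; [exact: mulr_ge0|rewrite exprn_ge0// invr_ge0].
have d2 : (28 * k * 32^-1 ^+ a.+2) ^+ a.+1 <= 16^-1 ^+ a.+1 :> R.
  have d3 : 28 * k * 32^-1 ^+ a.+2 <= 1.
    by apply: (le_trans d1); rewrite exprn_ile1//; lra.
  by rewrite exprS; apply: le_trans d1; rewrite ler_piMr// exprn_ile1.
have d4 : k ^+ 2 * (28 * k * 32^-1 ^+ a.+2) ^+ a.+1 <= 1 / 4.
  apply: (@le_trans _ _ ((2 ^+ a.+1) ^+ 2 * 16^-1 ^+ a.+1)).
    apply: ler_pM => //; first by rewrite exprn_ge0.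
      exact: exprn_ge0.
    by rewrite lerXn2r ?nnegrE// ltW.
  rewrite exprAC -exprMn (_ : 2 ^+ 2 * 16^-1 = 4^-1 :> R); last by field.
  by rewrite exprS div1r ler_piMr// exprn_ile1//; lra.
have d5 : 36 * 9^-1 ^+ a.+2 <= 4 / 9 :> R.
  rewrite !exprS mulrA mulrA (_ : 36 / 9 / 9 = 4 / 9); last by field.
  by rewrite ler_piMr// exprn_ile1//; lra.
apply: (@le_trans _ _ (4 / 9 * (1 / 4))); last by lra.
apply: ler_pM => //; first by rewrite mulr_ge0// exprn_ge0.
Qed.

Section Subcritical.
Variables (R : realType) (h : nat).
Hypothesis hh : (2 <= h)%N.

Let kap : R := subcritical R h.

Let kap0 : 0 < kap.
Proof. by rewrite mulr_gt0 ?exprn_gt0 ?invr_gt0. Qed.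

Let h0 : 0 < h%:R :> R.
Proof. by rewrite ltr0n ltnW. Qed.

Let kap1 : kap <= 1.
Proof.
apply: mulr_ile1; rewrite ?exprn_ge0 ?invr_ge0 ?exprn_ile1//; lra.
Qed.

(* [Q ^+ 8] is [n ^ (1/h)]; the reserved set has about [Q ^+ 2] vertices. *)
Let Q (n : nat) : R := expR ((8 * h%:R)^-1 * ln n%:R).

Let QX n : Q n ^+ 8 = rootn R h n.
Proof.
by rewrite /Q -expRM_natl /rootn; congr expR; field; rewrite gt_eqF.
Qed.

Let h1E : (h - 1).+1 = h. Proof. by rewrite subn1 prednK// ltnW. Qed.
Let h2E : (h - 2).+1 = (h - 1)%N. Proof. by move: hh => h2; lia. Qed.

Section Bounds.
Variable n : nat.
Let Lg : R := ln n%:R.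
Let N := rootn R h n.
Let Lam := rootln R h n.
Let t := kap * (Lam / N ^+ (h - 1)).
Variables (m : R) (D s l : nat).
Hypotheses (n0 : (0 < n)%N) (L1 : 1 <= Lg) (Q2 : 2 <= Q n).
Hypothesis N_ge : 2 / kap * Lg <= N.
Hypotheses (m0 : 0 < m) (tm_ge : 1 / 2 <= t * m) (tm_le : t * m <= 1) (m18 : 18 <= m).
Hypotheses (D_ge : 27 * (n%:R / m) <= D%:R) (D_le : D%:R <= 28 * (n%:R / m)).
Hypothesis s_le : s%:R <= 2 * (h%:R * D%:R) ^+ (h - 1) :> R.
Hypotheses (l_ge : Q n ^+ 2 <= l%:R) (l_le : l%:R <= 2 * Q n ^+ 2).

Let L0 : 0 <= Lg. Proof. exact: le_trans L1. Qed.
Let N0 : 0 < N. Proof. exact: rootn_gt0. Qed.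
Let Lam1 : 1 <= Lam. Proof. exact: rootln_ge1. Qed.
Let Lam0 : 0 < Lam. Proof. exact: lt_le_trans Lam1. Qed.
Let Q0 : 0 < Q n. Proof. exact: expR_gt0. Qed.
Let Q1 : 1 <= Q n. Proof. by apply: le_trans Q2; rewrite ler1n. Qed.
Let n00 : 0 < n%:R :> R. Proof. by rewrite ltr0n. Qed.

Let t0 : 0 < t.
Proof. by rewrite mulr_gt0 ?divr_gt0 ?exprn_gt0. Qed.

Let nE : n%:R = N ^+ h.
Proof. by rewrite /N (rootnX R hh n0). Qed.

Let ntE : n%:R * t = kap * Lam * N.
Proof.
rewrite nE /t -h1E exprS subSS subn0; field.
by rewrite expf_neq0// gt_eqF.
Qed.

Let inv_m_le : m^-1 <= 2 * t.
Proof.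
rewrite -[leLHS]mul1r ler_pdivrMr// -[2 * t * m]mulrA.
by move: (t * m) tm_ge => y; lra.
Qed.

Let nm_ge : kap * Lam * N <= n%:R / m.
Proof.
by rewrite -ntE ler_pM2l// -[leRHS]mul1r ler_pdivlMr.
Qed.

Let nm_le : n%:R / m <= 2 * (kap * Lam * N).
Proof.
by rewrite -ntE mulrCA ler_pM2l.
Qed.

Lemma cell_load_ge : 2 * Lg <= n%:R / m.
Proof.
apply: le_trans nm_ge.
have : kap * (2 / kap * Lg) <= kap * N by rewrite ler_pM2l.
rewrite (_ : kap * (_ * _) = 2 * Lg); last by field; rewrite gt_eqF.
move=> H; apply: (le_trans H); rewrite -mulrA ler_pM2l//.
by apply: ler_peMl => //; exact: ltW.
Qed.

Let t_le : t <= Lg / N.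
Proof.
apply: (@le_trans _ _ (Lam / N ^+ (h - 1))).
  by apply: ler_piMl => //; rewrite ltW// divr_gt0// exprn_gt0.
have N1 : 1 <= N by rewrite /N -QX exprn_ege1.
apply: ler_pM; first exact: ltW.
- by rewrite invr_ge0 exprn_ge0// ltW.
- by rewrite -[leLHS]expr1 (rootlnX_le hh L1 (ltnW hh)).
- rewrite lef_pV2 ?posrE ?exprn_gt0//.
  rewrite -h2E exprS; apply: ler_peMr; first exact: ltW.
  exact: exprn_ege1.
Qed.

(** |W| ^ 2 is of order Q ^ 4, and a chain of h - 1 colours costs log n / N with N = Q ^ 8. *)
Lemma linked_term : l%:R ^+ 2 * (h%:R ^+ h * (9 / m * (n%:R * (9 / m)) ^+ (h - 2))) <=
  4 * h%:R ^+ h * 18 ^+ (h - 1) * Lg / Q n.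
Proof.
have e1 : 9 / m * (n%:R * (9 / m)) ^+ (h - 2) <= 18 ^+ (h - 1) * (Lg / N).
  have -> : 9 / m * (n%:R * (9 / m)) ^+ (h - 2) = 9 ^+ (h - 1) * (m^-1 * (n%:R / m) ^+ (h - 2)).
    rewrite -h2E exprS (_ : n%:R * (9 / m) = 9 * (n%:R / m)); last by ring.
    by rewrite exprMn; ring.
  have e2 : m^-1 * (n%:R / m) ^+ (h - 2) <= (2 * t) * (2 * (n%:R * t)) ^+ (h - 2).
    apply: ler_pM => //.
    - by rewrite invr_ge0 ltW.
    - by rewrite exprn_ge0// divr_ge0// ltW.
    - apply: lerXn2r; last by rewrite ntE.
        by rewrite nnegrE divr_ge0// ltW.
      by rewrite nnegrE ltW// mulr_gt0// mulr_gt0.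
  have e3 : (2 * t) * (2 * (n%:R * t)) ^+ (h - 2) <= 2 ^+ (h - 1) * (Lg / N).
    have -> : (2 * t) * (2 * (n%:R * t)) ^+ (h - 2) =
        2 ^+ (h - 1) * (kap ^+ (h - 1) * (Lam ^+ (h - 1) / N)).
      rewrite ntE /t -h2E !exprS exprMn [(kap * Lam * N) ^+ _]exprMn [(kap * Lam) ^+ _]exprMn.
      have Nk : N ^+ (h - 2) != 0 by rewrite expf_neq0// gt_eqF.
      have NN : N != 0 by rewrite gt_eqF.
      move: (N ^+ (h - 2)) Nk (2 ^+ (h - 2)) (kap ^+ (h - 2)) (Lam ^+ (h - 2)).
      by move=> x1 x10 x2 x3 x4; field; rewrite NN x10.
    rewrite ler_pM2l ?exprn_gt0//.
    apply: (@le_trans _ _ (Lam ^+ (h - 1) / N)).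
      apply: ler_piMl; last by rewrite exprn_ile1// ltW.
      by rewrite divr_ge0// ?exprn_ge0// ltW.
    by rewrite ler_pM2r ?invr_gt0// (rootlnX_le hh L1 (leq_subr 1 h)).
  apply: (@le_trans _ _ (9 ^+ (h - 1) * (2 ^+ (h - 1) * (Lg / N)))).
    by rewrite ler_pM2l ?exprn_gt0//; exact: le_trans e3.
  by rewrite mulrA -exprMn (_ : 9 * 2 = 18)//; ring.
have l2 : l%:R ^+ 2 <= 4 * Q n ^+ 4 :> R.
  have -> : 4 * Q n ^+ 4 = (2 * Q n ^+ 2) ^+ 2 by ring.
  apply: lerXn2r; [by rewrite nnegrE|by rewrite nnegrE mulr_ge0// exprn_ge0// ltW|exact: l_le].
apply: (@le_trans _ _ (4 * Q n ^+ 4 * (h%:R ^+ h * (18 ^+ (h - 1) * (Lg / N))))).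
  apply: ler_pM.
  - by rewrite exprn_ge0.
  - have m9 : 0 <= 9 / m by rewrite divr_ge0// ltW.
    by apply: mulr_ge0; [rewrite exprn_ge0|rewrite mulr_ge0// exprn_ge0// mulr_ge0].
  - exact: l2.
  - by apply: ler_wpM2l; first by rewrite exprn_ge0.
have -> : N = Q n ^+ 8 by rewrite QX.
have -> : 4 * Q n ^+ 4 * (h%:R ^+ h * (18 ^+ (h - 1) * (Lg / Q n ^+ 8))) =
    4 * h%:R ^+ h * 18 ^+ (h - 1) * Lg * (Q n ^+ 4)^-1.
  move: (h%:R ^+ h) (18 ^+ (h - 1)) => x1 x2; field; by rewrite gt_eqF.
apply: ler_wpM2l; first by rewrite !mulr_ge0 ?exprn_ge0.
by rewrite lef_pV2 ?posrE ?exprn_gt0// -[leLHS]expr1 ler_weXn2l.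
Qed.

(** D is about three times the bound 9 n / m on the mean load of a block; as 2 ^ -D <= exp (- D /
    2), the exponents 27 / 2 and 9 leave a margin of 9 / 2 times n / m, itself at least 2 log n. *)
Lemma degree_term : h%:R * m * (2 ^- D * expR (n%:R * (9 / m))) <= h%:R * expR (- (1 * Lg)).
Proof.
rewrite -mulrA ler_pM2l//.
have mn : m <= n%:R.
  rewrite -[leLHS]mul1r -ler_pdivlMr//; apply: le_trans cell_load_ge; move: L1; lra.
have nexp : n%:R = expR Lg :> R by rewrite lnK// posrE.
apply: (@le_trans _ _ (n%:R * (expR (- (27 / 2 * (n%:R / m))) * expR (9 * (n%:R / m))))).
  apply: ler_pM; [exact: ltW| |exact: mn|].
    by apply: mulr_ge0; [rewrite invr_ge0 exprn_ge0|exact: expR_ge0].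
  rewrite [n%:R * (9 / m)]mulrCA ler_pM2r ?expR_gt0//.
  by apply: expN2_le; apply: le_trans D_ge; lra.
rewrite nexp -!expRD ler_expR -nexp; move: cell_load_ge L0; move: (n%:R / m) Lg => x y; lra.
Qed.

Variable mu : R.
Hypothesis muE : mu = (1 - 9 / m) ^+ s.

(** Each explored vertex covers a proportion 9 / m at most, and at most [s] vertices are explored,
    about (28 h n / m) ^ (h - 1); substituting the radius leaves a multiple of log n. *)
Let mu_ge : expR (- (Lg / (8 * h%:R ^+ 2))) <= mu.
Proof.
have m9 : 9 / m <= 1 / 2.
  by rewrite ler_pdivrMr//; have := m18; lra.
have m90 : 0 <= 9 / m by rewrite divr_ge0// ltW.
rewrite muE; apply: (@le_trans _ _ (expR (- (2 * (9 / m))) ^+ s)); last first.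
  rewrite lerXn2r ?nnegrE ?expR_ge0//; first by lra.
  exact: expRN2_le.
rewrite -expRM_natl ler_expR mulrN lerN2.
have nm0 : 0 <= n%:R / m by rewrite divr_ge0// ltW.
apply: (@le_trans _ _ (2 * (h%:R * (28 * (n%:R / m))) ^+ (h - 1) * (2 * (9 / m)))).
  apply: ler_wpM2r; first exact: mulr_ge0.
  apply: (le_trans s_le); rewrite ler_pM2l//; apply: lerXn2r.
  - by rewrite nnegrE mulr_ge0.
  - by rewrite nnegrE; exact: mulr_ge0 (ler0n _ _) (mulr_ge0 (ler0n _ 28) nm0).
  - exact: ler_wpM2l.
have -> : 2 * (h%:R * (28 * (n%:R / m))) ^+ (h - 1) * (2 * (9 / m)) =
    36 * (28 * h%:R) ^+ (h - 1) * (n%:R ^+ (h - 1) * (m^-1) ^+ h).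
  rewrite (_ : h%:R * (28 * (n%:R / m)) = (28 * h%:R) * (n%:R / m)); last by ring.
  rewrite exprMn [(n%:R / m) ^+ _]exprMn -[X in m^-1 ^+ X]h1E exprS.
  by move: ((28 * h%:R) ^+ _) (n%:R ^+ _) (m^-1 ^+ (h - 1)) => x1 x2 x3; ring.
have c0 : 0 <= 36 * (28 * h%:R) ^+ (h - 1) :> R.
  by rewrite mulr_ge0 ?exprn_ge0 ?mulr_ge0.
apply: (@le_trans _ _ (36 * (28 * h%:R) ^+ (h - 1) * ((2 * kap) ^+ h * Lg))).
  rewrite ler_wpM2l//.
  apply: (@le_trans _ _ (n%:R ^+ (h - 1) * (2 * t) ^+ h)).
    apply: ler_wpM2l; first by rewrite exprn_ge0.
    apply: lerXn2r => //; first by rewrite nnegrE invr_ge0 ltW.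
    by rewrite nnegrE ltW// mulr_gt0.
  have -> : n%:R ^+ (h - 1) * (2 * t) ^+ h = (2 * kap) ^+ h * Lg; last by [].
  have -> : Lg = Lam ^+ h by rewrite /Lam (rootlnX hh L0).
  rewrite nE /t mulrA exprMn [(Lam / _) ^+ h]exprMn exprVn -exprM mulnC exprM.
  by field; rewrite !expf_neq0// gt_eqF.
have := subcritical_exponent R hh; rewrite -/kap.
set x := 36 * _ * _ => Hx.
have -> : 36 * (28 * h%:R) ^+ (h - 1) * ((2 * kap) ^+ h * Lg) = x * Lg by rewrite mulrA.
have h20 : 0 < (h%:R : R) ^+ 2 by rewrite exprn_gt0.
have hn0 : h%:R != 0 :> R by rewrite gt_eqF.
rewrite -(ler_pM2l h20).
have -> : h%:R ^+ 2 * (Lg / (8 * h%:R ^+ 2)) = 1 / 8 * Lg by field.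
by rewrite mulrA ler_wpM2r.
Qed.

Let mu_h_ge : (Q n)^-1 <= mu ^+ h.
Proof.
apply: (@le_trans _ _ (expR (- (Lg / (8 * h%:R ^+ 2))) ^+ h)); last first.
  by rewrite lerXn2r ?nnegrE ?expR_ge0// (le_trans _ mu_ge)// expR_ge0.
rewrite -expRM_natl /Q -expRN ler_expR mulrN lerN2.
rewrite le_eqVlt -/Lg; apply/orP; left; apply/eqP.
by field; rewrite gt_eqF.
Qed.

Let mu_gt0 : 0 < mu.
Proof. by apply: lt_le_trans mu_ge; exact: expR_gt0. Qed.

Let mu_ge1 : (Q n)^-1 <= mu.
Proof.
apply: (le_trans mu_h_ge); rewrite -[X in mu ^+ X]h1E exprS.
apply: ler_piMr; first exact: ltW.
apply: exprn_ile1; first exact: ltW.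
rewrite muE; apply: exprn_ile1; rewrite ?subr_ge0 ?lerBlDr ?lerDl.
  by rewrite ler_pdivrMr//; have := m18; lra.
by rewrite divr_ge0// ltW.
Qed.

Lemma uncovered_term : h%:R * (100 / (m * mu)) <= 200 * h%:R * Lg / Q n.
Proof.
have -> : 200 * h%:R * Lg / Q n = h%:R * (100 * (2 * (Lg / Q n))) by ring.
rewrite ler_pM2l// ler_pM2l// invfM.
apply: (@le_trans _ _ ((2 * t) * Q n)).
  apply: ler_pM => //; first by rewrite invr_ge0 ltW.
    by rewrite invr_ge0 ltW.
  by rewrite -[leRHS]invrK lef_pV2 ?posrE// invr_gt0.
rewrite -mulrA ler_pM2l//.
apply: (@le_trans _ _ (Lg / N * Q n)); first by rewrite ler_pM2r.
have -> : N = Q n ^+ 8 by rewrite QX.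
rewrite (_ : Lg / Q n ^+ 8 * Q n = Lg * (Q n ^+ 7)^-1); last by field; rewrite gt_eqF.
by rewrite ler_wpM2l// lef_pV2 ?posrE ?exprn_gt0// -[leLHS]expr1 ler_weXn2l.
Qed.

(** The exponent is at least Q ^ 2 * Q ^ -1 / 2 ^ h, and exp (- y) <= 1 / y. *)
Lemma touched_term : expR (- (l%:R * (mu / 2) ^+ h)) <= 2 ^+ h / Q n.
Proof.
have p2 : 0 < (2 : R) ^+ h by rewrite exprn_gt0.
have y_le : Q n / 2 ^+ h <= l%:R * (mu / 2) ^+ h.
  rewrite exprMn exprVn mulrA ler_pM2r ?invr_gt0//.
  apply: (@le_trans _ _ (Q n ^+ 2 * (Q n)^-1)).
    by rewrite expr2 mulfK// gt_eqF.
  apply: ler_pM => //; first by rewrite exprn_ge0// ltW.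
  by rewrite invr_ge0 ltW.
apply: (@le_trans _ _ (expR (- (Q n / 2 ^+ h)))); first by rewrite ler_expR lerN2.
rewrite expRN -[leRHS]invrK invfM invrK mulrC lef_pV2 ?posrE ?expR_gt0 ?divr_gt0//.
  by apply: le_trans (expR_ge1Dx _); rewrite lerDr.
by rewrite mulr_gt0// invr_gt0.
Qed.

End Bounds.

Definition disconnect_error (n : nat) : R :=
  (4 * h%:R ^+ h * 18 ^+ (h - 1) * ln n%:R + 200 * h%:R * ln n%:R + 2 ^+ h) / Q n +
  h%:R * expR (- (1 * ln n%:R)).

Lemma disconnect_error_cvg0 (e : R) : 0 < e -> \forall n \near \oo, disconnect_error n <= e.
Proof.
move=> e0; pose K : R := 4 * h%:R ^+ h * 18 ^+ (h - 1) + 200 * h%:R + 2 ^+ h.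
have K0 : 0 < K.
  apply: ltr_wpDl; last by rewrite exprn_gt0.
  by apply: addr_ge0; rewrite ?mulr_ge0 ?exprn_ge0.
have Ke : 0 <= 2 * K / e by rewrite divr_ge0 ?mulr_ge0// ltW.
have e8 : 0 < (8 * h%:R)^-1 :> R by rewrite invr_gt0 mulr_gt0.
have eh : 0 < e / 2 / h%:R by rewrite !divr_gt0.
near=> n.
have L1 : 1 <= ln (n%:R : R) by near: n; exact: near_ln_ge.
have Q0 : 0 < Q n by exact: expR_gt0.
have H1 : 2 * K / e * ln n%:R <= Q n by near: n; exact: near_expR_ge.
have H2 : expR (- (1 * ln n%:R)) <= e / 2 / h%:R by near: n; exact: near_expRN.
rewrite /disconnect_error [leRHS]splitr; apply: lerD; last first.
  by rewrite mulrC -ler_pdivlMr.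
rewrite ler_pdivrMr//; apply: (@le_trans _ _ (K * ln n%:R)).
  have p0 : 0 <= (2 : R) ^+ h by exact: exprn_ge0.
  rewrite /K; move: (2 ^+ h) p0 (ln n%:R) L1 => y y0 x x1.
  rewrite [leRHS]mulrDl [(_ + 200 * _) * x]mulrDl; apply: lerD; first exact: lexx.
  exact: ler_peMr.
have : K * ln n%:R = e / 2 * (2 * K / e * ln n%:R) by field; rewrite gt_eqF.
by move=> ->; rewrite ler_pM2l// divr_gt0.
Unshelve. all: by end_near. Qed.

Lemma near_disconnected (d : nat -> measure_display)
  (Omega : forall n, measurableType (d n)) (P : forall n, probability (Omega n) R)
  (pos : forall n, 'I_h -> 'I_n -> Omega n -> R * R) :
  (forall n, iid_uniform_positions (P n) (pos n)) ->
  \forall n \near \oo, ((1 - disconnect_error n)%:E <=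
    P n (~` rainbow_event (pos n) (Num.sqrt kap * threshold R h n)))%E.
Proof.
move=> Hpos.
have K36 : 0 < 36^-1 :> R by rewrite invr_gt0 ltr0n.
have e8 : 0 < (8 * h%:R)^-1 :> R by rewrite invr_gt0 mulr_gt0.
near=> n.
have n0 : (0 < n)%N by near: n; exact: nbhs_infty_gt.
have L1 : 1 <= ln (n%:R : R) by near: n; exact: near_ln_ge.
have L0 : 0 <= ln (n%:R : R) by exact: le_trans L1.
have Q2 : 2 <= Q n.
  apply: (@le_trans _ _ (2 * ln n%:R)); first by rewrite ler_peMr.
  by near: n; exact: near_expR_ge.
have Nge : 2 / kap * ln n%:R <= rootn R h n by near: n; exact: near_rootn.
have thr36 : threshold R h n ^+ 2 <= 36^-1 by near: n; exact: near_threshold.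
have thr0 : 0 < threshold R h n.
  by rewrite powR_gt0// divr_gt0 ?exprn_gt0 ?ltr0n// (lt_le_trans ltr01).
have sk0 : 0 < Num.sqrt kap by rewrite sqrtr_gt0.
set r := Num.sqrt kap * threshold R h n.
have r0 : 0 < r by exact: mulr_gt0.
pose t := kap * (rootln R h n / rootn R h n ^+ (h - 1)).
have r2E : r ^+ 2 = t.
  by rewrite exprMn sqr_sqrtr ?(ltW kap0)// (thresholdE hh L0 n0).
have r36 : r ^+ 2 <= 36^-1.
  by rewrite exprMn sqr_sqrtr ?(ltW kap0)// (le_trans _ thr36)// ler_piMl ?sqr_ge0.
have r4 : r <= 1 / 4.
  rewrite -(@ler_pXn2r _ 2) ?nnegrE ?divr_ge0 ?(ltW r0)//.
  by apply: (le_trans r36); lra.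
have [M [M0 rM tm_ge tm_le]] := unit_grid r0 r4.
set m : R := #|{: 'I_M * 'I_M}|%:R in tm_ge tm_le.
have m0 : 0 < m by rewrite ltr0n card_prod card_ord muln_gt0 M0.
have m18 : 18 <= m.
  have : r ^+ 2 * m <= 36^-1 * m by rewrite ler_pM2r.
  by move: tm_ge; move: (r ^+ 2 * m) => y; lra.
rewrite r2E in tm_ge tm_le.
pose D := (Num.truncn (27 * (n%:R / m))).+1.
have nm1 : 1 <= n%:R / m.
  by apply: le_trans (cell_load_ge n0 L1 Nge m0 tm_le); lra.
have D_ge : 27 * (n%:R / m) <= D%:R by rewrite /D; apply/ltW; exact: truncnS_gt.
have D_le : D%:R <= 28 * (n%:R / m).
  apply: (@le_trans _ _ (27 * (n%:R / m) + 1)); last by lra.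
  by rewrite /D -natr1 lerD2r truncn_le mulr_ge0// (le_trans ler01).
pose s := (\sum_(j < h) h ^ j * D ^ j)%N.
have s_le : s%:R <= 2 * (h%:R * D%:R) ^+ (h - 1) :> R.
  rewrite -natrM -natrX -natrM ler_nat /s.
  under eq_bigr do rewrite -expnMn.
  apply: sum_expn_le; last exact: ltnW.
  by apply: (leq_trans hh); exact: leq_pmulr.
pose l := (Num.truncn (Q n ^+ 2)).+1.
have l_ge : Q n ^+ 2 <= l%:R by rewrite /l; apply/ltW; exact: truncnS_gt.
have Q0 : 0 <= Q n by exact: expR_ge0.
have Q22 : 4 <= Q n ^+ 2.
  rewrite (_ : 4 = 2 ^+ 2); last by ring.
  by apply: lerXn2r; rewrite ?nnegrE.
have l_le1 : l%:R <= Q n ^+ 2 + 1.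
  by rewrite /l -natr1 lerD2r truncn_le exprn_ge0.
have l_le : l%:R <= 2 * Q n ^+ 2 by lra.
(* Since Q ^ 2 >= 4, l <= Q ^ 2 + 1 <= Q ^ 4 - 1, while n = Q ^ (8h). *)
have ln1 : (l <= n - 1)%N.
  rewrite -(ler_nat R) natrB// -(rootnX R hh n0) -QX.
  apply: (@le_trans _ _ ((Q n ^+ 2) ^+ 2 - 1)).
    move: (l%:R) (Q n ^+ 2) Q22 l_le1 => y x x4 yx.
    by apply: (le_trans yx); rewrite expr2; have := ler_wpM2l (le_trans _ x4) x4; lra.
  rewrite lerD2r -!exprM; apply: ler_weXn2l; last exact: leq_mul.
  by apply: le_trans Q2; rewrite ler1n.
have [W uW Wl] : exists2 W : {set 'I_n}, Ordinal n0 \notin W & #|W| = l.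
  have /card_geqP [w [uw sw sub]] : (l <= #|~: [set Ordinal n0]|)%N.
    by rewrite cardsC1 card_ord -subn1.
  exists [set x in w]; last by rewrite cardsE (card_uniqP uw).
  by rewrite inE; apply/negP => /sub; rewrite !inE eqxx.
have W0 : W != finset.set0 by rewrite -cards_eq0 Wl.
have m9 : 9 < m by apply: lt_le_trans m18; rewrite ltr_nat.
have n9 : 1 <= n%:R * (9 / m) by rewrite mulrCA; lra.
have := rainbow_event_compl_ge (Hpos n) M0 rM hh uW W0 (leqnn s) m9 n9 erefl.
rewrite Wl -/m; apply: le_trans; rewrite lee_fin lerD2l lerN2.
have -> : disconnect_error n = 4 * h%:R ^+ h * 18 ^+ (h - 1) * ln n%:R / Q n +
    (200 * h%:R * ln n%:R / Q n + 2 ^+ h / Q n + h%:R * expR (- (1 * ln n%:R))).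
  rewrite /disconnect_error.
  move: (4 * _ * _ * _) (200 * _ * _) (2 ^+ h) (Q n)^-1 (h%:R * _) => x1 x2 x3 x4 x5.
  by rewrite mulrDl [(x1 + x2) * x4]mulrDl -!addrA.
apply: lerD; first exact: (linked_term n0 L1 Q2 m0 tm_ge l_le).
rewrite [leRHS]addrC; apply: lerD.
  exact: (degree_term n0 L1 Nge m0 tm_le D_ge).
apply: lerD.
  exact: (uncovered_term n0 L1 Q2 m0 tm_ge m18 D_le s_le erefl).
exact: (touched_term n0 L1 m0 tm_ge m18 D_le s_le l_ge erefl).
Unshelve. all: by end_near. Qed.

Lemma rainbow_disconnected_whp (r : nat -> R) (d : nat -> measure_display)
  (Omega : forall n, measurableType (d n)) (P : forall n, probability (Omega n) R)
  (pos : forall n, 'I_h -> 'I_n -> Omega n -> R * R) (c : R) :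
  (forall n, iid_uniform_positions (P n) (pos n)) ->
  c < 2 / (3 * pi) * (1 / (2 * pi)) ^+ (h - 1) ->
  (forall n : nat, r n <= c * threshold R h n) ->
  (P n (~` rainbow_event (pos n) (r n)))%E @[n --> \oo] --> 1%E.
Proof.
move=> Hpos hc hr.
have mE n s : measurable (rainbow_event (pos n) s).
  by apply: measurable_rainbow_event; case: (Hpos n).
have c_le : c <= Num.sqrt kap.
  apply: (le_trans (ltW hc)).
  have pi0 := pi_gt0 R; have pi8 := pi_sqr_ge8 R.
  set y := _ * _; have y0 : 0 <= y.
    by rewrite mulr_ge0 ?exprn_ge0 ?divr_ge0 ?mulr_ge0// ltW.
  rewrite -(ger0_norm y0) -sqrtr_sqr; apply: ler_wsqrtr.
  rewrite /y exprMn /kap /subcritical exprAC.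
  have pinz : (pi : R) != 0 by rewrite gt_eqF.
  have inv8 : (pi ^+ 2)^-1 <= 8^-1 :> R by rewrite lef_pV2 ?posrE// exprn_gt0.
  have z0 : 0 <= (1 / (2 * pi)) ^+ 2 :> R by exact: sqr_ge0.
  apply: ler_pM.
  - exact: sqr_ge0.
  - exact: exprn_ge0.
  - have -> : (2 / (3 * pi)) ^+ 2 = 4 / 9 * (pi ^+ 2)^-1 :> R.
      by move: pinz; move: (pi : R) => x x0; field.
    by apply: le_trans (ler_wpM2l _ inv8) _; lra.
  - apply: lerXn2r; [by rewrite nnegrE|by rewrite nnegrE invr_ge0|].
    have -> : (1 / (2 * pi)) ^+ 2 = 1 / 4 * (pi ^+ 2)^-1 :> R.
      by move: pinz; move: (pi : R) => x x0; field.
    by apply: le_trans (ler_wpM2l _ inv8) _; lra.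
apply: (@probability_cvg1 _ _ _ _ _ disconnect_error) => [n| |e e0].
- exact: measurableC.
- apply: filterS (near_disconnected Hpos) => n /le_trans; apply.
  apply: le_measure; rewrite ?inE; [exact: measurableC..|].
  apply: subsetC; apply: rainbow_event_mono; apply: (le_trans (hr n)).
  by rewrite ler_wpM2r// powR_ge0.
- exact: disconnect_error_cvg0.
Qed.

End Subcritical.

Unset Implicit Arguments.

Theorem theorem1 (R : realType) (h : nat) (hh : (2 <= h)%N) (r : nat -> R)
  (d : nat -> measure_display) (Omega : forall n : nat, measurableType (d n))
  (P : forall n : nat, probability (Omega n) R)
  (pos : forall n : nat, 'I_h -> 'I_n -> Omega n -> R * R)
  (Hpos : forall n : nat, iid_uniform_positions (P n) (pos n)) :
  (forall b : R,
     (2 ^+ (2 + 3 * (h - 1)) / pi ^+ 3) `^ (1 / (2 * h%:R)) < b ->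
     (forall n : nat,
        b * (ln n%:R / n%:R ^+ (h - 1)) `^ (1 / (2 * h%:R)) <= r n) ->
     (P n (rainbow_event (pos n) (r n)))%E @[n --> \oo] --> 1%E)
  /\
  (forall c : R,
     c < 2 / (3 * pi) * (1 / (2 * pi)) ^+ (h - 1) ->
     (forall n : nat,
        r n <= c * (ln n%:R / n%:R ^+ (h - 1)) `^ (1 / (2 * h%:R))) ->
     (P n (~` rainbow_event (pos n) (r n)))%E @[n --> \oo] --> 1%E).
Proof.
split=> [b hb hr|c hc hr].
  exact: (rainbow_connected_whp hh hb Hpos hr).
exact: (rainbow_disconnected_whp hh Hpos hc hr).
Qed.
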